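(* Let $\tau_0,\tau_1>0$ and $\mathfrak r=\tau_0\tau_1/[2(\tau_0+\tau_1)]$. Let $a>0$, $\mu\in\mathcal G_d^1$, $\dot a\in\mathbb R$, and let $\mu_\varepsilon$ be a smooth curve in $\mathcal G_d^1$ with $\mu_0=\mu$ and tangent $\xi$ at $\varepsilon=0$. Put $\alpha=a\mu$ and $\alpha_\varepsilon=(a+\varepsilon\dot a)\mu_\varepsilon$ (for $|\varepsilon|$ small enough that $a+\varepsilon\dot a>0$). Then, as $\varepsilon\to0$, $$\mathsf U_{\tau_0,\tau_1}(\alpha,\alpha_\varepsilon)=\varepsilon^2g_\alpha^{\rm U}\big((\dot a,\xi),(\dot a,\xi)\big)+o(\varepsilon^2),$$ where $$g_\alpha^{\rm U}\big((\dot a,\xi),(\dot a,\xi)\big)=\frac{\mathfrak r}{a}\dot a^2+a\left(g_{\mathrm{BW},\mu}:\mathfrak r\,g_{\mathrm{FR},\mu}\right)(\xi,\xi).$$ This positive-definite form defines a smooth Riemannian tensor on $\mathcal G_d^+$.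
   Context: $\mathbb S^d$, $\mathbb S_{++}^d$: real symmetric, resp. symmetric positive-definite, $d\times d$ matrices. $\mathcal G_d^1=\{\mathcal N(m,\Sigma):m\in\mathbb R^d,\Sigma\in\mathbb S_{++}^d\}$, identified with the open set $\mathbb R^d\times\mathbb S_{++}^d$; a tangent vector at $\mu=\mathcal N(m,\Sigma)$ is $\xi=(\dot m,H)\in\mathbb R^d\times\mathbb S^d$. $\mathcal G_d^+=\{a\nu:a>0,\nu\in\mathcal G_d^1\}$, a manifold with coordinates $(a,m,\Sigma)$. For finite nonnegative Borel measures, $\mathrm{KL}(\rho\mid\eta)=\int(r\log r-r+1)\,d\eta$ if $\rho\ll\eta$ with $r=d\rho/d\eta$, and $+\infty$ otherwise, and $$\mathsf U_{\tau_0,\tau_1}(\alpha,\beta)=\inf_{\gamma}\Big\{\int\|x-y\|^2\,d\gamma+\tau_0\mathrm{KL}(\gamma_0\mid\alpha)+\tau_1\mathrm{KL}(\gamma_1\mid\beta)\Big\},$$ over finite nonnegative Borel measures $\gamma$ on $\mathbb R^d\times\mathbb R^d$ with first and second marginals $\gamma_0,\gamma_1$. With $\mathcal L_\Sigma(X)=\Sigma X+X\Sigma$, the Bures--Wasserstein and Fisher--Rao forms at $\mu=\mathcal N(m,\Sigma)$ are $$g_{\mathrm{BW},\mu}(\xi,\xi)=\|\dot m\|^2+\tfrac12\operatorname{tr}(H\mathcal L_\Sigma^{-1}H),\qquad g_{\mathrm{FR},\mu}(\xi,\xi)=\dot m^\top\Sigma^{-1}\dot m+\tfrac12\operatorname{tr}(\Sigma^{-1}H\Sigma^{-1}H).$$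 The parallel sum of positive-definite quadratic forms $G,H$ on a finite-dimensional space is $(G:H)(\xi,\xi)=\inf_\eta\{G(\eta,\eta)+H(\xi-\eta,\xi-\eta)\}$ (in matrix form, $(G^{-1}+H^{-1})^{-1}$). *)

(* Defs.v *)
From HB Require Import structures.
From mathcomp Require Import all_boot all_order all_algebra.
From mathcomp Require Import all_classical all_reals all_analysis.
From mathcomp Require Import measurable_realfun.

Set Implicit Arguments.
Unset Strict Implicit.
Unset Printing Implicit Defensive.

Import Order.TTheory GRing.Theory Num.Theory.
Import numFieldNormedType.Exports.

Local Open Scope classical_set_scope.
Local Open Scope ring_scope.

Section image_measure.
Context d1 d2 (T1 : measurableType d1) (T2 : measurableType d2) (R : realType).
Variable f : {mfun T1 >-> T2}.

Definition image_measure (mu : set T1 -> \bar R) : set T2 -> \bar R :=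
  pushforward mu f.

Section measure.
Variable mu : {measure set T1 -> \bar R}.

Let image_measure0 : image_measure mu set0 = 0%E.
Proof. exact: measure0. Qed.

Let image_measure_ge0 A : (0 <= image_measure mu A)%E.
Proof. exact: measure_ge0. Qed.

Let image_measure_sigma_additive : semi_sigma_additive (image_measure mu).
Proof. exact: measure_semi_sigma_additive. Qed.

HB.instance Definition _ := isMeasure.Build _ _ _ (image_measure mu)
  image_measure0 image_measure_ge0 image_measure_sigma_additive.
End measure.

Section finite.
Variable mu : {finite_measure set T1 -> \bar R}.

Let image_measure_finite : fin_num_fun (image_measure mu).
Proof.
by move=> A mA; apply: fin_num_measure; rewrite -[X in measurable X]setTI;
  exact: measurable_funPT.
Qed.

HB.instance Definition _ :=
  Measure_isFinite.Build _ _ _ (image_measure mu) image_measure_finite.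
End finite.
End image_measure.

Section marginals.
Context d1 d2 (T1 : measurableType d1) (T2 : measurableType d2) (R : realType).

HB.instance Definition _ := isMeasurableFun.Build _ _ _ _
  (fst : T1 * T2 -> T1) (@measurable_fst _ _ T1 T2).
HB.instance Definition _ := isMeasurableFun.Build _ _ _ _
  (snd : T1 * T2 -> T2) (@measurable_snd _ _ T1 T2).

Implicit Type gamma : {finite_measure set (T1 * T2)%type -> \bar R}.

Definition marginal1 gamma : {finite_measure set T1 -> \bar R} :=
  image_measure fst gamma.
Definition marginal2 gamma : {finite_measure set T2 -> \bar R} :=
  image_measure snd gamma.
End marginals.

Section KL.
Context d (T : measurableType d) (R : realType).
Local Open Scope charge_scope.

(* [ln 0 = 0] in the library, so the integrand takes the value 1 where the
   density vanishes. *)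
Definition KL (rho eta : {finite_measure set T -> \bar R}) : \bar R :=
  if `[< rho `<< eta >] then
    (\int[eta]_x
       (let r := fine (('d (charge_of_finite_measure rho) '/d eta) x) in
        r * ln r - r + 1)%:E)%E
  else +oo%E.
End KL.

(* R^d as a measurable space: d-tuples of reals with the product sigma-algebra,
   which is the Borel one. Linear algebra is done on column vectors. *)
Notation space R d := (d.-tuple (measurableTypeR R)).

Section unbalanced_transport.
Variables (R : realType) (d : nat).

Definition sqdist (x y : space R d) : R :=
  \sum_(i < d) (tnth x i - tnth y i) ^+ 2.

Definition transport_cost (tau0 tau1 : R)
    (alpha beta : {finite_measure set (space R d) -> \bar R})
    (gamma : {finite_measure set (space R d * space R d)%type -> \bar R}) : \bar R :=
  ((\int[gamma]_p (sqdist p.1 p.2)%:E)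
   + tau0%:E * KL (marginal1 gamma) alpha
   + tau1%:E * KL (marginal2 gamma) beta)%E.

Definition UOT (tau0 tau1 : R)
    (alpha beta : {finite_measure set (space R d) -> \bar R}) : \bar R :=
  ereal_inf (range (transport_cost tau0 tau1 alpha beta)).
End unbalanced_transport.

Section gaussian.
Variable R : realType.

Definition space_cons n (p : space R n * measurableTypeR R) : space R n.+1 :=
  [tuple of p.2 :: p.1].

Let measurable_space_cons n : measurable_fun setT (@space_cons n).
Proof.
exact: (measurable_cons (@measurable_snd _ _ _ _) (@measurable_fst _ _ _ _)).
Qed.

HB.instance Definition _ n := isMeasurableFun.Build _ _ _ _
  (@space_cons n) (@measurable_space_cons n).

Fixpoint lebesgue_space n : {measure set (space R n) -> \bar R} :=
  if n is k.+1 then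
    image_measure (@space_cons k) (lebesgue_space k \x @lebesgue_measure R)%E
  else \d_([tuple] : space R 0).

Definition colv d (x : space R d) : 'cV[R]_d := \col_i tnth x i.

Definition gauss_weight d (m : 'cV[R]_d) (S : 'M[R]_d) (x : space R d) : R :=
  expR (- ((colv x - m)^T *m invmx S *m (colv x - m)) 0 0 / 2).

Lemma measurable_gauss_weight d (m : 'cV[R]_d) (S : 'M[R]_d) :
  measurable_fun setT (gauss_weight m S).
Proof.
apply: measurableT_comp => //; apply: measurable_funM => //.
apply: measurableT_comp => //.
have mc i : measurable_fun setT (fun x : space R d => (colv x - m) i 0).
  rewrite (_ : (fun _ => _) = fun x => tnth x i - m i 0); last first.
    by apply/funext => x; rewrite !mxE.
  apply: measurable_funB => //; exact: measurable_tnth.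
rewrite (_ : (fun _ => _) = fun x => \sum_j ((\sum_k ((colv x - m) k 0
    * invmx S k j)) * (colv x - m) j 0)); last first.
  apply/funext => x; rewrite mxE; apply: eq_bigr => j _.
  by rewrite mxE; congr (_ * _); apply: eq_bigr => k _; rewrite [_^T _ _]mxE.
apply: measurable_sum => j; apply: measurable_funM => //.
by apply: measurable_sum => k; apply: measurable_funM.
Qed.

Definition gauss_unnormalized d (m : 'cV[R]_d) (S : 'M[R]_d)
    (A : set (space R d)) : \bar R :=
  (\int[lebesgue_space d]_(x in A) (gauss_weight m S x)%:E)%E.

Section measure.
Variables (d : nat) (m : 'cV[R]_d) (S : 'M[R]_d).

Let gauss0 : gauss_unnormalized m S set0 = 0%E.
Proof. exact: integral_set0. Qed.

Let gauss_ge0 A : (0 <= gauss_unnormalized m S A)%E.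
Proof. by apply: integral_ge0 => x _; rewrite lee_fin expR_ge0. Qed.

Let gauss_sigma_additive : semi_sigma_additive (gauss_unnormalized m S).
Proof.
apply: semi_sigma_additive_nng_induced => [|x]; last by rewrite lee_fin expR_ge0.
by apply/measurable_EFinP; exact: measurable_gauss_weight.
Qed.

HB.instance Definition _ := isMeasure.Build _ _ _ (gauss_unnormalized m S)
  gauss0 gauss_ge0 gauss_sigma_additive.
End measure.

(* N(m, S): the probability measure whose Lebesgue density is proportional to
   exp (- (x - m)^T S^-1 (x - m) / 2). The Dirac mass only makes [gaussian]
   total; for S positive definite the weight has finite positive mass and the
   default is not used. *)
Definition gaussian d (m : 'cV[R]_d) (S : 'M[R]_d) : probability (space R d) R :=
  mnormalize (gauss_unnormalized m S) (\d_([tuple of nseq d 0] : space R d)).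

(* a N(m, S), meant for a > 0. *)
Definition scaled_gaussian d (a : R) (m : 'cV[R]_d) (S : 'M[R]_d) :
    {finite_measure set (space R d) -> \bar R} :=
  mscale (`|a|%:nng) (gaussian m S).
End gaussian.

Section geometry.
Variables (R : realType) (d : nat).

Definition posdefmx (S : 'M[R]_d) :=
  S^T = S /\ forall v : 'cV[R]_d, v != 0 -> 0 < (v^T *m S *m v) 0 0.

Definition gauss_tangent : set ('cV[R]_d * 'M[R]_d) :=
  [set xi | xi.2^T = xi.2].

Definition lyapunov (S X : 'M[R]_d) : 'M[R]_d := S *m X + X *m S.

(* The inverse is taken on all square matrices; when S is positive definite it
   preserves the symmetric ones. *)
Definition lyapunov_inv (S H : 'M[R]_d) : 'M[R]_d :=
  vec_mx (mxvec H *m invmx (lin_mx (lyapunov S))).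

Definition gBW (S : 'M[R]_d) (xi : 'cV[R]_d * 'M[R]_d) : R :=
  \sum_i xi.1 i 0 ^+ 2 + 2^-1 * \tr (xi.2 *m lyapunov_inv S xi.2).

Definition gFR (S : 'M[R]_d) (xi : 'cV[R]_d * 'M[R]_d) : R :=
  (xi.1^T *m invmx S *m xi.1) 0 0
  + 2^-1 * \tr (invmx S *m xi.2 *m invmx S *m xi.2).

(* Parallel sum, on the subspace T, of quadratic forms given by their values on
   the diagonal. *)
Definition parallel_sum (V : zmodType) (T : set V) (G H : V -> R) (xi : V) : R :=
  inf [set G eta + H (xi - eta) | eta in T].

(* The points p = (a, (m, S)) and the tangent vectors xi = (adot, (mdot, H)) of
   the manifold of scaled Gaussians, in its global chart. *)
Definition gUOT (tau0 tau1 : R) (p xi : R * ('cV[R]_d * 'M[R]_d)) : R :=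
  let a := p.1 in
  let S := p.2.2 in
  let r := tau0 * tau1 / (2 * (tau0 + tau1)) in
  r / a * xi.1 ^+ 2
  + a * parallel_sum gauss_tangent (gBW S) (fun zeta => r * gFR S zeta) xi.2.

Definition scaled_gaussians : set (R * ('cV[R]_d * 'M[R]_d)) :=
  [set p | 0 < p.1 /\ posdefmx p.2.2].

Definition scaled_gauss_tangent : set (R * ('cV[R]_d * 'M[R]_d)) :=
  [set xi | gauss_tangent xi.2].
End geometry.

Section smoothness.
Variable R : realType.

Definition smooth_curve (V : normedModType R) (I : set R) (f : R -> V) :=
  forall n x, I x -> derivable (derive1n n f) x 1.

(* f is of class C^n on U, a relatively open subset of the linear subspace T:
   only directional derivatives along T are taken. *)
Fixpoint Cn_on (V W : normedModType R) (T U : set V) n (f : V -> W) : Prop :=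
  {within U, continuous f} /\
  if n is k.+1 then
    forall v, T v -> (forall x, U x -> derivable f x v) /\ Cn_on T U k ('D_v f)
  else True.

Definition smooth_on (V W : normedModType R) (T U : set V) (f : V -> W) :=
  forall n, Cn_on T U n f.

(* A Riemannian metric on U, open in the linear subspace T, in the global chart
   U; smoothness is that of its components. *)
Record riemannian_metric (V : normedModType R) (T U : set V)
    (g : V -> V -> V -> R) : Prop := {
  metric_sym : forall p, U p -> forall x y, T x -> T y -> g p x y = g p y x;
  metric_linear : forall p, U p -> forall c x y z, T x -> T y -> T z ->
    g p (c *: x + y) z = c * g p x z + g p y z;
  metric_posdef : forall p, U p -> forall x, T x -> x != 0 -> 0 < g p x x;
  metric_smooth : forall x y, T x -> T y -> smooth_on T U (fun p => g p x y) }.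
End smoothness.

(* Main.v *)
(* Write N(m, S) for the base Gaussian and let (v, A), A symmetric, solve
   mdot = v + S v / r and H = S A + A S + S A S / r; with q(x) = s + v.(x - m) +
   (x - m)^T A (x - m) / 2 this is the stationarity condition of the parallel sum.

   Lower bound: by Kantorovich duality with the potentials psi = 2 e q on the target and
   phi = - 2 e q - e^2 |grad q|^2 / (1 - |e| k) on the source, k bounding A. The dual
   functional only involves Gaussian integrals of exponentials of quadratic polynomials,
   known in closed form, which are expanded with
   ln det (1 + M) = tr M - tr M^2 / 2 + o(e^2).

   Upper bound: by the Gaussian plan with first marginal of mean m + (2 e / tau0) S v and
   covariance S + (2 e / tau0) S A S, the target point being drawn around
   x + e grad q(x) with covariance e^4. The noise makes the plan absolutely continuous, so
   that its marginals follow from completing the square; the divergences are divergences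
   between Gaussians and the same expansion of ln det applies.

   The closed form of the parallel sum is rational in the entries of S, with denominators
   that do not vanish on positive definite matrices, whence the smoothness. *)

Require Import Defs.
From HB Require Import structures.
From mathcomp Require Import all_boot all_order all_algebra.
From mathcomp Require Import all_classical all_reals all_analysis.
From mathcomp Require Import measurable_realfun ring lra.

Set Implicit Arguments.
Unset Strict Implicit.
Unset Printing Implicit Defensive.

Import Order.TTheory GRing.Theory Num.Theory.
Import numFieldNormedType.Exports.

Local Open Scope classical_set_scope.
Local Open Scope ring_scope.

Local Notation space R d := (d.-tuple (measurableTypeR R)).

(** * Positive definite matrices *)

Section positive_definite_matrices.
Variable R : realType.

(** The constant [r] comes from penalties in series. To second order [KL] is half the Fisher-Rao
    form, so the two marginal divergences act like [tau0 / 2] and [tau1 / 2] times that form;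
    letting them share a displacement optimally gives their parallel sum, whose constant satisfies
    [r^-1 = 2 / tau0 + 2 / tau1]. Transport adds the Bures-Wasserstein form as a third term of the
    same parallel sum. In the stationarity equations, [v] and [S A + A S] are the transported part
    of [(mdot, H)], while [S v / r] and [S A S / r] are the part absorbed by the divergences. The
    constant term [s] of [q] is dual to the change of mass.

    No optimal coupling is ever studied: [dual_value] and [primal_value] are computed for free
    parameters and coincide at the parameters above. The curve enters through its first-order
    expansion, since a displacement of order [e^2] changes the integral of a potential of order [e]
    by [O(e^3)], and the divergences are quadratic in displacements of order [e]. *)

Definition qform d (P : 'M[R]_d) (v : 'cV[R]_d) : R := (v^T *m P *m v) 0 0.

(** [qform P v] and [bform P v v] have the same body, so the bilinear lemmas reach quadratic forms
    by unfolding [qform] and folding [bform]. *)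
Definition bform d (P : 'M[R]_d) (u v : 'cV[R]_d) : R := (u^T *m P *m v) 0 0.

Lemma bform_tr d (P : 'M[R]_d) u v : bform P^T u v = bform P v u.
Proof.
rewrite /bform -[in RHS](trmxK (v^T *m P *m u)) [RHS]mxE.
by rewrite !trmx_mul trmxK mulmxA.
Qed.

Lemma bformDl d (P : 'M[R]_d) u1 u2 v :
  bform P (u1 + u2) v = bform P u1 v + bform P u2 v.
Proof. by rewrite /bform linearD/= !mulmxDl mxE. Qed.

Lemma bformDr d (P : 'M[R]_d) u v1 v2 :
  bform P u (v1 + v2) = bform P u v1 + bform P u v2.
Proof. by rewrite /bform mulmxDr mxE. Qed.

Lemma bformZl d (P : 'M[R]_d) a u v : bform P (a *: u) v = a * bform P u v.
Proof. by rewrite /bform linearZ/= -!scalemxAl mxE. Qed.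

Lemma bformZr d (P : 'M[R]_d) a u v : bform P u (a *: v) = a * bform P u v.
Proof. by rewrite /bform -!scalemxAr mxE. Qed.

Lemma bformMl d (P Q : 'M[R]_d) u v : bform P (Q *m u) v = bform (Q^T *m P) u v.
Proof. by rewrite /bform trmx_mul !mulmxA. Qed.

Lemma bformMr d (P Q : 'M[R]_d) u v : bform P u (Q *m v) = bform (P *m Q) u v.
Proof. by rewrite /bform !mulmxA. Qed.

Lemma bformMD d (P Q : 'M[R]_d) u v : bform (P + Q) u v = bform P u v + bform Q u v.
Proof. by rewrite /bform mulmxDr mulmxDl mxE. Qed.

Lemma bformMZ d a (P : 'M[R]_d) u v : bform (a *: P) u v = a * bform P u v.
Proof. by rewrite /bform -scalemxAr -scalemxAl mxE. Qed.

Lemma qformD d (P : 'M[R]_d) u v : P^T = P ->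
  qform P (u + v) = qform P u + 2 * bform P u v + qform P v.
Proof.
move=> sP; rewrite /qform -!/(bform _ _ _) !bformDl !bformDr.
rewrite -[bform P v u]bform_tr sP; ring.
Qed.

Lemma qformZ d (P : 'M[R]_d) a u : qform P (a *: u) = a ^+ 2 * qform P u.
Proof. by rewrite /qform -/(bform P _ _) bformZl bformZr mulrA. Qed.

Lemma qformN d (P : 'M[R]_d) u : qform P (- u) = qform P u.
Proof.
by rewrite -scaleN1r qformZ sqrrN expr1n mul1r.
Qed.

Lemma qform0 d (P : 'M[R]_d) : qform P 0 = 0.
Proof. by rewrite /qform mulmx0 mxE. Qed.

Lemma qform_ge0 d (P : 'M[R]_d) v : posdefmx P -> 0 <= qform P v.
Proof.
move=> [_ pP]; have [->|v0] := eqVneq v 0; first by rewrite qform0.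
exact/ltW/pP.
Qed.

Lemma bformE d (P : 'M[R]_d) u v :
  bform P u v = \sum_i \sum_j u i 0 * P i j * v j 0.
Proof.
rewrite /bform mxE exchange_big/=; apply: eq_bigr => j _.
by rewrite mxE mulr_suml; apply: eq_bigr => i _; rewrite [_^T _ _]mxE.
Qed.

Lemma bform_delta d (P : 'M[R]_d) i j :
  bform P (delta_mx i 0) (delta_mx j 0) = P i j.
Proof. by rewrite /bform trmx_delta -rowE -colE !mxE. Qed.

Lemma qform1E d (v : 'cV[R]_d) : qform 1%:M v = \sum_i v i 0 ^+ 2.
Proof. by rewrite /qform mulmx1 mxE; apply: eq_bigr => i _; rewrite mxE expr2. Qed.

Lemma posdef_unit d (P : 'M[R]_d) : posdefmx P -> P \in unitmx.
Proof.
move=> [sP pP]; rewrite unitmxE unitfE.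
apply/det0P => -[v v0 vP].
have := pP v^T; rewrite trmx_eq0 => /(_ v0).
by rewrite trmxK vP mul0mx mxE ltxx.
Qed.

Lemma posdef_inv d (P : 'M[R]_d) : posdefmx P -> posdefmx (invmx P).
Proof.
move=> pdP; have uP := posdef_unit pdP; have [sP pP] := pdP.
split; first by rewrite trmx_inv sP.
move=> v v0; have := pP (invmx P *m v).
rewrite trmx_mul trmx_inv sP -!mulmxA (mulmxA P) mulmxV// mul1mx mulmxA; apply.
by apply: contra_neq v0 => /(congr1 (mulmx P)); rewrite mulmxA mulmxV// mul1mx mulmx0.
Qed.

Lemma posdefD d (P Q : 'M[R]_d) : posdefmx P -> Q^T = Q ->
  (forall v, 0 <= qform Q v) -> posdefmx (P + Q).
Proof.
move=> [sP pP] sQ pQ; split; first by rewrite linearD/= sP sQ.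
move=> v v0; rewrite -/(bform _ _ _) bformMD; apply: ltr_pwDl; first exact: pP.
exact: pQ.
Qed.

Lemma posdefZ d a (P : 'M[R]_d) : 0 < a -> posdefmx P -> posdefmx (a *: P).
Proof.
move=> a0 [sP pP]; split; first by rewrite linearZ/= sP.
by move=> v v0; rewrite -/(bform _ _ _) bformMZ mulr_gt0//; exact: pP.
Qed.

Lemma posdef1 d : posdefmx (1%:M : 'M[R]_d).
Proof.
split; first by rewrite trmx1.
move=> v v0; rewrite -/(qform _ _) qform1E lt_neqAle eq_sym psumr_neq0; last first.
  by move=> i _; rewrite sqr_ge0.
rewrite sumr_ge0 ?andbT; last by move=> i _; rewrite sqr_ge0.
have /existsP[i vi] : [exists i, v i 0 != 0].
  apply: contra_neqT v0; rewrite negb_exists => /forallP v0.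
  by apply/matrixP => i j; rewrite ord1 [RHS]mxE; apply/eqP; have := v0 i; rewrite negbK.
by apply/hasP; exists i; rewrite ?mem_index_enum//= lt_neqAle sqr_ge0 andbT eq_sym sqrf_eq0.
Qed.

(** The entrywise sum stands in for the operator norm, which avoids eigenvalues: each product
    [|v_i| |v_j|] is at most half the sum of the squares, hence at most [|v|^2]. *)
Lemma qform_bound d (P : 'M[R]_d) v :
  `|qform P v| <= (\sum_i \sum_j `|P i j|) * qform 1%:M v.
Proof.
rewrite {1}/qform -/(bform _ _ _) bformE mulr_suml (le_trans (ler_norm_sum _ _ _))//.
apply: ler_sum => i _; rewrite mulr_suml (le_trans (ler_norm_sum _ _ _))//.
apply: ler_sum => j _; rewrite mulrAC normrM mulrC ler_wpM2l// normrM.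
have le1 l : `|v l 0| ^+ 2 <= qform 1%:M v.
  rewrite real_normK ?num_real// qform1E (bigD1 l)//= lerDl.
  by apply: sumr_ge0 => h _; exact: sqr_ge0.
have := le1 i; have := le1 j; have := normr_ge0 (v i 0); have := normr_ge0 (v j 0).
by move: `|v i 0| `|v j 0| => a b; have := sqr_ge0 (a - b); nra.
Qed.

Lemma CauchySchwarz_bform d (P : 'M[R]_d) u v : posdefmx P ->
  bform P u v ^+ 2 <= qform P u * qform P v.
Proof.
move=> pdP; have [sP pP] := pdP.
have [->|v0] := eqVneq v 0; first by rewrite qform0 /bform mulmx0 mxE expr0n/= mulr0.
have qv : 0 < qform P v by exact: pP.
(* This multiple of [v] minimises the form along the line through [u]. *)
have := qform_ge0 (u + (- (bform P u v / qform P v)) *: v) pdP.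
rewrite qformD// bformZr qformZ.
set b := bform P u v; set q := qform P v in qv *; set p := qform P u.
rewrite (_ : _ + _ + _ = p - b ^+ 2 / q); last by field; rewrite gt_eqF.
by rewrite subr_ge0 ler_pdivrMr.
Qed.

(* Apply Cauchy-Schwarz for S to [e_i] and [S^-1 v]. *)
Lemma posdef_coercive d (S : 'M[R]_d) : posdefmx S ->
  exists2 k : R, 0 < k & forall v, k * qform 1%:M v <= qform S v.
Proof.
move=> pdS; have pdI := posdef_inv pdS.
have uS := posdef_unit pdS; have [sS _] := pdS.
(* The trace of the inverse bounds the sum over the coordinates; the added 1 keeps [t] positive in
   dimension 0. *)
set t := 1 + \sum_i (invmx S) i i.
have inv_ge0 i : 0 <= (invmx S) i i.
  by have := qform_ge0 (delta_mx i 0) pdI; rewrite /qform -/(bform _ _ _) bform_delta.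
have t0 : 0 < t by rewrite ltr_pwDl// sumr_ge0.
exists t^-1; first by rewrite invr_gt0.
move=> v; rewrite mulrC ler_pdivrMr// qform1E.
have vi i : v i 0 ^+ 2 <= qform S v * (invmx S) i i.
  have := CauchySchwarz_bform v (invmx S *m delta_mx i 0) pdS.
  rewrite bformMr mulmxV// {2}/qform -/(bform _ _ _) bformMr mulmxV//.
  rewrite bformMl trmx_inv sS mulmx1.
  by rewrite {1}/bform mulmx1 -colE !mxE /qform -/(bform _ _ _) bform_delta.
apply: (le_trans (ler_sum _ (fun i _ => vi i))).
rewrite -mulr_sumr ler_wpM2l ?qform_ge0// lerDr//.
Qed.

Section schur.
Variables (n : nat) (P : 'M[R]_(1 + n)).

(** Eliminating the first coordinate in this way drives the inductions on the dimension for
    determinants, Gaussian integrals and the expansion of the log-determinant. *)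
Definition schur := drsubmx P - (P 0 0)^-1 *: (dlsubmx P *m ursubmx P).

Lemma schur_decomp : P 0 0 != 0 ->
  P = block_mx 1%:M 0 ((P 0 0)^-1 *: dlsubmx P) 1%:M
      *m block_mx (ulsubmx P) (ursubmx P) 0 schur.
Proof.
move=> c0; rewrite mulmx_block !mul1mx !mul0mx !addr0.
rewrite -!scalemxAl /schur addrCA subrr addr0.
have -> : (P 0 0)^-1 *: (dlsubmx P *m ulsubmx P) = dlsubmx P.
  rewrite (mx11_scalar (ulsubmx P)) mul_mx_scalar scalerA.
  rewrite (_ : ulsubmx P 0 0 = P 0 0) ?mulVf ?scale1r//.
  by rewrite !mxE; congr (P _ _); apply: val_inj.
by rewrite submxK.
Qed.

Lemma det_schur : P 0 0 != 0 -> \det P = P 0 0 * \det schur.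
Proof.
move=> c0; rewrite {1}schur_decomp// det_mulmx det_lblock det_ublock !det1 !mul1r.
rewrite det_mx11; congr (_ * _).
by rewrite !mxE; congr (P _ _); apply: val_inj.
Qed.

(** Completing the square in the first coordinate, so that a Gaussian integral splits into a
    one-dimensional one and one in dimension [n]. *)
Lemma qform_schur (x : R) (v : 'cV[R]_n) : P^T = P -> P 0 0 != 0 ->
  qform P (col_mx x%:M v) =
  P 0 0 * (x + (P 0 0)^-1 * (ursubmx P *m v) 0 0) ^+ 2 + qform schur v.
Proof.
move=> sP c0; set c := P 0 0.
have ulE : ulsubmx P = c%:M.
  rewrite (mx11_scalar (ulsubmx P)) /c; congr (_%:M).
  by rewrite !mxE; congr (P _ _); apply: val_inj.
have dlE : dlsubmx P = (ursubmx P)^T by rewrite trmx_ursub sP.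
rewrite /qform -[P in LHS]submxK tr_col_mx mul_row_block mul_row_col ulE dlE.
rewrite tr_scalar_mx !mulmxDl.
set l := ursubmx P.
have lvE : v^T *m l^T = (l *m v)^T by rewrite trmx_mul.
rewrite lvE; set y := (l *m v) 0 0.
rewrite -[x%:M *m l *m v]mulmxA (mx11_scalar (l *m v)) -/y -!scalar_mxM.
rewrite /schur -/c -/l mulmxBr mulmxBl.
rewrite -scalemxAr -scalemxAl dlE mulmxA -[_ *m l *m v]mulmxA lvE.
rewrite (mx11_scalar (l *m v)) -/y tr_scalar_mx -scalar_mxM.
move: (_ *m drsubmx P *m v) => Z.
by rewrite -scalar_mxM !mxE !eqxx !mulr1n; field.
Qed.

Hypothesis pdP : posdefmx P.

Lemma posdef_head_gt0 : 0 < P 0 0.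
Proof.
have := pdP.2 (col_mx 1%:M 0).
have -> : ((col_mx 1%:M 0 : 'cV_(1 + n))^T *m P *m col_mx 1%:M 0) 0 0 = P 0 0.
  rewrite -[P in LHS]submxK tr_col_mx trmx0 mul_row_block mul_row_col trmx1.
  rewrite !mul1mx !mul0mx mulmx0 mulmx1 !addr0.
  by rewrite !mxE; congr (P _ _); apply: val_inj.
by apply; rewrite col_mx_eq0 negb_and oner_neq0.
Qed.

Lemma posdef_schur : posdefmx schur.
Proof.
have c0 := posdef_head_gt0; have sP := pdP.1.
split.
  rewrite /schur linearB/= linearZ/= trmx_mul trmx_drsub trmx_dlsub trmx_ursub sP.
  by [].
move=> v v0; rewrite -/(qform _ _).
(* The first coordinate is the one that cancels the square in [qform_schur]. *)
have := pdP.2 (col_mx (- ((P 0 0)^-1 * (ursubmx P *m v) 0 0))%:M v).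
rewrite -/(qform _ _) qform_schur ?gt_eqF// addNr expr0n/= mulr0 add0r; apply.
by rewrite col_mx_eq0 negb_and v0 orbT.
Qed.

End schur.

Lemma posdef_det_gt0 d (P : 'M[R]_d) : posdefmx P -> 0 < \det P.
Proof.
elim: d P => [P _|n IH P pdP]; first by rewrite det_mx00.
rewrite (@det_schur n P) ?gt_eqF ?(@posdef_head_gt0 n P)//.
by rewrite mulr_gt0 ?(@posdef_head_gt0 n P)//; exact/IH/(@posdef_schur n P).
Qed.

End positive_definite_matrices.

(** * Gaussian integrals *)

Section product_sigma_finite.
Context d1 d2 (T1 : measurableType d1) (T2 : measurableType d2) (R : realType).

(** Sigma-finiteness of [m1] is a hypothesis and not a structure, which is the form required by an
    induction along the recursive [lebesgue_space]. *)
Lemma sigma_finite_product (m1 : {measure set T1 -> \bar R})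
    (m2 : {sigma_finite_measure set T2 -> \bar R}) :
  sigma_finite setT m1 -> sigma_finite setT (m1 \x m2)%E.
Proof.
move=> /sigma_finiteP[F [TF ndF Foo]].
have /sigma_finiteP[G [TG ndG Goo]] := sigma_finiteT m2.
exists (fun n => F n `*` G n).
  rewrite -setXTT TF TG predeqE => -[x y]; split.
    move=> [/= [i _ Fix] [k _ Gky]]; exists (maxn i k) => //; split.
    - by move: x Fix; exact/subsetPset/ndF/leq_maxl.
    - by move: y Gky; exact/subsetPset/ndG/leq_maxr.
  by move=> [i _ []/= ? ?]; split; exists i.
move=> k; have [? ?] := Foo k; have [? ?] := Goo k.
split; first exact: measurableX.
by rewrite product_measure1E// lte_mul_pinfty// ge0_fin_numE.
Qed.

(* The library's product of two probabilities hides the sigma-finite instance of [\x]. *)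
Definition sfprod (m1 : {sigma_finite_measure set T1 -> \bar R})
    (m2 : {sigma_finite_measure set T2 -> \bar R}) : set (T1 * T2) -> \bar R :=
  (m1 \x m2)%E.

HB.instance Definition _ m1 m2 := Measure.on (sfprod m1 m2).
HB.instance Definition _ m1 m2 := @Measure_isSigmaFinite.Build _ _ _ (sfprod m1 m2)
  (sigma_finite_product m2 (sigma_finiteT m1)).

End product_sigma_finite.

Section gaussian_integral.
Variable R : realType.

Let space_uncons n (x : space R n.+1) : space R n * measurableTypeR R :=
  ([tuple of behead x], thead x).

Let measurable_space_uncons n : measurable_fun setT (@space_uncons n).
Proof.
apply: measurable_fun_pair; first exact: measurable_behead.
exact: measurable_tnth.
Qed.

Let space_consK n : cancel (@space_cons R n) (@space_uncons n).
Proof. by case=> t x; rewrite /space_uncons theadE; congr pair; exact: val_inj. Qed.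

Lemma sigma_finite_lebesgue_space n : sigma_finite setT (lebesgue_space R n).
Proof.
elim: n => [|n IH] /=.
  exists (fun=> setT); first by rewrite bigcup_const.
  by move=> _; split=> //; rewrite /= diracT ltry.
have [F FT Foo] := sigma_finite_product (@lebesgue_measure R) IH.
(* Pulling the exhausting sets back along the inverse of [space_cons] makes their pushed-forward
   measure equal to the product measure of [F i]. *)
exists (fun i => @space_uncons n @^-1` F i).
  by rewrite -preimage_bigcup -FT preimage_setT.
move=> i; have [mF Fi] := Foo i; split.
  by rewrite -[X in measurable X]setTI; exact: measurable_space_uncons.
rewrite /image_measure/= /pushforward -comp_preimage.
rewrite (_ : _ \o _ = id) ?preimage_id//.
by apply/funext => x; exact: space_consK.
Qed.

(* [lebesgue_space] repackaged with its sigma-finiteness. *)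
Definition leb n : set (space R n) -> \bar R := lebesgue_space R n.
HB.instance Definition _ n := Measure.on (@leb n).
HB.instance Definition _ n :=
  @Measure_isSigmaFinite.Build _ _ _ (@leb n) (@sigma_finite_lebesgue_space n).

Lemma integral_leb0 (f : space R 0 -> \bar R) :
  (\int[@leb 0]_x f x)%E = f [tuple].
Proof.
rewrite [LHS]integral_dirac//; first by rewrite diracT mul1e.
move=> _ B mB; have [Bf|Bf] := pselect (B (f [tuple])).
  rewrite (_ : _ `&` _ = setT)//; apply/seteqP; split=> // x _.
  by split=> //=; rewrite (tuple0 x).
rewrite (_ : _ `&` _ = set0)//; apply/seteqP; split=> // x [_] /=.
by rewrite (tuple0 x).
Qed.

Lemma integral_lebS n (f : space R n.+1 -> \bar R) :
  measurable_fun setT f -> (forall x, 0 <= f x)%E ->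
  (\int[@leb n.+1]_x f x =
   \int[@leb n]_x \int[@lebesgue_measure R]_y f (space_cons (x, y)))%E.
Proof.
move=> mf f0.
rewrite [LHS](@ge0_integral_pushforward _ _ _ _ _ (@space_cons R n)
  (@measurable_funPT _ _ _ _ (@space_cons R n)) ((@leb n) \x @lebesgue_measure R)%E setT f)//.
rewrite preimage_setT.
rewrite (@fubini_tonelli1 _ _ _ _ R (@leb n) (@lebesgue_measure R) (f \o @space_cons R n))//.
exact: (measurableT_comp mf (@measurable_funPT _ _ _ _ (@space_cons R n))).
by move=> x; exact: f0.
Qed.

(** Read off from the total mass of the normal density of standard deviation [c^(-1/2)]. *)
Lemma integral_gauss_1d (c m : R) : 0 < c ->
  (\int[@lebesgue_measure R]_x (expR (- (c * (x - m) ^+ 2) / 2))%:E =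
   (Num.sqrt (2 * pi) / Num.sqrt c)%:E)%E.
Proof.
move=> c0; pose s := (Num.sqrt c)^-1.
have sc0 : 0 < Num.sqrt c by rewrite sqrtr_gt0.
have s0 : s != 0 by rewrite gt_eqF// invr_gt0.
have s2 : s ^+ 2 = c^-1 by rewrite exprVn sqr_sqrtr// ltW.
have := integral_normal_pdf m s.
under eq_integral do rewrite normal_pdfE// EFinM.
rewrite ge0_integralZl//=; first last.
  by rewrite lee_fin normal_peak_ge0.
  by move=> x _; rewrite lee_fin normal_fun_ge0.
  by apply/measurable_EFinP; exact: measurable_normal_fun.
have p0 := normal_peak_gt0 s0.
under eq_integral => x _.
  rewrite (_ : normal_fun m s x = expR (- (c * (x - m) ^+ 2) / 2)); last first.
    rewrite /normal_fun s2; congr expR; rewrite -mulr_natl; field.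
    by rewrite gt_eqF.
  over.
move=> /(congr1 (fun z => (normal_peak s)^-1%:E * z)%E).
rewrite muleA -EFinM mulVf ?gt_eqF// mul1e => ->.
rewrite mule1 /normal_peak invrK s2 -mulr_natr.
rewrite (_ : c^-1 * pi * 2 = (2 * pi) * c^-1); last by ring.
by rewrite sqrtrM ?mulr_ge0 ?pi_ge0// sqrtrV// ltW.
Qed.

Lemma colv_space_cons n (x : space R n) (y : R) :
  colv (space_cons (x, y)) = col_mx y%:M (colv x) :> 'cV_(1 + n).
Proof.
apply/matrixP => i j; rewrite ord1 !mxE; case: splitP => k ik.
  rewrite !ord1 mxE eqxx mulr1n.
  by rewrite (_ : i = ord0) ?tnth0//; apply: val_inj; rewrite /= ik ord1.
rewrite mxE !(tnth_nth 0)/=. rewrite ik.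
by [].
Qed.

Lemma measurable_qform d (P : 'M[R]_d) (m : 'cV[R]_d) :
  measurable_fun setT (fun x : space R d => qform P (colv x - m)).
Proof.
have mc i : measurable_fun setT (fun x : space R d => (colv x - m) i 0).
  rewrite (_ : (fun _ => _) = fun x => tnth x i - m i 0); last first.
    by apply/funext => x; rewrite !mxE.
  apply: measurable_funB => //; exact: measurable_tnth.
rewrite (_ : (fun _ => _) = fun x : space R d => \sum_i \sum_j
   (colv x - m) i 0 * P i j * (colv x - m) j 0); last first.
  by apply/funext => x; rewrite /qform -/(bform _ _ _) bformE.
apply: measurable_sum => i; apply: measurable_sum => j.
by do 2 apply: measurable_funM => //.
Qed.

Lemma qform_schur_center n (P : 'M[R]_(1 + n)) (m : 'cV[R]_(1 + n)) (y : R) v :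
  P^T = P -> P 0 0 != 0 ->
  qform P (col_mx y%:M v - m) =
  P 0 0 * (y - (usubmx m 0 0 -
    (P 0 0)^-1 * (ursubmx P *m (v - dsubmx m)) 0 0)) ^+ 2
  + qform (schur P) (v - dsubmx m).
Proof.
move=> sP c0; rewrite -{1}[m]vsubmxK opp_col_mx add_col_mx.
rewrite {1}(mx11_scalar (usubmx m)) -raddfB/= qform_schur//.
by congr (_ * _ ^+ 2 + _); ring.
Qed.

(** The centre of the inner integral depends on the other coordinates but its value does not, so
    what remains is the Gaussian of the Schur complement; [\det P] factors in the same way. *)
Lemma integral_gauss d (P : 'M[R]_d) (m : 'cV[R]_d) : posdefmx P ->
  (\int[@leb d]_x (expR (- qform P (colv x - m) / 2))%:E =
   (Num.sqrt (2 * pi) ^+ d / Num.sqrt (\det P))%:E)%E.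
Proof.
elim: d P m => [P m _|n IH P m pdP].
  rewrite integral_leb0 det_mx00 sqrtr1 divr1 expr0.
  by rewrite (_ : colv _ - m = 0) ?qform0 ?oppr0 ?mul0r ?expR0//; apply/matrixP => -[].
rewrite integral_lebS; last 2 first.
- apply/measurable_EFinP; apply: measurableT_comp => //; apply: measurable_funM => //.
  by apply: measurableT_comp => //; exact: measurable_qform.
- by move=> x; rewrite lee_fin expR_ge0.
have c0 := @posdef_head_gt0 _ n P pdP.
have pdS := @posdef_schur _ n P pdP.
pose m1 := usubmx (m : 'cV_(1 + n)) 0 0; pose m2 := dsubmx (m : 'cV_(1 + n)).
under eq_integral => x _.
  under eq_integral => y _.
    rewrite (_ : - _ / 2 = - (P 0 0 * (y - (m1 - (P 0 0)^-1 *
        (ursubmx (P : 'M[R]_(1 + n)) *m (colv x - m2)) 0 0)) ^+ 2) / 2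
        + - qform (@schur _ n P) (colv x - m2) / 2); last first.
      rewrite colv_space_cons (@qform_schur_center n P m _ _ pdP.1) ?gt_eqF//.
      by rewrite opprD mulrDl.
    rewrite expRD EFinM; over.
  rewrite ge0_integralZr//=; first last.
    apply/measurable_EFinP; apply: measurableT_comp => //; apply: measurable_funM => //.
    apply: measurableT_comp => //; apply: measurable_funM => //.
    by apply: measurable_funX => //; apply: measurable_funB.
  rewrite integral_gauss_1d//; over.
rewrite ge0_integralZl//=; first last.
  apply/measurable_EFinP; apply: measurableT_comp => //; apply: measurable_funM => //.
  by apply: measurableT_comp => //; exact: measurable_qform.
rewrite IH// -EFinM (@det_schur _ n P) ?gt_eqF// (@sqrtrM _ (P 0 0)) ?ltW//.
by rewrite [in RHS]exprS invfM; congr EFin; ring.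
Qed.

End gaussian_integral.

(** * Densities and relative entropy *)

Section has_integral.
Context d (T : measurableType d) (R : realType).
Implicit Types (mu : {measure set T -> \bar R}) (f g : T -> R).

(** Integrability and value travel together, so that integrals can be combined linearly without
    separate side conditions. *)
Definition has_int (mu : set T -> \bar R) (f : T -> R) (v : R) :=
  mu.-integrable setT (EFin \o f) /\ (\int[mu]_x (f x)%:E = v%:E)%E.

Lemma has_intD mu f g a b :
  has_int mu f a -> has_int mu g b -> has_int mu (fun x => f x + g x) (a + b).
Proof.
move=> [fi fa] [gi gb]; split.
  rewrite (_ : EFin \o _ = (EFin \o f) \+ (EFin \o g))%E; first exact: integrableD.
  by apply/funext => x; rewrite /= EFinD.
under eq_integral do rewrite EFinD.
by rewrite integralD// fa gb.
Qed.

Lemma has_intZ mu f a k : has_int mu f a -> has_int mu (fun x => k * f x) (k * a).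
Proof.
move=> [fi fa]; split.
  rewrite (_ : EFin \o _ = fun x => k%:E * (EFin \o f) x)%E; first exact: integrableZl.
  by apply/funext => x; rewrite /= EFinM.
under eq_integral do rewrite EFinM.
by rewrite integralZl// fa.
Qed.

Lemma has_intB mu f g a b :
  has_int mu f a -> has_int mu g b -> has_int mu (fun x => f x - g x) (a - b).
Proof.
move=> fa /(has_intZ (-1)) gb.
have := has_intD fa gb; rewrite mulN1r.
by congr has_int; apply/funext => x; rewrite mulN1r.
Qed.

Lemma has_int_cst (mu : {finite_measure set T -> \bar R}) k a :
  mu setT = a%:E -> has_int mu (fun=> k) (k * a).
Proof.
move=> mua; split; first exact: finite_measure_integrable_cst.
by rewrite integral_cst// EFinM -mua.
Qed.

Lemma has_int_le mu f g a b :
  has_int mu f a -> has_int mu g b -> (forall x, f x <= g x) -> a <= b.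
Proof.
move=> [fi fa] [gi gb] fg; rewrite -lee_fin -fa -gb.
by apply: le_integral => // x _; rewrite lee_fin.
Qed.

Lemma ge0_has_int mu f v : measurable_fun setT f -> (forall x, 0 <= f x) ->
  (\int[mu]_x (f x)%:E = v%:E)%E -> has_int mu f v.
Proof.
move=> mf f0 fv; split=> //; apply/integrableP; split; first exact/measurable_EFinP.
by under eq_integral => x _ do rewrite /= ger0_norm//; rewrite fv ltry.
Qed.

Lemma integrable_has_int mu f : mu.-integrable setT (EFin \o f) ->
  exists v, has_int mu f v.
Proof.
move=> fi; exists (fine (\int[mu]_x (f x)%:E)); split=> //.
by rewrite fineK//; exact: integrable_fin_num.
Qed.

Lemma dominated_has_int mu f g v : measurable_fun setT f -> has_int mu g v ->
  (forall x, `|f x| <= g x) -> exists w, has_int mu f w.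
Proof.
move=> mf [gi _] fg; apply: integrable_has_int.
apply: le_integrable gi => //; first exact/measurable_EFinP.
by move=> x _ /=; rewrite lee_fin (le_trans (fg x))// ler_norm.
Qed.

End has_integral.

Section densities.
Context d (T : measurableType d) (R : realType).

(** An explicit representative defined at every point, to be computed with; the abstract
    Radon-Nikodym derivatives agree with it almost everywhere. *)
Definition density (mu nu : set T -> \bar R) (f : T -> R) :=
  [/\ measurable_fun setT f, forall x, 0 <= f x &
   forall A, measurable A -> (nu A = \int[mu]_(x in A) (f x)%:E)%E].

Variables (mu : {sigma_finite_measure set T -> \bar R})
          (nu : {finite_measure set T -> \bar R}).

Lemma density_exists : nu `<< mu -> exists f, density mu nu f.
Proof.
move=> numu; exists (fine \o Radon_Nikodym_SigmaFinite.f nu mu); split.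
- apply: measurableT_comp => //.
  exact: measurable_int (Radon_Nikodym_SigmaFinite.f_integrable numu).
- by move=> x /=; rewrite fine_ge0//; exact: Radon_Nikodym_SigmaFinite.f_ge0.
- move=> A mA; rewrite (Radon_Nikodym_SigmaFinite.f_integral numu)//.
  by apply: eq_integral => x _ /=; rewrite fineK//; exact: Radon_Nikodym_SigmaFinite.f_fin_num.
Qed.

Variable f : T -> R.
Hypothesis fP : density mu nu f.

Lemma density_dominates : nu `<< mu.
Proof.
have [mf f0 nuE] := fP.
apply/null_content_dominatesP => A mA A0.
by rewrite nuE// null_set_integral//; exact/measurable_funTS/measurable_EFinP.
Qed.

Lemma density_has_int : has_int mu f (fine (nu setT)).
Proof.
have [mf f0 nuE] := fP.
apply: ge0_has_int => //.
by rewrite -nuE// fineK// fin_num_measure.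
Qed.

Lemma density_ae_eq :
  ae_eq mu setT (EFin \o f) (Radon_Nikodym_SigmaFinite.f nu mu).
Proof.
have [mf f0 nuE] := fP.
apply: integral_ae_eq => //; first by case: density_has_int.
  exact: measurable_int (Radon_Nikodym_SigmaFinite.f_integrable density_dominates).
move=> A _ mA; rewrite -nuE// (Radon_Nikodym_SigmaFinite.f_integral density_dominates)//.
Qed.

Lemma ge0_integral_density g : measurable_fun setT g -> (forall x, 0 <= g x)%E ->
  (\int[nu]_x g x = \int[mu]_x (g x * (f x)%:E))%E.
Proof.
have [mf f0 nuE] := fP => mg g0.
rewrite -(Radon_Nikodym_SigmaFinite.change_of_variables density_dominates)//.
apply: ae_eq_integral => //.
- apply: emeasurable_funM => //.
  exact: measurable_int (Radon_Nikodym_SigmaFinite.f_integrable density_dominates).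
- by apply: emeasurable_funM => //; exact/measurable_EFinP.
- exact/ae_eqe_mul2l/ae_eq_sym/density_ae_eq.
Qed.

Lemma has_int_density g v : measurable_fun setT g ->
  has_int nu g v <-> has_int mu (fun x => g x * f x) v.
Proof.
have [mf f0 nuE] := fP => mg.
have main : nu.-integrable setT (EFin \o g) <->
    mu.-integrable setT (EFin \o (fun x => g x * f x)).
  have E : (\int[nu]_x `|(g x)%:E| = \int[mu]_x `|(g x * f x)%:E|)%E.
    rewrite ge0_integral_density//; last exact/measurableT_comp/measurable_EFinP.
    by apply: eq_integral => x _; rewrite EFinM abseM/= (ger0_norm (f0 x)).
  have mgf : measurable_fun setT (EFin \o (fun x => g x * f x)).
    by apply/measurable_EFinP; exact: measurable_funM.
  split=> /integrableP[_ h]; apply/integrableP; split=> //=.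
  - by rewrite -E.
  - exact/measurable_EFinP.
  - by rewrite E.
have E : nu.-integrable setT (EFin \o g) ->
    (\int[nu]_x (g x)%:E = \int[mu]_x (g x * f x)%:E)%E.
  move=> gi.
  rewrite -(Radon_Nikodym_change_of_variables density_dominates)//.
  apply: ae_eq_integral => //.
  - apply: emeasurable_funM => //; first exact/measurable_EFinP.
    exact/measurable_int/Radon_Nikodym_integrable/density_dominates.
  - by apply/measurable_EFinP; exact: measurable_funM.
  - under [X in ae_eq _ _ _ X]eq_fun do rewrite EFinM.
    apply: ae_eqe_mul2l; apply: ae_eq_sym.
    apply: ae_eq_trans density_ae_eq _.
    exact: ae_eq_Radon_Nikodym_SigmaFinite density_dominates _ measurableT.
split=> -[gi gv]; split.
- exact/main.
- by rewrite -E.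
- exact/main.
- by rewrite E//; exact/main.
Qed.

End densities.

Section entropy.
Variable R : realType.

Definition entf (r : R) : R := r * ln r - r + 1.

(** [entf] and [expR t - 1] are convex conjugates. For [r > 0] this is [1 + u <= expR u] at
    [u = t - ln r], multiplied by [r]. *)
Lemma young_entf (r t : R) : 0 <= r -> r * t <= entf r + (expR t - 1).
Proof.
rewrite le_eqVlt => /orP[/eqP<-|r0].
  by rewrite /entf !mul0r subr0 add0r addrC subrK expR_ge0.
have := expR_ge1Dx (t - ln r); rewrite expRD expRN lnK// => h.
have := ler_wpM2l (ltW r0) h.
rewrite mulrCA mulfV ?gt_eqF// mulr1 /entf; lra.
Qed.

Lemma entf_ge0 (r : R) : 0 <= r -> 0 <= entf r.
Proof. by move=> /(young_entf 0); rewrite mulr0 expR0 subrr addr0. Qed.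

Lemma measurable_entf : measurable_fun setT entf.
Proof.
apply: measurable_funD => //; apply: measurable_funB => //.
by apply: measurable_funM => //; exact: measurable_ln.
Qed.

Context d (T : measurableType d).
Variables rho eta : {finite_measure set T -> \bar R}.

(** Makes [KL] computable by replacing the Radon-Nikodym derivative of its definition by an explicit
    density. *)
Lemma KL_density f : density eta rho f -> KL rho eta = (\int[eta]_x (entf (f x))%:E)%E.
Proof.
move=> fP; have [mf f0 _] := fP; have dom := density_dominates fP.
rewrite /KL asboolT//.
have aeq : ae_eq eta setT (EFin \o f) (Radon_Nikodym (charge_of_finite_measure rho) eta).
  apply: ae_eq_trans (density_ae_eq fP) _.
  exact: ae_eq_Radon_Nikodym_SigmaFinite.
apply: ae_eq_integral => //.
- apply/measurable_EFinP; apply: (measurableT_comp measurable_entf).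
  apply: measurableT_comp => //.
- by apply/measurable_EFinP; exact: measurableT_comp measurable_entf _.
- by apply: filterS aeq => x /= h _; rewrite -h.
Qed.

Lemma KL_ge0 : (0 <= KL rho eta)%E.
Proof.
have [dom|ndom] := pselect (rho `<< eta); last by rewrite /KL asboolF// leey.
have [f fP] := density_exists dom; rewrite (KL_density fP).
by apply: integral_ge0 => x _; rewrite lee_fin entf_ge0//; case: fP.
Qed.

(* Donsker-Varadhan duality, from Young's inequality for [entf]. *)
Lemma KL_dual (h : T -> R) (k u v w : R) : measurable_fun setT h ->
  KL rho eta = k%:E -> eta setT = u%:E ->
  has_int eta (expR \o h) v -> has_int eta (fun x => expR (- h x)) w ->
  exists2 z, has_int rho h z & z <= k + (v - u).
Proof.
move=> mh KLk etau hv hw.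
have dom : rho `<< eta.
  by apply: contrapT => ndom; move: KLk; rewrite /KL asboolF.
have [f fP] := density_exists dom; have [mf f0 _] := fP.
rewrite (KL_density fP) in KLk.
have entk : has_int eta (entf \o f) k.
  by apply: ge0_has_int => // [|x]; [exact: measurableT_comp measurable_entf _|exact: entf_ge0].
have one : has_int eta (fun=> 1) (1 * u) by exact: has_int_cst.
have hfk := has_intD entk (has_intB hv one).
(* Young's inequality at [|h x|] dominates [|h| f] by [entf f + expR h + expR (- h)]; the integral
   [w] enters here. *)
have [z hz] : exists z, has_int eta (fun x => h x * f x) z.
  apply: (dominated_has_int _ (has_intD entk (has_intD hv hw))).
    exact: measurable_funM.
  move=> x /=; rewrite normrM (ger0_norm (f0 x)) mulrC.
  have [h0|h0] := leP 0 (h x).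
    apply: (le_trans (young_entf _ (f0 x))); rewrite lerD2l.
    by rewrite ger0_norm//; have := expR_ge0 (- h x); lra.
  apply: (le_trans (young_entf _ (f0 x))); rewrite lerD2l.
  by rewrite ltr0_norm//; have := expR_ge0 (h x); lra.
exists z; first exact/(has_int_density fP _ mh).
rewrite mul1r in hfk; apply: (has_int_le hz hfk) => x /=.
by rewrite mulrC; exact: young_entf.
Qed.

End entropy.

(** * Transport duality *)

Section transport_duality.
Variables (R : realType) (d : nat).
Lemma has_int_image d1 d2 (T1 : measurableType d1) (T2 : measurableType d2)
    (f : {mfun T1 >-> T2}) (mu : {measure set T1 -> \bar R}) (g : T2 -> R) v :
  measurable_fun setT g ->
  has_int (image_measure f mu) g v <-> has_int mu (g \o f) v.
Proof.
move=> mg; have mf : measurable_fun setT f by exact: measurable_funPT.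
have meg : measurable_fun setT (EFin \o g) by exact/measurable_EFinP.
have main : mu.-integrable setT (EFin \o (g \o f)) ->
    (\int[image_measure f mu]_x (g x)%:E = \int[mu]_x (g (f x))%:E)%E.
  move=> gi; rewrite [LHS](integral_pushforward mf (D := setT))//.
split=> -[gi gv].
  have gi' : mu.-integrable setT (EFin \o (g \o f)).
    apply/integrableP; split; first exact/measurable_EFinP/measurableT_comp.
    move/integrableP : gi => [_]; rewrite ge0_integral_pushforward//.
    exact: measurableT_comp.
  by split=> //; rewrite -main.
split; last by rewrite main.
exact: (integrable_pushforward mf).
Qed.

Lemma measurable_sqdist :
  measurable_fun setT (fun p : space R d * space R d => sqdist p.1 p.2).
Proof.
apply: measurable_sum => i; apply: measurable_funX; apply: measurable_funB.
- by apply: (measurableT_comp (f := fun x : space R d => tnth x i)) => //; exact: measurable_tnth.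
- by apply: (measurableT_comp (f := fun x : space R d => tnth x i)) => //; exact: measurable_tnth.
Qed.

Lemma sqdist_ge0 (x y : space R d) : 0 <= sqdist x y.
Proof. by apply: sumr_ge0 => i _; exact: sqr_ge0. Qed.

Variables (tau0 tau1 : R).
Hypotheses (tau0_gt0 : 0 < tau0) (tau1_gt0 : 0 < tau1).
Variables alpha beta : {finite_measure set (space R d) -> \bar R}.

Lemma UOT_ge0 : (0 <= UOT tau0 tau1 alpha beta)%E.
Proof.
apply: le_ereal_inf_tmp => _ [gamma _ <-]; rewrite /transport_cost.
apply: adde_ge0; first apply: adde_ge0.
- by apply: integral_ge0 => p _; rewrite lee_fin sqdist_ge0.
- by rewrite mule_ge0 ?KL_ge0// lee_fin ltW.
- by rewrite mule_ge0 ?KL_ge0// lee_fin ltW.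
Qed.

(** Weak duality: [KL_dual] at [- phi / tau0] and [- psi / tau1] bounds the two divergences of any
    plan from below, and the constraint on [phi] and [psi] bounds its cost. The values [w0] and [w1]
    supply the integrability of the potentials against the plan. *)
Lemma UOT_ge_dual (phi psi : space R d -> R) (a b v0 w0 v1 w1 : R) :
  measurable_fun setT phi -> measurable_fun setT psi ->
  (forall x y, phi x + psi y <= sqdist x y) ->
  alpha setT = a%:E -> beta setT = b%:E ->
  has_int alpha (fun x => expR (- (phi x / tau0))) v0 ->
  has_int alpha (fun x => expR (phi x / tau0)) w0 ->
  has_int beta (fun x => expR (- (psi x / tau1))) v1 ->
  has_int beta (fun x => expR (psi x / tau1)) w1 ->
  ((tau0 * (a - v0) + tau1 * (b - v1))%:E <= UOT tau0 tau1 alpha beta)%E.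
Proof.
move=> mphi mpsi phipsi aE bE hv0 hw0 hv1 hw1.
apply: le_ereal_inf_tmp => _ [gamma _ <-]; rewrite /transport_cost.
set I := (\int[_]__ _)%E; set K0 := KL _ _; set K1 := KL _ _.
have I0 : (0 <= I)%E by apply: integral_ge0 => p _; rewrite lee_fin sqdist_ge0.
have K00 : (0 <= K0)%E by exact: KL_ge0.
have K10 : (0 <= K1)%E by exact: KL_ge0.
(* As soon as one of the three terms is infinite, so is the total, and the bound is trivial; the
   duality argument concerns the finite case. *)
case K0E : K0 K00 => [k0| |]// K00; last first.
  by rewrite gt0_muley ?lte_fin// addey// ?addye// ?leey// -ltNye ?(lt_le_trans _ I0)//
     (lt_le_trans _ (mule_ge0 _ K10)) ?lee_fin ?ltW.
case K1E : K1 K10 => [k1| |]// K10; last first.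
  by rewrite gt0_muley ?lte_fin// addey ?leey// -ltNye (lt_le_trans _ (adde_ge0 I0 _))//
     lee_fin mulr_ge0// ltW.
case IE : I I0 => [i| |]// I0; last by rewrite -EFinM -EFinM leey.
have mphi0 : measurable_fun setT (fun x => - (phi x / tau0)).
  by apply: measurableT_comp => //; exact: measurable_funM.
have mpsi1 : measurable_fun setT (fun x => - (psi x / tau1)).
  by apply: measurableT_comp => //; exact: measurable_funM.
have [|z0 hz0 z0k] := KL_dual mphi0 K0E aE hv0 (w := w0).
  by under eq_fun do rewrite opprK.
have [|z1 hz1 z1k] := KL_dual mpsi1 K1E bE hv1 (w := w1).
  by under eq_fun do rewrite opprK.
have hI : has_int gamma (fun p => sqdist p.1 p.2) i.
  by apply: ge0_has_int => //; [exact: measurable_sqdist|move=> p; exact: sqdist_ge0].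
have /(has_intZ (- tau0)) g0 := (has_int_image fst gamma z0 mphi0).1 hz0.
have /(has_intZ (- tau1)) g1 := (has_int_image snd gamma z1 mpsi1).1 hz1.
have := has_int_le (has_intD g0 g1) hI.
have h : forall p : space R d * space R d,
    - tau0 * ((fun x => - (phi x / tau0)) \o fst) p +
    - tau1 * ((fun x => - (psi x / tau1)) \o snd) p <= sqdist p.1 p.2.
  move=> p /=; rewrite !mulrNN.
  have -> : tau0 * (phi p.1 / tau0) = phi p.1 by rewrite mulrC divfK ?gt_eqF.
  by have -> : tau1 * (psi p.2 / tau1) = psi p.2 by rewrite mulrC divfK ?gt_eqF.
move=> /(_ h) le_i.
rewrite -!EFinM -!EFinD lee_fin.
have := ler_wpM2l (ltW tau0_gt0) z0k; have := ler_wpM2l (ltW tau1_gt0) z1k.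
nra.
Qed.

End transport_duality.

(** * Densities and exponential moments of Gaussian measures *)

Section gaussian_densities.
Variables (R : realType) (d : nat).
Implicit Types (m l : 'cV[R]_d) (S B : 'M[R]_d).

(** The total mass of [gauss_weight m S], written with the determinant of the precision matrix
    because [integral_gauss] is stated for that matrix. *)
Definition gauss_mass S : R := Num.sqrt (2 * pi) ^+ d / Num.sqrt (\det (invmx S)).

Lemma gauss_mass_gt0 S : posdefmx S -> 0 < gauss_mass S.
Proof.
move=> /posdef_inv/posdef_det_gt0 h; rewrite /gauss_mass divr_gt0 ?sqrtr_gt0//.
by rewrite exprn_gt0// sqrtr_gt0 mulr_gt0// pi_gt0.
Qed.

Lemma gauss_weightE m S (x : space R d) :
  gauss_weight m S x = expR (- qform (invmx S) (colv x - m) / 2).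
Proof. by []. Qed.

Lemma gauss_unnormalizedT m S : posdefmx S ->
  gauss_unnormalized m S setT = (gauss_mass S)%:E.
Proof.
by move=> pS; rewrite -(integral_gauss m (posdef_inv pS)).
Qed.

Lemma scaled_gaussianE a m S A : 0 <= a -> posdefmx S ->
  scaled_gaussian a m S A =
  (\int[@leb R d]_(x in A) (gauss_weight m S x)%:E * (a / gauss_mass S)%:E)%E.
Proof.
move=> a0 pS; have M0 := gauss_mass_gt0 pS.
rewrite /scaled_gaussian/= /mscale/= (ger0_norm a0) /gaussian /mnormalize/=.
rewrite gauss_unnormalizedT// eqe gt_eqF//= EFinM muleCA.
by [].
Qed.

Lemma scaled_gaussianT a m S : 0 <= a -> scaled_gaussian a m S setT = a%:E.
Proof.
move=> a0; rewrite /scaled_gaussian/= /mscale/= (ger0_norm a0).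
by rewrite [X in (_ * X)%E](@probability_setT _ _ _ (gaussian m S)) mule1.
Qed.

Lemma scaled_gaussian_density a m S : 0 <= a -> posdefmx S ->
  density (@leb R d) (scaled_gaussian a m S)
    (fun x => a / gauss_mass S * gauss_weight m S x).
Proof.
move=> a0 pS; have M0 := gauss_mass_gt0 pS.
have mw : measurable_fun setT (EFin \o gauss_weight m S).
  by apply/measurable_EFinP; exact: measurable_gauss_weight.
split.
- by apply: measurable_funM => //; exact: measurable_gauss_weight.
- by move=> x; rewrite mulr_ge0 ?expR_ge0// divr_ge0// ltW.
move=> A mA; rewrite scaled_gaussianE// muleC.
under [RHS]eq_integral do rewrite EFinM.
rewrite ge0_integralZl//.
- exact: measurable_funTS.
- by move=> x _; rewrite lee_fin expR_ge0.
- by rewrite lee_fin divr_ge0// ltW.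
Qed.

Definition dotv (u v : 'cV[R]_d) : R := bform 1%:M u v.

Lemma measurable_dotv l m : measurable_fun setT (fun x : space R d => dotv l (colv x - m)).
Proof.
rewrite (_ : (fun _ => _) = fun x : space R d => \sum_i l i 0 * (tnth x i - m i 0)).
  apply: measurable_sum => i; apply: measurable_funM => //.
  by apply: measurable_funB => //; exact: measurable_tnth.
apply/funext => x; rewrite /dotv /bform mulmx1 mxE.
by apply: eq_bigr => i _; rewrite !mxE.
Qed.

Lemma qform_complete_square (L : 'M[R]_d) (l v : 'cV[R]_d) : posdefmx L ->
  qform L v + 2 * dotv l v = qform L (v + invmx L *m l) - qform (invmx L) l.
Proof.
move=> pL; have uL := posdef_unit pL; have [sL _] := pL.
rewrite qformD// bformMr mulmxV//.
have -> : qform L (invmx L *m l) = qform (invmx L) l.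
  by rewrite {1}/qform -/(bform _ _ _) bformMr mulmxV// bformMl mulmx1 trmx_inv sL.
by rewrite addrK /dotv -[bform _ l v]bform_tr trmx1.
Qed.

(* The exponential moments of a Gaussian: complete the square. *)
Lemma has_int_gauss_exp a m S B l : 0 <= a -> posdefmx S -> posdefmx (invmx S + B) ->
  has_int (scaled_gaussian a m S)
    (fun x => expR (- (qform B (colv x - m) / 2 + dotv l (colv x - m))))
    (a * expR (qform (invmx (invmx S + B)) l / 2) / Num.sqrt (\det (1%:M + S *m B))).
Proof.
move=> a0 pS; set L := invmx S + B => pL.
have uS := posdef_unit pS; have M0 := gauss_mass_gt0 pS.
have mq : measurable_fun setT (fun x : space R d =>
    expR (- (qform B (colv x - m) / 2 + dotv l (colv x - m)))).
  apply: measurableT_comp => //; apply: measurableT_comp => //.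
  apply: measurable_funD; last exact: measurable_dotv.
  by apply: measurable_funM => //; exact: measurable_qform.
apply/(has_int_density (scaled_gaussian_density m a0 pS)) => //.
set K := a / gauss_mass S * expR (qform (invmx L) l / 2).
have K0 : 0 <= K by rewrite mulr_ge0 ?expR_ge0// divr_ge0// ltW.
have E (x : space R d) : expR (- (qform B (colv x - m) / 2 + dotv l (colv x - m))) *
    (a / gauss_mass S * gauss_weight m S x) =
    K * expR (- qform L (colv x - (m - invmx L *m l)) / 2).
  rewrite gauss_weightE mulrCA -expRD /K -[RHS]mulrA -expRD; congr (_ * expR _).
  rewrite (_ : colv x - (m - _) = (colv x - m) + invmx L *m l); last first.
    by rewrite opprB addrA addrAC.
  have := qform_complete_square l (colv x - m) pL.
  have -> : qform L (colv x - m) = qform (invmx S) (colv x - m) + qform B (colv x - m).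
    by rewrite /qform -/(bform _ _ _) bformMD.
  by lra.
rewrite (_ : (fun x => _) = fun x : space R d =>
    K * expR (- qform L (colv x - (m - invmx L *m l)) / 2)); last exact/funext.
have := integral_gauss (m - invmx L *m l) pL => hG.
rewrite (_ : a * _ / _ = K * (Num.sqrt (2 * pi) ^+ d / Num.sqrt (\det L))); last first.
  rewrite /K /gauss_mass.
  have -> : \det (1%:M + S *m B) = \det L / \det (invmx S).
    rewrite -[1%:M](mulmxV uS) -mulmxDr det_mulmx det_inv invrK.
    by rewrite mulrC.
  have dL := posdef_det_gt0 pL; have dS := posdef_det_gt0 (posdef_inv pS).
  rewrite (@sqrtrM _ (\det L)) ?ltW// sqrtrV ?ltW//.
  have p0 : 0 < Num.sqrt (2 * pi) ^+ d :> R.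
    by rewrite exprn_gt0// sqrtr_gt0 mulr_gt0// pi_gt0.
  move: (Num.sqrt (2 * pi) ^+ d) p0 => p p0.
  by field; rewrite !gt_eqF ?sqrtr_gt0.
apply: has_intZ; apply: ge0_has_int => //.
apply: measurableT_comp => //; apply: measurable_funM => //.
by apply: measurableT_comp => //; exact: measurable_qform.
Qed.

End gaussian_densities.

(** * Second-order expansions at zero *)

Section limits_at_zero.
Variable R : realType.
Implicit Types (f g h : R -> R) (k l : R).

(** The limit is punctured so that quotients by powers of [e] can be simplified; the point 0 itself
    is treated separately in [lim0_near_sandwich]. *)
Definition lim0 f l := f e @[e --> (0 : R)^'] --> l.

Lemma lim0_near f g l : (\forall e \near (0 : R)^', f e = g e) -> lim0 f l -> lim0 g l.
Proof.
move=> fg; apply: cvg_trans; apply: near_eq_cvg.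
by apply: filterS fg => e ->.
Qed.

Lemma near0_neq0 : \forall e \near (0 : R)^', e != 0.
Proof. exact: nbhs_dnbhs_neq. Qed.

Lemma lim0_ext f g l : (forall e, e != 0 -> f e = g e) -> lim0 f l -> lim0 g l.
Proof.
by move=> fg; apply: lim0_near; apply: filterS near0_neq0 => e; exact: fg.
Qed.

Lemma lim0_eq f k l : k = l -> lim0 f k -> lim0 f l. Proof. by move=> ->. Qed.

Lemma lim0_cst k : lim0 (fun=> k) k. Proof. exact: cvg_cst. Qed.

Arguments lim0_cst : clear implicits.

Lemma lim0_id : lim0 (fun e => e) 0.
Proof. by apply: cvg_trans (cvg_within _) _. Qed.

Lemma lim0D f g k l : lim0 f k -> lim0 g l -> lim0 (fun e => f e + g e) (k + l).
Proof. exact: cvgD. Qed.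

Lemma lim0N f k : lim0 f k -> lim0 (fun e => - f e) (- k).
Proof. exact: cvgN. Qed.

Lemma lim0B f g k l : lim0 f k -> lim0 g l -> lim0 (fun e => f e - g e) (k - l).
Proof. exact: cvgB. Qed.

Lemma lim0M f g k l : lim0 f k -> lim0 g l -> lim0 (fun e => f e * g e) (k * l).
Proof. exact: cvgM. Qed.

Lemma lim0V f k : k != 0 -> lim0 f k -> lim0 (fun e => (f e)^-1) k^-1.
Proof. exact: cvgV. Qed.

Lemma lim0X f k n : lim0 f k -> lim0 (fun e => f e ^+ n) (k ^+ n).
Proof.
move=> fk; elim: n => [|n IH]; first exact: lim0_cst.
by under eq_fun do rewrite exprS; rewrite exprS; exact: lim0M.
Qed.

Arguments lim0X {f k} n.

Lemma lim0_sum (I : Type) (r : seq I) (P : pred I) (F : I -> R -> R) (v : I -> R) :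
  (forall i, lim0 (F i) (v i)) ->
  lim0 (fun e => \sum_(i <- r | P i) F i e) (\sum_(i <- r | P i) v i).
Proof.
move=> Fv; elim: r => [|i r IH].
  by rewrite big_nil; under eq_fun do rewrite big_nil; exact: lim0_cst.
rewrite big_cons; under eq_fun do rewrite big_cons.
by case: (P i) => //; exact: lim0D.
Qed.

Lemma lim0_prod (I : Type) (r : seq I) (P : pred I) (F : I -> R -> R) (v : I -> R) :
  (forall i, lim0 (F i) (v i)) ->
  lim0 (fun e => \prod_(i <- r | P i) F i e) (\prod_(i <- r | P i) v i).
Proof.
move=> Fv; elim: r => [|i r IH].
  by rewrite big_nil; under eq_fun do rewrite big_nil; exact: lim0_cst.
rewrite big_cons; under eq_fun do rewrite big_cons.
by case: (P i) => //; exact: lim0M.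
Qed.

Lemma lim0_gt f k l : l < k -> lim0 f k -> \forall e \near (0 : R)^', l < f e.
Proof. by move=> lk fk; exact: (cvgr_gt k). Qed.

Lemma lim0_lt f k l : k < l -> lim0 f k -> \forall e \near (0 : R)^', f e < l.
Proof. by move=> lk fk; exact: (cvgr_lt k). Qed.

Lemma lim0_quot f k : lim0 (fun e => f e / e) k -> lim0 f 0.
Proof.
move=> fk; apply: (lim0_ext (f := fun e => f e / e * e)).
  by move=> e e0; rewrite divfK.
by apply: (lim0_eq _ (lim0M fk lim0_id)); rewrite mulr0.
Qed.

(* A function of cubic order is negligible at second order along [f = O(e)]. *)
Lemma lim0_cubic (phi : R -> R) C (r : R) f k : 0 < r ->
  (forall x, `|x| <= r -> `|phi x| <= C * `|x| ^+ 3) ->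
  lim0 (fun e => f e / e) k -> lim0 (fun e => phi (f e) / e ^+ 2) 0.
Proof.
move=> r0 phiC fk; have f0 := lim0_quot fk.
apply/norm_cvg0P.
apply: (squeeze_cvgr (f := fun=> 0) (h := fun e => C * `|f e / e| ^+ 3 * `|e|)).
- near=> e; rewrite normr_ge0/=.
  have fr : `|f e| <= r by near: e; apply: (cvgr_norm_le 0) => //; rewrite normr0.
  have e0 : e != 0 by near: e; exact: near0_neq0.
  rewrite normrM normfV normrX (normrM (f e)) normfV.
  rewrite ler_pdivrMr ?exprn_gt0 ?normr_gt0//.
  apply: (le_trans (phiC _ fr)).
  rewrite (_ : C * (`|f e| / `|e|) ^+ 3 * `|e| * `|e| ^+ 2 = C * `|f e| ^+ 3)//.
  by field; rewrite normr_eq0.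
- exact: cvg_cst.
- rewrite -[X in _ --> X](mulr0 (C * `|k| ^+ 3)); apply: cvgM.
    apply: cvgM; first exact: cvg_cst.
    by apply: (@lim0X (fun e => `|f e / e|)); exact: (cvg_norm fk).
  by rewrite -[X in _ --> X](@normr0 _ R); apply: cvg_norm; exact: lim0_id.
Unshelve. all: by end_near. Qed.

(** By the mean value theorem between 0 and [x], the factor [x] turns a quadratic bound on the
    derivative into a cubic one with the same constant. The radius 1/2 keeps [1 + x] away from 0
    when the lemma is applied to the logarithm. *)
Lemma taylor_bound (phi dphi : R -> R) (C : R) :
  phi 0 = 0 -> (forall x : R, `|x| <= 2^-1 -> is_derive x 1 phi (dphi x)) ->
  (forall x : R, `|x| <= 2^-1 -> `|dphi x| <= C * `|x| ^+ 2) ->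
  forall x : R, `|x| <= 2^-1 -> `|phi x| <= C * `|x| ^+ 3.
Proof.
move=> phi0 dP dC x x2.
have cont y : `|y| <= 2^-1 -> {for y, continuous phi}.
  by move=> y2; apply: differentiable_continuous; apply/derivable1_diffP; have [] := dP _ y2.
have C0 : 0 <= C.
  have := dC 2^-1; rewrite ger0_norm// => /(_ (lexx _)) /(le_trans (normr_ge0 _)).
  by rewrite pmulr_lge0// exprn_gt0.
suff [c cx ->] : exists2 c, `|c| <= `|x| & phi x = dphi c * x.
  rewrite normrM exprS mulrCA [leRHS]mulrC ler_wpM2r//.
  apply: (le_trans (dC c (le_trans cx x2))); rewrite ler_wpM2l//.
  by rewrite lerXn2r// nnegrE.
have [x0|x0] := leP 0 x.
  have x2' : x <= 2^-1 by rewrite -(ger0_norm x0).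
  have [y||c cx] := @MVT_segment R phi dphi 0 x x0.
  - rewrite in_itv/= => /andP[y0 yx]; apply: dP.
    by rewrite gtr0_norm//; lra.
  - apply: continuous_in_subspaceT => y; rewrite inE/= in_itv/= => /andP[y0 yx].
    by apply: cont; rewrite ger0_norm// (le_trans yx).
  rewrite phi0 !subr0 => ->; exists c => //.
  by move: cx; rewrite in_itv/= => /andP[c0 cx]; rewrite !ger0_norm.
have x2' : - x <= 2^-1 by rewrite -(ltr0_norm x0).
have [y||c cx] := @MVT_segment R phi dphi x 0 (ltW x0).
- rewrite in_itv/= => /andP[xy y0]; apply: dP.
  by rewrite ltr0_norm//; lra.
- apply: continuous_in_subspaceT => y; rewrite inE/= in_itv/= => /andP[xy y0].
  by apply: cont; rewrite ler0_norm//; lra.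
rewrite phi0 sub0r sub0r mulrN => /oppr_inj ->; exists c => //.
move: cx; rewrite in_itv/= => /andP[xc c0]; rewrite (ler0_norm c0) (ltr0_norm x0); lra.
Qed.

(** The inequality [1 + t <= expR t] at [x] gives the sign, and at [- x] it gives
    [expR x * (1 - x) <= 1], so that the difference is at most [x^2 / (1 - x)]. *)
Lemma expR_sub1_bound (x : R) : `|x| <= 2^-1 -> `|expR x - 1 - x| <= 2 * `|x| ^+ 2.
Proof.
move=> x2; have lo := expR_ge1Dx x; have := expR_ge1Dx (- x).
rewrite expRN => hi; have {}x2 : x <= 2^-1 by rewrite (le_trans _ x2)// ler_norm.
have : expR x * (1 - x) <= 1 by rewrite mulrC -ler_pdivlMr ?expR_gt0// div1r.
rewrite ger0_norm; last by lra.
rewrite real_normK ?num_real// => h; nra.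
Qed.

Lemma expR_taylor2 (x : R) : `|x| <= 2^-1 ->
  `|expR x - 1 - x - x ^+ 2 / 2| <= 2 * `|x| ^+ 3.
Proof.
apply: (taylor_bound (phi := fun x => expR x - 1 - x - x ^+ 2 / 2)
  (dphi := fun x => expR x - 1 - x)).
- by rewrite expR0 expr0n/= mul0r !subr0 subrr.
- move=> y _; apply: is_derive_eq.
  by rewrite !subr0 /GRing.scale/= !mulr1; field.
- exact: expR_sub1_bound.
Qed.

Lemma ln_taylor2 (x : R) : `|x| <= 2^-1 ->
  `|ln (1 + x) - x + x ^+ 2 / 2| <= 2 * `|x| ^+ 3.
Proof.
apply: (taylor_bound (phi := fun x => ln (1 + x) - x + x ^+ 2 / 2)
  (dphi := fun x => x ^+ 2 / (1 + x))).
- by rewrite addr0 ln1 expr0n/= mul0r addr0 subr0.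
- move=> y y2; have y0 : 0 < 1 + y by move: y2; rewrite ler_norml; lra.
  have d1 : is_derive y 1 (fun x => 1 + x) 1.
    by apply: is_derive_eq; rewrite add0r mulr1.
  have d2 := @is_derive1_comp _ (@ln R) (fun x => 1 + x) y _ _ (is_derive1_ln y0) d1.
  apply: is_derive_eq.
  by rewrite /GRing.scale/= !mulr1; field; rewrite gt_eqF.
- move=> y y2; have y0 : 2^-1 <= 1 + y by move: y2; rewrite ler_norml; lra.
  rewrite normrM normfV (ger0_norm (x := 1 + y)); last by lra.
  rewrite normrX mulrC ler_wpM2r ?exprn_ge0//.
  by rewrite -[leRHS]invrK lef_pV2// posrE; lra.
Qed.

Lemma lim0_ln f k : lim0 (fun e => f e / e) k ->
  lim0 (fun e => (ln (1 + f e) - f e) / e ^+ 2) (- (k ^+ 2 / 2)).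
Proof.
move=> fk; have r0 : 0 < 2^-1 :> R by rewrite invr_gt0.
have h := lim0_cubic r0 ln_taylor2 fk.
apply: (lim0_ext (f := fun e => (ln (1 + f e) - f e + f e ^+ 2 / 2) / e ^+ 2
    - (f e / e) ^+ 2 * 2^-1)); first by move=> e e0; field.
apply: (lim0_eq _ (lim0B h (lim0M (lim0X 2 fk) (lim0_cst _)))); ring.
Qed.

Lemma lim0_exp f k : lim0 (fun e => f e / e) k ->
  lim0 (fun e => (expR (f e) - 1 - f e) / e ^+ 2) (k ^+ 2 / 2).
Proof.
move=> fk; have r0 : 0 < 2^-1 :> R by rewrite invr_gt0.
have h := lim0_cubic r0 expR_taylor2 fk.
apply: (lim0_ext (f := fun e => (expR (f e) - 1 - f e - f e ^+ 2 / 2) / e ^+ 2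
    + (f e / e) ^+ 2 * 2^-1)); first by move=> e e0; field.
apply: (lim0_eq _ (lim0D h (lim0M (lim0X 2 fk) (lim0_cst _)))); ring.
Qed.

End limits_at_zero.
Arguments lim0_cst {R} k.
Arguments lim0X {R f k} n.

(** * Entrywise limits of matrices and the log-determinant *)

Section matrix_limits.
Variable R : realType.

(** Entrywise convergence reduces products, determinants and inverses of matrices to sums and
    products of real limits. *)
Definition mlim m n (M : R -> 'M[R]_(m, n)) (N : 'M[R]_(m, n)) :=
  forall i j, lim0 (fun e => M e i j) (N i j).

Lemma mlim_near m n (M M' : R -> 'M[R]_(m, n)) N :
  (\forall e \near (0 : R)^', M e = M' e) -> mlim M N -> mlim M' N.
Proof.
move=> MM' MN i j; apply: (lim0_near _ (MN i j)).
by apply: filterS MM' => e ->.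
Qed.

Lemma mlim_ext m n (M M' : R -> 'M[R]_(m, n)) N :
  (forall e, e != 0 -> M e = M' e) -> mlim M N -> mlim M' N.
Proof.
by move=> MM'; apply: mlim_near; apply: filterS (near0_neq0 R) => e; exact: MM'.
Qed.

Lemma mlim_eq m n (M : R -> 'M[R]_(m, n)) N N' : N = N' -> mlim M N -> mlim M N'.
Proof. by move=> ->. Qed.

Lemma mlim_cst m n (N : 'M[R]_(m, n)) : mlim (fun=> N) N.
Proof. by move=> i j; exact: lim0_cst. Qed.

Lemma mlimD m n (M M' : R -> 'M[R]_(m, n)) N N' :
  mlim M N -> mlim M' N' -> mlim (fun e => M e + M' e) (N + N').
Proof.
by move=> MN MN' i j; rewrite mxE; under eq_fun do rewrite mxE; exact: lim0D.
Qed.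

Lemma mlimZ m n f k (M : R -> 'M[R]_(m, n)) N :
  lim0 f k -> mlim M N -> mlim (fun e => f e *: M e) (k *: N).
Proof.
by move=> fk MN i j; rewrite mxE; under eq_fun do rewrite mxE; exact: lim0M.
Qed.

Lemma mlimN m n (M : R -> 'M[R]_(m, n)) N : mlim M N -> mlim (fun e => - M e) (- N).
Proof.
by move=> MN i j; rewrite mxE; under eq_fun do rewrite mxE; exact: lim0N.
Qed.

Lemma mlimB m n (M M' : R -> 'M[R]_(m, n)) N N' :
  mlim M N -> mlim M' N' -> mlim (fun e => M e - M' e) (N - N').
Proof. by move=> MN /mlimN; exact: mlimD. Qed.

Lemma mlimM m n p (M : R -> 'M[R]_(m, n)) (M' : R -> 'M[R]_(n, p)) N N' :
  mlim M N -> mlim M' N' -> mlim (fun e => M e *m M' e) (N *m N').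
Proof.
move=> MN MN' i j; rewrite mxE; under eq_fun do rewrite mxE.
by apply: lim0_sum => k; exact: lim0M.
Qed.

Lemma mlim_trmx m n (M : R -> 'M[R]_(m, n)) N : mlim M N -> mlim (fun e => (M e)^T) N^T.
Proof. by move=> MN i j; rewrite mxE; under eq_fun do rewrite mxE; exact: MN. Qed.

Lemma lim0_tr n (M : R -> 'M[R]_n) N : mlim M N -> lim0 (fun e => \tr (M e)) (\tr N).
Proof. by move=> MN; apply: lim0_sum => i; exact: MN. Qed.

Lemma lim0_det n (M : R -> 'M[R]_n) N : mlim M N -> lim0 (fun e => \det (M e)) (\det N).
Proof.
move=> MN; rewrite /determinant; apply: lim0_sum => s.
by apply: lim0M; [exact: lim0_cst|apply: lim0_prod => i; exact: MN].
Qed.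

Lemma mlim_inv n (M : R -> 'M[R]_n) N : N \in unitmx -> mlim M N ->
  mlim (fun e => invmx (M e)) (invmx N).
Proof.
move=> uN MN; have dN : \det N != 0 by move: uN; rewrite unitmxE unitfE.
(* The adjugate formula holds for [invmx] on invertible matrices only, hence for [M e] with [e]
   close to 0. *)
apply: (mlim_near (M := fun e => (\det (M e))^-1 *: \adj (M e))).
  have h : \forall e \near (0 : R)^', \det (M e) != 0.
    by apply: (cvgr_neq0 (\det N)) => //; exact: lim0_det.
  by apply: filterS h => e h; rewrite /invmx unitmxE unitfE h.
rewrite /invmx uN; apply: mlimZ; first by apply: lim0V => //; exact: lim0_det.
move=> i j; rewrite mxE; under eq_fun do rewrite mxE.
apply: lim0M; first exact: lim0_cst.
by apply: lim0_det => k l; rewrite !mxE; under eq_fun do rewrite !mxE; exact: MN.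
Qed.

Lemma lim0_bform n (P : R -> 'M[R]_n) (u v : R -> 'cV[R]_n) P0 u0 v0 :
  mlim P P0 -> mlim u u0 -> mlim v v0 ->
  lim0 (fun e => bform (P e) (u e) (v e)) (bform P0 u0 v0).
Proof.
move=> PP uu vv; apply: (mlimM (mlimM (mlim_trmx uu) PP) vv).
Qed.

Lemma lim0_qform n (P : R -> 'M[R]_n) (u : R -> 'cV[R]_n) P0 u0 :
  mlim P P0 -> mlim u u0 -> lim0 (fun e => qform (P e) (u e)) (qform P0 u0).
Proof. by move=> PP uu; exact: lim0_bform. Qed.

Lemma mlim_quot m n (M : R -> 'M[R]_(m, n)) N :
  mlim (fun e => e^-1 *: M e) N -> mlim M 0.
Proof.
move=> MN; apply: (mlim_ext (M := fun e => e *: (e^-1 *: M e))).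
  by move=> e e0; rewrite scalerA mulfV// scale1r.
by apply: (mlim_eq _ (mlimZ (@lim0_id R) MN)); rewrite scale0r.
Qed.

(** The coercivity constant of [P] eventually exceeds the entrywise size of [Q e], which controls
    its quadratic form by [qform_bound]. *)
Lemma posdef_near n (P : 'M[R]_n) (Q : R -> 'M[R]_n) : posdefmx P ->
  (\forall e \near (0 : R)^', (Q e)^T = Q e) -> mlim Q 0 ->
  \forall e \near (0 : R)^', posdefmx (P + Q e).
Proof.
move=> pP sQ Q0; have [k k0 Pk] := posdef_coercive pP.
have s0 : lim0 (fun e => \sum_i \sum_j `|Q e i j|) 0.
  have h : lim0 (fun e => \sum_i \sum_j `|Q e i j|)
      (\sum_i \sum_j `|(0 : 'M[R]_n) i j|).
    apply: (@lim0_sum _ _ _ _ (fun i e => \sum_j `|Q e i j|)) => i.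
    apply: (@lim0_sum _ _ _ _ (fun j e => `|Q e i j|)) => j.
    by apply: cvg_norm; exact: Q0.
  apply: (lim0_eq _ h).
  by rewrite big1// => i _; rewrite big1// => j _; rewrite mxE normr0.
apply: filterS2 sQ (lim0_lt k0 s0) => e sQe Qk; split.
  by rewrite linearD/= sQe pP.1.
move=> v v0; rewrite -/(bform _ _ _) bformMD.
have v1 : 0 < qform 1%:M v by exact: (posdef1 R n).2.
have := qform_bound (Q e) v.
have := Pk v; rewrite ler_norml /qform -!/(bform _ _ _) => Pv /andP[Qv _].
have : (\sum_i \sum_j `|Q e i j|) * bform 1%:M v v < k * bform 1%:M v v by rewrite ltr_pM2r.
lra.
Qed.

(* [ln det (1 + M) = tr M - tr (M^2) / 2 + o(e^2)] along [M = O(e)], by induction on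
   the dimension through the Schur complement. *)
Lemma lndet_expansion n (M : R -> 'M[R]_n) (N : 'M[R]_n) :
  mlim (fun e => e^-1 *: M e) N ->
  (\forall e \near (0 : R)^', 0 < \det (1%:M + M e)) /\
  lim0 (fun e => (ln (\det (1%:M + M e)) - \tr (M e)) / e ^+ 2) (- (\tr (N *m N) / 2)).
Proof.
elim: n M N => [|n IH] M N MN.
  split; first by near=> e; rewrite det_mx00.
  rewrite /mxtrace big_ord0 mul0r oppr0.
  by under eq_fun do rewrite det_mx00 ln1 big_ord0 subrr mul0r; exact: lim0_cst.
pose M1 e : 'M[R]_(1 + n) := M e; pose N1 : 'M[R]_(1 + n) := N.
pose x e := M e 0 0.
pose u e := dlsubmx (M1 e); pose l e := ursubmx (M1 e).
pose M' e := drsubmx (M1 e) - (1 + x e)^-1 *: (u e *m l e).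
have xlim : lim0 (fun e => x e / e) (N 0 0).
  by apply: (lim0_ext _ (MN 0 0)) => e _; rewrite mxE mulrC.
have x0 := lim0_quot xlim.
have x1 : lim0 (fun e => (1 + x e)^-1) 1.
  apply: (lim0_eq _ (lim0V _ (lim0D (lim0_cst 1) x0))); rewrite addr0 ?invr1//.
have ulim : mlim (fun e => e^-1 *: u e) (dlsubmx N1).
  move=> i j; rewrite !mxE; apply: (lim0_ext _ (MN _ _)) => e _; rewrite !mxE.
  by [].
have llim : mlim (fun e => e^-1 *: l e) (ursubmx N1).
  move=> i j; rewrite !mxE; apply: (lim0_ext _ (MN _ _)) => e _; rewrite !mxE.
  by [].
have dlim : mlim (fun e => e^-1 *: drsubmx (M1 e)) (drsubmx N1).
  move=> i j; rewrite !mxE; apply: (lim0_ext _ (MN _ _)) => e _; rewrite !mxE.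
  by [].
(* The Schur correction is of order [e^2]: it disappears from this limit, but its trace supplies the
   off-diagonal part of [\tr (N *m N)] at second order. *)
have M'lim : mlim (fun e => e^-1 *: M' e) (drsubmx N1).
  apply: (mlim_ext (M := fun e => e^-1 *: drsubmx (M1 e) -
      (e * (1 + x e)^-1) *: ((e^-1 *: u e) *m (e^-1 *: l e)))).
    move=> e e0; rewrite /M' scalerBr; congr (_ - _).
    rewrite -scalemxAl -scalemxAr !scalerA; congr (_ *: _).
    by rewrite mulrAC -!mulrA mulrCA (mulrA e) mulfV// mul1r mulrC.
  apply: (mlim_eq _ (mlimB dlim (mlimZ (lim0M (@lim0_id R) x1) (mlimM ulim llim)))).
  by rewrite mul0r scale0r subr0.
have [pd' lnd'] := IH _ _ M'lim.
have xp : \forall e \near (0 : R)^', 0 < 1 + x e.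
  by apply: (lim0_gt _ (lim0D (lim0_cst 1) x0)); rewrite addr0.
have detE e : 0 < 1 + x e -> \det (1%:M + M e) = (1 + x e) * \det (1%:M + M' e).
  move=> xe; have P00 : (1%:M + M1 e) 0 0 = 1 + x e by rewrite mxE [1%:M 0 0]mxE.
  rewrite [LHS](@det_schur _ n (1%:M + M1 e)) ?P00 ?gt_eqF//; congr (_ * \det _).
  rewrite /schur P00 /M' addrA.
  have -> : drsubmx (1%:M + M1 e) = 1%:M + drsubmx (M1 e).
    by apply/matrixP => i j; rewrite !mxE.
  have -> : dlsubmx (1%:M + M1 e) = u e.
    by apply/matrixP => i j; rewrite !mxE eq_rlshift/= add0r.
  have -> // : ursubmx (1%:M + M1 e) = l e.
  by apply/matrixP => i j; rewrite !mxE eq_lrshift/= add0r.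
split.
  by apply: filterS2 xp pd' => e xe de; rewrite detE// mulr_gt0.
have trE e : \tr (M e) = x e + \tr (drsubmx (M1 e)).
  have := mxtrace_block (ulsubmx (M1 e)) (ursubmx (M1 e)) (dlsubmx (M1 e)) (drsubmx (M1 e)).
  rewrite submxK trace_mx11 => ->; congr (_ + _).
  by rewrite !mxE; congr (M e _ _); apply: val_inj.
have trM' e : \tr (M' e) = \tr (drsubmx (M1 e)) - (1 + x e)^-1 * (l e *m u e) 0 0.
  by rewrite /M' raddfB/= linearZ/= mxtrace_mulC trace_mx11.
apply: (lim0_near (f := fun e => (ln (1 + x e) - x e) / e ^+ 2 +
   (ln (\det (1%:M + M' e)) - \tr (M' e)) / e ^+ 2 -
   (1 + x e)^-1 * ((e^-1 *: l e) *m (e^-1 *: u e)) 0 0)).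
  have := near0_neq0 R; apply: filterS3 xp pd' => e xe de e0.
  rewrite detE// lnM ?posrE// trE trM' -scalemxAl -scalemxAr !mxE.
  by field; rewrite e0 gt_eqF.
have lulim := mlimM llim ulim.
apply: (lim0_eq _ (lim0B (lim0D (lim0_ln xlim) lnd') (lim0M x1 (lulim 0 0)))).
have -> : \tr (N *m N) = N 0 0 ^+ 2 + (ursubmx N1 *m dlsubmx N1) 0 0 *+ 2
    + \tr (drsubmx N1 *m drsubmx N1).
  transitivity (\tr (N1 *m N1)) => //.
  rewrite -[N1 in LHS]submxK mulmx_block mxtrace_block !raddfD/= !trace_mx11.
  rewrite [\tr (dlsubmx _ *m _)]mxtrace_mulC trace_mx11.
  have -> : (ulsubmx N1 *m ulsubmx N1) 0 0 = N 0 0 ^+ 2.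
    rewrite mxE big_ord1 !mxE expr2.
    by congr (N _ _ * N _ _); apply: val_inj.
  by rewrite -!addrA; congr (_ + _); rewrite addrA.
rewrite mul1r -mulr_natl; field.
Unshelve. all: by end_near. Qed.

End matrix_limits.
Arguments mlim_cst {R m n} N.

(** * Second-order expansion of Gaussian exponential moments *)

Section exponential_expansion.
Variable R : realType.

(** The expectation of [exp (- (k + l.x + x^T B x / 2))] under the centred Gaussian of covariance
    [S], when [invmx S + B] is positive definite. *)
Definition gauss_exp d (S B : 'M[R]_d) (l : 'cV[R]_d) (k : R) : R :=
  expR (- k) * (expR (qform (invmx (invmx S + B)) l / 2) / Num.sqrt (\det (1%:M + S *m B))).

Section expansion.
Variables (d : nat) (S B : R -> 'M[R]_d) (l : R -> 'cV[R]_d) (k : R -> R).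
Variables (S0 B1 : 'M[R]_d) (l1 : 'cV[R]_d) (k1 : R).
Hypotheses (pS0 : posdefmx S0) (Slim : mlim S S0).
Hypothesis Blim : mlim (fun e => e^-1 *: B e) B1.
Hypothesis llim : mlim (fun e => e^-1 *: l e) l1.
Hypothesis klim : lim0 (fun e => k e / e) k1.

Lemma posdef_perturbed : (\forall e \near (0 : R)^', posdefmx (S e)) ->
  (\forall e \near (0 : R)^', (B e)^T = B e) ->
  \forall e \near (0 : R)^', posdefmx (invmx (S e) + B e).
Proof.
move=> pS sB; have uS0 := posdef_unit pS0.
have lim : mlim (fun e => invmx (S e) - invmx S0 + B e) 0.
  apply: (mlim_eq _ (mlimD (mlimB (mlim_inv uS0 Slim) (mlim_cst _)) (mlim_quot Blim))).
  by rewrite subrr addr0.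
have sym : \forall e \near (0 : R)^',
    (invmx (S e) - invmx S0 + B e)^T = invmx (S e) - invmx S0 + B e.
  apply: filterS2 pS sB => e pSe sBe.
  rewrite linearD/= linearB/= sBe (posdef_inv pS0).1 (posdef_inv pSe).1//.
apply: filterS (posdef_near (posdef_inv pS0) sym lim) => e.
by rewrite addrA addrCA subrr addr0.
Qed.

(** With [X = k + l.x + x^T B x / 2], the numerator is [1 - E exp (- X) - E X], equivalent to
    [- E X^2 / 2]. On the right, the first two terms are half the variance of the limit of [X / e],
    the last one half its squared mean. *)
Lemma gauss_exp_expansion :
  lim0 (fun e => (1 - gauss_exp (S e) (B e) (l e) (k e)
                  - (k e + \tr (S e *m B e) / 2)) / e ^+ 2)
       (- (qform S0 l1 / 2 + \tr (S0 *m B1 *m (S0 *m B1)) / 4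
           + (k1 + \tr (S0 *m B1) / 2) ^+ 2 / 2)).
Proof.
have uS0 := posdef_unit pS0.
pose M e := S e *m B e.
have Mlim : mlim (fun e => e^-1 *: M e) (S0 *m B1).
  apply: (mlim_ext _ (mlimM Slim Blim)) => e _.
  by rewrite -scalemxAr.
have [dp lnd] := lndet_expansion Mlim.
pose L e := invmx (invmx (S e) + B e).
have Llim : mlim L S0.
  have := mlimD (mlim_inv uS0 Slim) (mlim_quot Blim); rewrite addr0.
  by move=> /(mlim_inv (posdef_unit (posdef_inv pS0))); rewrite invmxK.
have qlim := lim0_qform Llim llim.
have trlim := lim0_tr Mlim.
(* [gauss_exp] is [expR (- W e)] where the determinant is positive, so the expansions of the
   log-determinant and of the exponential can be chained. *)
pose W e := k e - qform (L e) (l e) / 2 + ln (\det (1%:M + M e)) / 2.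
have r1 : lim0 (fun e => (k e + \tr (M e) / 2 - W e) / e ^+ 2)
    (qform S0 l1 / 2 + \tr (S0 *m B1 *m (S0 *m B1)) / 4).
  apply: (lim0_ext (f := fun e => qform (L e) (e^-1 *: l e) * 2^-1 -
     (ln (\det (1%:M + M e)) - \tr (M e)) / e ^+ 2 * 2^-1)).
    by move=> e e0; rewrite qformZ /W; field.
  apply: (lim0_eq _ (lim0B (lim0M qlim (lim0_cst _)) (lim0M lnd (lim0_cst _)))).
  by field.
have Wlim : lim0 (fun e => W e / e) (k1 + \tr (S0 *m B1) / 2).
  apply: (lim0_ext (f := fun e => k e / e + \tr (e^-1 *: M e) * 2^-1 -
     e * ((k e + \tr (M e) / 2 - W e) / e ^+ 2))).
    by move=> e e0; rewrite linearZ/=; field.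
  apply: (lim0_eq _ (lim0B (lim0D klim (lim0M trlim (lim0_cst _))) (lim0M (@lim0_id R) r1))).
  by rewrite mul0r subr0.
have NWlim : lim0 (fun e => - W e / e) (- (k1 + \tr (S0 *m B1) / 2)).
  by under eq_fun do rewrite mulNr; exact: lim0N.
have r2 := lim0_exp NWlim.
apply: (lim0_near (f := fun e => - ((expR (- W e) - 1 - - W e) / e ^+ 2) -
   (k e + \tr (M e) / 2 - W e) / e ^+ 2)).
  have := near0_neq0 R; apply: filterS2 dp => e de e0.
  have -> : gauss_exp (S e) (B e) (l e) (k e) = expR (- W e).
    rewrite /gauss_exp -/(M e) -/(L e) /W.
    rewrite (_ : (Num.sqrt _)^-1 = expR (- (ln (\det (1%:M + M e)) / 2))); last first.
      rewrite expRN; congr (_^-1).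
      rewrite -[X in Num.sqrt X]lnK ?posrE// -[X in Num.sqrt (expR X)](@divfK _ 2)//.
      by rewrite expRM_natr sqrtr_sqr ger0_norm ?expR_ge0.
    by rewrite -!expRD; congr expR; ring.
  by rewrite -/(M e); field.
by apply: (lim0_eq _ (lim0B (lim0N r2) r1)); field.
Qed.

End expansion.

Lemma near0P (P : R -> Prop) : (\forall e \near (0 : R)^', P e) ->
  exists2 r : R, 0 < r & forall e, e != 0 -> `|e| < r -> P e.
Proof.
move=> /nbhs_ballP[r /= r0 rP]; exists r => // e e0 er.
by apply: rP => //=; rewrite /ball/= sub0r normrN.
Qed.

(* If [t |-> \int exp (- t X)] has derivative [-v] at 0 then [X] has integral [v], as
   [exp (- t X) >= 1 - t X] for [t] of either sign. *)
Lemma has_int_of_exp dd (T : measurableType dd) (mu : {finite_measure set T -> \bar R})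
    (X : T -> R) (F : R -> R) (a v : R) :
  measurable_fun setT X -> mu setT = a%:E ->
  (\forall t \near (0 : R)^', has_int mu (fun x => expR (- (t * X x))) (F t)) ->
  lim0 (fun t => (a - F t) / t) v -> has_int mu X v.
Proof.
move=> mX mua hF Fv.
have [r r0 hr] := near0P hF.
pose s := r / 2.
have s0 : 0 < s by rewrite divr_gt0.
have sr : `|s| < r by rewrite gtr0_norm// /s; lra.
have hs := hr s (lt0r_neq0 s0) sr.
have hNs := hr (- s) _ _; rewrite oppr_eq0 normrN in hNs.
have {}hNs := hNs (lt0r_neq0 s0) sr.
have [z hz] : exists z, has_int mu X z.
  apply: (dominated_has_int mX (has_intZ s^-1 (has_intD hs hNs))) => x.
  rewrite mulrC ler_pdivlMr// mulNr opprK.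
  have h1 := expR_ge1Dx (s * X x); have h2 := expR_ge1Dx (- (s * X x)).
  have h3 := expR_ge0 (s * X x); have h4 := expR_ge0 (- (s * X x)).
  rewrite mulrC; have [X0|X0] := leP 0 (X x).
    by rewrite ger0_norm//; lra.
  by rewrite ltr0_norm//; lra.
have main t : t != 0 -> `|t| < r -> a - t * z <= F t.
  move=> t0 tr; have one : has_int mu (fun=> 1) (1 * a) by exact: has_int_cst.
  have := has_int_le (has_intB one (has_intZ t hz)) (hr t t0 tr).
  by rewrite mul1r; apply=> x; have := expR_ge1Dx (- (t * X x)).
suff -> : v = z by [].
(* By [main], the quotient [(a - F t) / t] is at most [z] for [t > 0] and at least [z] for [t < 0];
   each sign contradicts one strict inequality between [v] and [z]. *)
apply/eqP; rewrite eq_le; apply/andP; split; rewrite leNgt; apply/negP => zv.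
- have [q q0 hq] := near0P (lim0_gt zv Fv).
  pose t := Num.min q r / 2.
  have t0 : 0 < t by rewrite divr_gt0// lt_min q0.
  have tm : t < Num.min q r by rewrite /t ltr_pdivrMr// ltr_pMr ?lt_min ?q0//; lra.
  have := hq t (lt0r_neq0 t0); rewrite gtr0_norm// (lt_le_trans tm) ?ge_min ?lexx//.
  move=> /(_ isT); rewrite ltr_pdivlMr//.
  have := main t (lt0r_neq0 t0); rewrite gtr0_norm// (lt_le_trans tm) ?ge_min ?lexx ?orbT//.
  by move=> /(_ isT); lra.
- have [q q0 hq] := near0P (lim0_lt zv Fv).
  pose t := Num.min q r / 2.
  have t0 : 0 < t by rewrite divr_gt0// lt_min q0.
  have tm : t < Num.min q r by rewrite /t ltr_pdivrMr// ltr_pMr ?lt_min ?q0//; lra.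
  have Nt0 : - t != 0 by rewrite oppr_eq0 lt0r_neq0.
  have := hq (- t) Nt0; rewrite normrN gtr0_norm// (lt_le_trans tm) ?ge_min ?lexx//.
  move=> /(_ isT); rewrite ltr_ndivrMr ?oppr_lt0//.
  have := main (- t) Nt0; rewrite normrN gtr0_norm// (lt_le_trans tm) ?ge_min ?lexx ?orbT//.
  by move=> /(_ isT); lra.
Qed.

(** The integral of a quadratic polynomial is the derivative at 0 of the exponential moments, so no
    polynomial is integrated directly. *)
Lemma has_int_gauss_poly d (a : R) (m : 'cV[R]_d) (S B : 'M[R]_d) (l : 'cV[R]_d) :
  0 <= a -> posdefmx S -> B^T = B ->
  has_int (scaled_gaussian a m S)
    (fun x => qform B (colv x - m) / 2 + dotv l (colv x - m)) (a * (\tr (S *m B) / 2)).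
Proof.
move=> a0 pS sB.
have BE : mlim (fun t => t^-1 *: (t *: B)) B.
  by apply: (mlim_ext _ (mlim_cst B)) => t t0; rewrite scalerA mulVf// scale1r.
have lE : mlim (fun t => t^-1 *: (t *: l)) l.
  by apply: (mlim_ext _ (mlim_cst l)) => t t0; rewrite scalerA mulVf// scale1r.
have kE : lim0 (fun t : R => 0 / t) 0.
  by under eq_fun do rewrite mul0r; exact: lim0_cst.
apply: (has_int_of_exp (F := fun t => a * gauss_exp S (t *: B) (t *: l) 0) (a := a)).
- apply: measurable_funD; last exact: measurable_dotv.
  by apply: measurable_funM => //; exact: measurable_qform.
- exact: scaled_gaussianT.
- have := posdef_perturbed pS (mlim_cst S) BE _ _.
  have nS : \forall e \near (0:R)^', posdefmx S by near=> e.
  have nB : \forall e \near (0:R)^', (e *: B)^T = e *: B by near=> e; rewrite linearZ/= sB.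
  move=> /(_ nS nB); apply: filterS => t pt.
  have := has_int_gauss_exp m (t *: l) a0 pS pt.
  rewrite /gauss_exp oppr0 expR0 mul1r mulrA; congr has_int.
  apply/funext => x; congr expR; congr (- _).
  by rewrite /qform /dotv -!/(bform _ _ _) bformMZ bformZl; ring.
- have h := gauss_exp_expansion pS (mlim_cst S) BE lE kE.
  have := lim0M (lim0_cst a) (lim0D (lim0M (@lim0_id R) h) (lim0_cst (\tr (S *m B) / 2))).
  rewrite mul0r add0r; apply: lim0_ext => t t0.
  by rewrite -scalemxAr mxtraceZ; field.
Unshelve. all: by end_near. Qed.

End exponential_expansion.

(** * Lower bound *)

Section lower_bound.
Variable R : realType.
Definition quadpoly d (k : R) (l : 'cV[R]_d) (B : 'M[R]_d) (x : 'cV[R]_d) : R :=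
  k + dotv l x + qform B x / 2.

Lemma measurable_quadpoly d k l B (m : 'cV[R]_d) :
  measurable_fun setT (fun x : space R d => quadpoly k l B (colv x - m)).
Proof.
apply: measurable_funD; first by apply: measurable_funD => //; exact: measurable_dotv.
by apply: measurable_funM => //; exact: measurable_qform.
Qed.

Lemma quadpolyZ d c k l B (x : 'cV[R]_d) :
  quadpoly (c * k) (c *: l) (c *: B) x = c * quadpoly k l B x.
Proof.
rewrite /quadpoly /dotv /qform -!/(bform _ _ _) bformZl bformMZ; ring.
Qed.

Lemma quadpolyN d k l B (x : 'cV[R]_d) :
  quadpoly (- k) (- l) (- B) x = - quadpoly k l B x.
Proof. by have := quadpolyZ (-1) k l B x; rewrite !mulN1r !scaleN1r. Qed.

Lemma quadpolyD d k1 l1 B1 k2 l2 B2 (x : 'cV[R]_d) :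
  quadpoly (k1 + k2) (l1 + l2) (B1 + B2) x = quadpoly k1 l1 B1 x + quadpoly k2 l2 B2 x.
Proof.
rewrite /quadpoly /dotv /qform -!/(bform _ _ _) bformDl bformMD; ring.
Qed.

Lemma qform1_affine d (v x : 'cV[R]_d) A : A^T = A ->
  qform 1%:M (v + A *m x) =
  quadpoly (qform 1%:M v) (2 *: (A *m v)) (2 *: (A *m A)) x.
Proof.
move=> sA; rewrite qformD ?trmx1// /quadpoly /dotv bformZl.
have -> : bform 1%:M (A *m v) x = bform A v x by rewrite bformMl sA mulmx1.
have -> : bform 1%:M v (A *m x) = bform A v x by rewrite bformMr mul1mx.
have -> : qform 1%:M (A *m x) = bform (A *m A) x x.
  by rewrite /qform -/(bform _ _ _) bformMr bformMl sA mul1mx.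
by rewrite {3}/qform -/(bform _ _ _) bformMZ; field.
Qed.

Lemma quadpoly_shift d k l B (x y : 'cV[R]_d) : B^T = B ->
  quadpoly k l B (x + y) = quadpoly (quadpoly k l B y) (l + B *m y) B x.
Proof.
move=> sB; rewrite /quadpoly qformD// /dotv bformDl bformDr.
by rewrite -[bform _ (B *m y) x]bform_tr trmx1 bformMr mul1mx; field.
Qed.

Lemma has_int_gauss_quadpoly d (a : R) (m : 'cV[R]_d) (S B : 'M[R]_d) l k :
  0 <= a -> posdefmx S -> posdefmx (invmx S + B) ->
  has_int (scaled_gaussian a m S) (fun x => expR (- quadpoly k l B (colv x - m)))
    (a * gauss_exp S B l k).
Proof.
move=> a0 pS pL.
have := has_intZ (expR (- k)) (has_int_gauss_exp m l a0 pS pL).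
rewrite (_ : expR (- k) * _ = a * gauss_exp S B l k); last by rewrite /gauss_exp; ring.
congr has_int; apply/funext => x; rewrite -expRD /quadpoly; congr expR; ring.
Qed.

Lemma sqdistE d (x y : space R d) : sqdist x y = qform 1%:M (colv y - colv x).
Proof.
by rewrite qform1E; apply: eq_bigr => i _; rewrite !mxE -sqrrN opprB.
Qed.

(* Completing the square in [y - x]: the left-hand side is the quadratic upper bound of
   the c-transform of [2 e q]. *)
Lemma dual_potentials d (e th s : R) (v : 'cV[R]_d) (A : 'M[R]_d) (x y : 'cV[R]_d) :
  A^T = A -> 0 < th -> `|e| * (\sum_i \sum_j `|A i j|) <= 1 - th^-1 ->
  - (2 * e * quadpoly s v A x + e ^+ 2 * th * qform 1%:M (v + A *m x))
  + 2 * e * quadpoly s v A y <= qform 1%:M (y - x).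
Proof.
move=> sA th0 eA; set h := y - x; set g := v + A *m x.
have -> : y = h + x by rewrite subrK.
rewrite quadpoly_shift// -/g {2}/quadpoly.
have := qform_ge0 (h + (- (e * th)) *: g) (posdef1 R d).
rewrite qformD ?trmx1// bformZr qformZ.
rewrite /dotv -[bform _ g h]bform_tr trmx1.
have h0 := qform_ge0 h (posdef1 R d).
have : e * qform A h <= (1 - th^-1) * qform 1%:M h.
  apply: (le_trans (ler_norm _)); rewrite normrM.
  apply: (le_trans (ler_wpM2l _ (qform_bound A h))) => //.
  by rewrite mulrA ler_wpM2r.
set b := bform _ _ _; set G := qform _ g; set HH := qform 1%:M h.
have ith0 : 0 <= th^-1 by rewrite invr_ge0 ltW.
move=> h1 /(mulr_ge0 ith0).
have -> : th^-1 * (HH + 2 * (- (e * th) * b) + (- (e * th)) ^+ 2 * G) =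
    th^-1 * HH - 2 * e * b + e ^+ 2 * th * G by field; rewrite gt_eqF.
move: h1; lra.
Qed.

Variables (d : nat) (tau0 tau1 : R).
Hypotheses (tau0_gt0 : 0 < tau0) (tau1_gt0 : 0 < tau1).
Variables (a adot : R) (m : 'cV[R]_d) (S : 'M[R]_d).
Hypotheses (a_gt0 : 0 < a) (pS : posdefmx S).
Variables (m1 : R -> 'cV[R]_d) (S1 : R -> 'M[R]_d) (mdot : 'cV[R]_d) (H : 'M[R]_d).
Hypothesis m1lim : mlim (fun e => e^-1 *: (m1 e - m)) mdot.
Hypothesis S1lim : mlim (fun e => e^-1 *: (S1 e - S)) H.
Hypothesis pS1 : \forall e \near (0 : R)^', posdefmx (S1 e).

(** The [e^2] coefficient of the dual functional. The terms in [adot], [mdot] and [H] come from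
    moving the target, the next one integrates [|grad q|^2], and the last one is half the second
    moment of [q]; the factor [4 / tau] is [tau] times the square of the slope [2 / tau] of the
    rescaled potential. *)
Definition dual_value (s : R) (v : 'cV[R]_d) (A : 'M[R]_d) : R :=
  2 * adot * (s + \tr (S *m A) / 2) + 2 * a * (dotv v mdot + \tr (H *m A) / 2)
  - a * (qform 1%:M v + \tr (S *m (A *m A)))
  - (4 / tau0 + 4 / tau1) * a * (qform S v / 2 + \tr (S *m A *m (S *m A)) / 4
       + (s + \tr (S *m A) / 2) ^+ 2 / 2).

Lemma S1_lim : mlim S1 S.
Proof.
have := mlimD (mlim_quot S1lim) (mlim_cst S); rewrite add0r.
by apply: mlim_ext => e _; rewrite subrK.
Qed.

Lemma UOT_lower_bound (s : R) (v : 'cV[R]_d) (A : 'M[R]_d) : A^T = A ->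
  exists2 D : R -> R, lim0 (fun e => D e / e ^+ 2) (dual_value s v A) &
    \forall e \near (0 : R)^', ((D e)%:E <= UOT tau0 tau1 (scaled_gaussian a m S)
       (scaled_gaussian (a + e * adot) (m1 e) (S1 e)))%E.
Proof.
move=> sA; pose kap : R := \sum_i \sum_j `|A i j|.
pose th (e : R) : R := (1 - `|e| * kap)^-1.
have thlim : lim0 th 1.
  apply: (lim0_eq _ (lim0V _ (lim0B (lim0_cst 1) (lim0M (cvg_norm (@lim0_id R)) (lim0_cst kap)))));
    by rewrite normr0 mul0r subr0 ?invr1// oner_neq0.
have thgt : \forall e \near (0 : R)^', 0 < 1 - `|e| * kap.
  apply: (lim0_gt _ (lim0B (lim0_cst 1) (lim0M (cvg_norm (@lim0_id R)) (lim0_cst kap)))).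
  by rewrite normr0 mul0r subr0.
pose b e := a + e * adot.
have blim : lim0 b a.
  apply: (lim0_eq _ (lim0D (lim0_cst a) (lim0M (@lim0_id R) (lim0_cst adot)))).
  by rewrite mul0r addr0.
pose D1 e := m1 e - m.
have D1lim := mlim_quot m1lim.
(* [k0], [l0], [B0] are the coefficients of [phi / tau0] in coordinates centred at [m], and [k1],
   [l1], [B1] those of [psi / tau1] recentred at the moving mean [m1 e]. *)
pose k0 e := - tau0^-1 * (2 * e * s + (e ^+ 2 * th e) * qform 1%:M v).
pose l0 e := - tau0^-1 *: (2 * e *: v + (e ^+ 2 * th e) *: (2 *: (A *m v))).
pose B0 e := - tau0^-1 *: (2 * e *: A + (e ^+ 2 * th e) *: (2 *: (A *m A))).
pose k1 e := 2 * e / tau1 * quadpoly s v A (D1 e).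
pose l1 e := 2 * e / tau1 *: (v + A *m D1 e).
pose B1 e := 2 * e / tau1 *: A.
have thelim : lim0 (fun e => e * th e * 2) 0.
  by apply: (lim0_eq _ (lim0M (lim0M (@lim0_id R) thlim) (lim0_cst 2))); rewrite !mul0r.
have quotZ n (X Y : 'M[R]_(d, n)) : mlim (fun e => e^-1 *:
    (- tau0^-1 *: (2 * e *: X + (e ^+ 2 * th e) *: (2 *: Y)))) (- (2 / tau0) *: X).
  apply: (mlim_ext (M := fun e => - tau0^-1 *: (2 *: X + (e * th e * 2) *: Y))).
    move=> e e0; rewrite [RHS]scalerA [e^-1 * _]mulrC -[RHS]scalerA; congr (_ *: _).
    by rewrite [RHS]scalerDr !scalerA; congr (_ *: _ + _ *: _); field.
  apply: (mlim_eq _ (mlimZ (lim0_cst _) (mlimD (mlim_cst _) (mlimZ thelim (mlim_cst Y))))).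
  by rewrite scale0r addr0 scalerA; congr (_ *: _); ring.
have l0lim : mlim (fun e => e^-1 *: l0 e) (- (2 / tau0) *: v) by exact: quotZ.
have B0lim : mlim (fun e => e^-1 *: B0 e) (- (2 / tau0) *: A) by exact: quotZ.
have k0lim : lim0 (fun e => k0 e / e) (- (2 / tau0) * s).
  apply: (lim0_ext (f := fun e => - tau0^-1 * (2 * s + e * th e * 2 * (qform 1%:M v / 2)))).
    by move=> e e0; rewrite /k0; field; rewrite e0 gt_eqF.
  apply: (lim0_eq _ (lim0M (lim0_cst _) (lim0D (lim0_cst _) (lim0M thelim (lim0_cst _))))).
  by ring.
have quot1 n (X : R -> 'M[R]_(d, n)) X0 : mlim X X0 ->
    mlim (fun e => e^-1 *: (2 * e / tau1 *: X e)) (2 / tau1 *: X0).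
  move=> XX; apply: (mlim_ext _ (mlimZ (lim0_cst (2 / tau1)) XX)) => e e0.
  by rewrite scalerA; congr (_ *: _); field; rewrite e0 gt_eqF.
have q1lim : lim0 (fun e => quadpoly s v A (D1 e)) s.
  have h1 := lim0_bform (mlim_cst 1%:M) (mlim_cst v) D1lim.
  have h2 := lim0_qform (mlim_cst A) D1lim.
  apply: (lim0_eq _ (lim0D (lim0D (lim0_cst s) h1) (lim0M h2 (lim0_cst _)))).
  by rewrite qform0 /bform mulmx0 mxE mul0r !addr0.
have l1lim : mlim (fun e => e^-1 *: l1 e) (2 / tau1 *: v).
  apply: quot1; apply: (mlim_eq _ (mlimD (mlim_cst v) (mlimM (mlim_cst A) D1lim))).
  by rewrite mulmx0 addr0.
have B1lim : mlim (fun e => e^-1 *: B1 e) (2 / tau1 *: A).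
  exact: (quot1 _ _ _ (mlim_cst A)).
have k1lim : lim0 (fun e => k1 e / e) (2 / tau1 * s).
  apply: (lim0_ext _ (lim0M (lim0_cst (2 / tau1)) q1lim)) => e e0.
  by rewrite /k1; field; rewrite e0 gt_eqF.
have S1l := S1_lim.
pose D e := tau0 * (a - a * gauss_exp S (B0 e) (l0 e) (k0 e)) +
  tau1 * (b e - b e * gauss_exp (S1 e) (B1 e) (l1 e) (k1 e)).
exists D.
  have E0 := gauss_exp_expansion pS (mlim_cst S) B0lim l0lim k0lim.
  have E1 := gauss_exp_expansion pS S1l B1lim l1lim k1lim.
  (* The means of the two potentials, added and divided by [e ^+ 2]. Their terms of order [e] cancel
     because both measures coincide at [e = 0], and difference quotients of the curve remain. *)
  pose lin e := 2 * a * (bform 1%:M v (e^-1 *: D1 e) +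
      bform A (e^-1 *: D1 e) (D1 e) / 2 + \tr (e^-1 *: (S1 e - S) *m A) / 2)
    + 2 * adot * (quadpoly s v A (D1 e) + \tr (S1 e *m A) / 2)
    - a * th e * (qform 1%:M v + \tr (S *m (A *m A))).
  have linlim : lim0 lin (2 * a * (dotv v mdot + \tr (H *m A) / 2) +
      2 * adot * (s + \tr (S *m A) / 2) - a * (qform 1%:M v + \tr (S *m (A *m A)))).
    have h1 := lim0_bform (mlim_cst 1%:M) (mlim_cst v) m1lim.
    have h2 := lim0_bform (mlim_cst A) m1lim D1lim.
    have h3 := lim0_tr (mlimM S1lim (mlim_cst A)).
    have h4 := lim0_tr (mlimM S1l (mlim_cst A)).
    apply: (lim0_eq _ (lim0B (lim0D
      (lim0M (lim0_cst (2 * a)) (lim0D (lim0D h1 (lim0M h2 (lim0_cst _))) (lim0M h3 (lim0_cst _))))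
      (lim0M (lim0_cst (2 * adot)) (lim0D q1lim (lim0M h4 (lim0_cst _)))))
      (lim0M (lim0M (lim0_cst a) thlim) (lim0_cst _)))).
    have -> : bform A mdot 0 = 0 by rewrite /bform mulmx0 mxE.
    by rewrite /dotv mul0r addr0 mulr1.
  apply: (lim0_ext (f := fun e => lin e +
    tau0 * a * ((1 - gauss_exp S (B0 e) (l0 e) (k0 e) - (k0 e + \tr (S *m B0 e) / 2)) / e ^+ 2) +
    tau1 * b e * ((1 - gauss_exp (S1 e) (B1 e) (l1 e) (k1 e)
       - (k1 e + \tr (S1 e *m B1 e) / 2)) / e ^+ 2))).
    move=> e e0; rewrite /lin /D.
    rewrite /B0 /B1 -!scalemxAr !mxtraceZ mulmxDr mxtraceD -!scalemxAr !mxtraceZ.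
    rewrite -scalemxAl mxtraceZ mulmxBl [\tr (_ - _)]raddfB/=.
    rewrite bformZr bformZl /k0 /k1 {1 3}/quadpoly /dotv /qform -!/(bform _ _ _) /b.
    move: (gauss_exp _ _ _ _) (gauss_exp _ _ _ _) => G0 G1.
    by field; rewrite e0 !gt_eqF.
  apply: (lim0_eq _ (lim0D (lim0D linlim (lim0M (lim0_cst (tau0 * a)) E0))
    (lim0M (lim0M (lim0_cst tau1) blim) E1))).
  rewrite /dual_value -!scalemxAr !qformZ !mxtraceZ -!scalemxAl !mxtraceZ.
  by field; rewrite !gt_eqF.
have nS : \forall e \near (0:R)^', posdefmx S by near=> e.
have sB0 e : (B0 e)^T = B0 e.
  by rewrite /B0 linearZ/= linearD/= !linearZ/= linearZ/= trmx_mul sA.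
have sB1 e : (B1 e)^T = B1 e by rewrite /B1 linearZ/= sA.
(* The opposite matrices serve the integrals of the inverse exponentials, [w0] and [w1] in
   [UOT_ge_dual]. *)
have Nlim (X : R -> 'M[R]_d) X0 : mlim (fun e => e^-1 *: X e) X0 ->
    mlim (fun e => e^-1 *: - X e) (- X0).
  by move=> /mlimN; apply: mlim_ext => e _; rewrite scalerN.
have nT (X : R -> 'M[R]_d) : (forall e, (X e)^T = X e) ->
    \forall e \near (0:R)^', (X e)^T = X e by move=> h; near=> e.
have nTN (X : R -> 'M[R]_d) : (forall e, (X e)^T = X e) ->
    \forall e \near (0:R)^', (- X e)^T = - X e.
  by move=> h; near=> e; rewrite linearN/= h.
have p0 := posdef_perturbed pS (mlim_cst S) B0lim nS (nT _ sB0).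
have p0N := posdef_perturbed pS (mlim_cst S) (Nlim _ _ B0lim) nS (nTN _ sB0).
have p1 := posdef_perturbed pS S1l B1lim pS1 (nT _ sB1).
have p1N := posdef_perturbed pS S1l (Nlim _ _ B1lim) pS1 (nTN _ sB1).
have bgt : \forall e \near (0:R)^', 0 < b e by exact: lim0_gt blim.
near=> e.
have pSe : posdefmx (S1 e) by near: e.
have b0 : 0 <= b e by apply: ltW; near: e.
have th0 : 0 < 1 - `|e| * kap by near: e.
pose phi (x : space R d) := tau0 * quadpoly (k0 e) (l0 e) (B0 e) (colv x - m).
pose psi (y : space R d) := tau1 * quadpoly (k1 e) (l1 e) (B1 e) (colv y - m1 e).
have phiE x : phi x / tau0 = quadpoly (k0 e) (l0 e) (B0 e) (colv x - m).
  by rewrite /phi mulrC mulKf ?gt_eqF.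
have psiE y : psi y / tau1 = quadpoly (k1 e) (l1 e) (B1 e) (colv y - m1 e).
  by rewrite /psi mulrC mulKf ?gt_eqF.
apply: (@UOT_ge_dual _ _ _ _ _ _ _ _ phi psi a (b e)
  (a * gauss_exp S (B0 e) (l0 e) (k0 e))
  (a * gauss_exp S (- B0 e) (- l0 e) (- k0 e))
  (b e * gauss_exp (S1 e) (B1 e) (l1 e) (k1 e))
  (b e * gauss_exp (S1 e) (- B1 e) (- l1 e) (- k1 e))) => //.
- by apply: measurable_funM => //; exact: measurable_quadpoly.
- by apply: measurable_funM => //; exact: measurable_quadpoly.
- move=> x y; rewrite sqdistE.
  have -> : colv y - colv x = (colv y - m) - (colv x - m).
    by rewrite opprB addrA subrK.
  apply: le_trans (@dual_potentials d e (th e) s v A (colv x - m) (colv y - m) sA _ _); last 2 first.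
  + by rewrite invr_gt0; exact: th0.
  + by rewrite invrK opprB addrCA subrr addr0.
  rewrite lerD// /phi /psi /k0 /l0 /B0 /k1 /l1 /B1.
    rewrite quadpolyZ quadpolyD !quadpolyZ -qform1_affine// mulrA mulrN mulfV ?gt_eqF//.
    by rewrite mulN1r.
  rewrite quadpolyZ mulrA mulrCA mulfV ?gt_eqF// mulr1 -quadpoly_shift//.
  by rewrite /D1 addrA subrK.
- exact/scaled_gaussianT/ltW.
- exact: scaled_gaussianT.
- under eq_fun do rewrite phiE; apply: has_int_gauss_quadpoly => //; first exact: ltW.
  by near: e.
- under eq_fun do rewrite phiE -[quadpoly _ _ _ _]opprK -quadpolyN.
  by apply: has_int_gauss_quadpoly => //; [exact: ltW|near: e].
- under eq_fun do rewrite psiE; apply: has_int_gauss_quadpoly => //.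
  by near: e.
- under eq_fun do rewrite psiE -[quadpoly _ _ _ _]opprK -quadpolyN.
  by apply: has_int_gauss_quadpoly => //; near: e.
Unshelve. all: by end_near. Qed.

End lower_bound.

(** * Upper bound *)

Section density_constructions.
Variable R : realType.

Lemma density_div dd (T : measurableType dd) (mu : {sigma_finite_measure set T -> \bar R})
    (nu rho : {finite_measure set T -> \bar R}) (f g : T -> R) :
  (forall x, 0 < f x) -> density mu nu f -> density mu rho g ->
  density nu rho (fun x => g x / f x).
Proof.
move=> fgt0 fP [mg g0 rhoE]; have [mf f0 nuE] := fP.
have mgf : measurable_fun setT (fun x => g x / f x).
  apply: measurable_funM => //.
  rewrite (_ : (fun _ => _) = (fun x => (f x) `^ (-1))); last first.
    by apply/funext => x; rewrite powR_inv1// ltW.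
  exact: (measurableT_comp (measurable_powR _)).
split=> [//|x|A mA]; first by rewrite divr_ge0.
rewrite rhoE// [LHS]integral_mkcond [RHS]integral_mkcond.
rewrite (ge0_integral_density fP).
- apply: eq_integral => x _; rewrite !patchE; case: ifP => _; last by rewrite mul0e.
  by rewrite -EFinM divfK// gt_eqF.
- apply/(measurable_restrictT _ mA); apply: measurable_funTS.
  exact/measurable_EFinP.
- by move=> x; rewrite patchE; case: ifP => // _; rewrite lee_fin divr_ge0.
Qed.

Section withdensity.
Context dd (T : measurableType dd) (mu : {measure set T -> \bar R}) (f : T -> R).
Hypotheses (mf : measurable_fun setT f) (f0 : forall x, 0 <= f x).
Variable (c : R).
Hypothesis fc : (\int[mu]_x (f x)%:E = c%:E)%E.

(** The hypotheses are arguments of the definition, so that the measure structures declared on it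
    can rely on them. *)
Definition withdensity of measurable_fun setT f & (forall x, 0 <= f x) &
  (\int[mu]_x (f x)%:E = c%:E)%E := fun A => (\int[mu]_(x in A) (f x)%:E)%E.

Local Notation nu := (withdensity mf f0 fc).

Let nu0 : nu set0 = 0%E. Proof. exact: integral_set0. Qed.

Let nu_ge0 A : (0 <= nu A)%E.
Proof. by apply: integral_ge0 => x _; rewrite lee_fin. Qed.

Let nu_sigma_additive : semi_sigma_additive nu.
Proof.
by apply: semi_sigma_additive_nng_induced => [|x]; [exact/measurable_EFinP|rewrite lee_fin].
Qed.

HB.instance Definition _ := isMeasure.Build _ _ _ nu nu0 nu_ge0 nu_sigma_additive.

Let nu_fin : fin_num_fun nu.
Proof.
move=> A mA; apply: integrable_fin_num => //.
apply: (integrableS measurableT) => //.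
by have [] := ge0_has_int mf f0 fc.
Qed.

HB.instance Definition _ := Measure_isFinite.Build _ _ _ nu nu_fin.

Lemma withdensityP : density mu nu f. Proof. by split. Qed.

End withdensity.

Section marginal_density.
Context d1 d2 (T1 : measurableType d1) (T2 : measurableType d2).
Variables (mu1 : {sigma_finite_measure set T1 -> \bar R})
          (mu2 : {sigma_finite_measure set T2 -> \bar R}).
Variables (gamma : {finite_measure set (T1 * T2)%type -> \bar R}) (g : T1 * T2 -> R).
Hypothesis gP : density (mu1 \x mu2)%E gamma g.

Lemma marginal1_density (h : T1 -> R) : measurable_fun setT h -> (forall x, 0 <= h x) ->
  (forall x, \int[mu2]_y (g (x, y))%:E = (h x)%:E)%E -> density mu1 (marginal1 gamma) h.
Proof.
have [mg g0 gE] := gP; move=> mh h0 gh; split=> // A mA.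
have mA' : measurable (fst @^-1` A : set (T1 * T2)).
  by rewrite -[X in measurable X]setTI; exact: measurable_fst.
rewrite [LHS]gE//.
rewrite [LHS]integral_mkcond [RHS]integral_mkcond fubini_tonelli1.
- apply: eq_integral => x _; rewrite /fubini_F/= patchE; case: ifPn => xA.
    by rewrite -gh; apply: eq_integral => y _; rewrite patchE mem_set//; move: xA; rewrite inE.
  rewrite [LHS]integral0_eq// => y _; rewrite patchE memNset//.
  by move: xA => /negP xA; apply: contra_not xA => ?; rewrite inE.
- apply/(measurable_restrictT _ mA').
  exact/measurable_funTS/measurable_EFinP.
- by move=> p; rewrite patchE; case: ifP => // _; rewrite lee_fin.
Qed.

Lemma marginal2_density (h : T2 -> R) : measurable_fun setT h -> (forall x, 0 <= h x) ->
  (forall y, \int[mu1]_x (g (x, y))%:E = (h y)%:E)%E -> density mu2 (marginal2 gamma) h.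
Proof.
have [mg g0 gE] := gP; move=> mh h0 gh; split=> // A mA.
have mA' : measurable (snd @^-1` A : set (T1 * T2)).
  by rewrite -[X in measurable X]setTI; exact: measurable_snd.
rewrite [LHS]gE//.
rewrite [LHS]integral_mkcond [RHS]integral_mkcond fubini_tonelli2.
- apply: eq_integral => y _; rewrite /fubini_G/= patchE; case: ifPn => yA.
    by rewrite -gh; apply: eq_integral => x _; rewrite patchE mem_set//; move: yA; rewrite inE.
  rewrite [LHS]integral0_eq// => x _; rewrite patchE memNset//.
  by move: yA => /negP yA; apply: contra_not yA => ?; rewrite inE.
- apply/(measurable_restrictT _ mA').
  exact/measurable_funTS/measurable_EFinP.
- by move=> p; rewrite patchE; case: ifP => // _; rewrite lee_fin.
Qed.

Lemma integral_product_density (h : T1 * T2 -> \bar R) :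
  measurable_fun setT h -> (forall p, 0 <= h p)%E ->
  (\int[gamma]_p h p = \int[mu1]_x \int[mu2]_y (h (x, y) * (g (x, y))%:E))%E.
Proof.
have [mg g0 gE] := gP; move=> mh h0.
have -> := @ge0_integral_density _ _ R (sfprod mu1 mu2) gamma g gP h mh h0.
rewrite fubini_tonelli1//.
- by apply: emeasurable_funM => //; exact/measurable_EFinP.
- by move=> p; rewrite mule_ge0// lee_fin.
Qed.

End marginal_density.

Lemma KL_refl dd (T : measurableType dd) (rho eta : {finite_measure set T -> \bar R}) :
  (forall A, measurable A -> rho A = eta A) -> KL rho eta = 0%E.
Proof.
move=> rhoE; have eP : density eta rho (fun=> 1).
  by split=> // A mA; rewrite integral_cst// mul1e rhoE.
rewrite (KL_density eP) /entf ln1 mulr0 sub0r addNr; exact: integral0.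
Qed.

(** The plan carried by the diagonal moves nothing and has the prescribed marginals. *)
Lemma UOT_diag d (tau0 tau1 : R) (alpha : {finite_measure set (space R d) -> \bar R}) :
  0 < tau0 -> 0 < tau1 -> UOT tau0 tau1 alpha alpha = 0%E.
Proof.
move=> tau0_gt0 tau1_gt0; apply/eqP; rewrite eq_le UOT_ge0// andbT.
pose diag (x : space R d) := (x, x).
have mdiag : measurable_fun setT diag by exact: measurable_fun_pair.
pose diagm : {mfun space R d >-> (space R d * space R d)%type} :=
  HB.pack diag (isMeasurableFun.Build _ _ _ _ diag mdiag).
apply: ge_ereal_inf; exists (transport_cost tau0 tau1 alpha alpha (image_measure diagm alpha)).
  by exists (image_measure diagm alpha).
rewrite /transport_cost !KL_refl// !mule0 !adde0.
rewrite ge0_integral_pushforward//.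
- rewrite integral0_eq// => x _ /=; congr EFin.
  by rewrite /sqdist big1// => i _; rewrite subrr expr0n.
- by apply/measurable_EFinP; exact: measurable_sqdist.
- by move=> p _; rewrite lee_fin sqdist_ge0.
Qed.

End density_constructions.

(** * Relative entropy between Gaussian measures *)

Section gaussian_divergence.
Variables (R : realType) (d : nat).
(** The divergence of the masses plus [c] times the classical divergence of [N(m', S')] from
    [N(m, S)]. *)
Definition KL_gauss_value (c a : R) (m' m : 'cV[R]_d) (S' S : 'M[R]_d) : R :=
  c * ln (c / a) - c + a +
  c / 2 * (\tr (invmx S *m S') - d%:R - ln (\det (invmx S *m S')) + qform (invmx S) (m' - m)).

Lemma has_int_gauss_quad (a : R) (m : 'cV[R]_d) (S B : 'M[R]_d) l k :
  0 <= a -> posdefmx S -> B^T = B ->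
  has_int (scaled_gaussian a m S) (fun x => quadpoly k l B (colv x - m))
    (a * (k + \tr (S *m B) / 2)).
Proof.
move=> a0 pS sB; have aE := scaled_gaussianT m S a0.
have := has_intD (has_int_cst k aE) (has_int_gauss_poly m l a0 pS sB).
rewrite [k * a]mulrC -mulrDr; congr has_int.
by apply/funext => x; rewrite /quadpoly; ring.
Qed.

(** The logarithm of a ratio of Gaussian densities is a quadratic polynomial, integrated by
    [has_int_gauss_quad]. [rho] is given by its density because it will be a marginal of a plan. *)
Lemma KL_gauss (rho : {finite_measure set (space R d) -> \bar R}) (c a : R)
    (m' m : 'cV[R]_d) (S' S : 'M[R]_d) : 0 < c -> 0 < a -> posdefmx S' -> posdefmx S ->
  density (@leb R d) rho (fun x => c / gauss_mass S' * gauss_weight m' S' x) ->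
  KL rho (scaled_gaussian a m S) = (KL_gauss_value c a m' m S' S)%:E.
Proof.
move=> c0 a0 pS' pS rhoP.
have M0 := gauss_mass_gt0 pS; have M'0 := gauss_mass_gt0 pS'.
have etaP := scaled_gaussian_density m (ltW a0) pS.
have gP := scaled_gaussian_density m' (ltW c0) pS'.
set g := (fun x => c / gauss_mass S' * _) in rhoP gP.
set f := (fun x => a / gauss_mass S * gauss_weight m S x) in etaP.
have aM : 0 < a / gauss_mass S by rewrite divr_gt0.
have cM' : 0 < c / gauss_mass S' by rewrite divr_gt0.
have fgt0 x : 0 < f x by rewrite mulr_gt0 ?expR_gt0.
have ggt0 x : 0 < g x by rewrite mulr_gt0 ?expR_gt0.
have dP := density_div fgt0 etaP rhoP.
rewrite (KL_density dP).
pose D := m' - m.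
pose k := ln ((c / gauss_mass S') / (a / gauss_mass S)) + qform (invmx S) D / 2.
have sS := (posdef_inv pS).1; have sS' := (posdef_inv pS').1.
have kE : ln ((c / gauss_mass S') / (a / gauss_mass S)) =
    ln (c / gauss_mass S') - ln (a / gauss_mass S) by rewrite ln_div ?posrE.
have lnE (x : space R d) : ln (g x / f x) =
    quadpoly k (invmx S *m D) (invmx S - invmx S') (colv x - m').
  have lng : ln (g x) = ln (c / gauss_mass S') - qform (invmx S') (colv x - m') / 2.
    rewrite /g lnM ?posrE ?expR_gt0//.
    by rewrite gauss_weightE expRK mulNr.
  have lnf : ln (f x) = ln (a / gauss_mass S) - qform (invmx S) (colv x - m) / 2.
    rewrite /f lnM ?posrE ?expR_gt0//.
    by rewrite gauss_weightE expRK mulNr.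
  rewrite ln_div ?posrE// lng lnf /quadpoly /k kE.
  have -> : colv x - m = (colv x - m') + D by rewrite /D addrA subrK.
  rewrite (qformD _ _ sS) /dotv.
  rewrite -[bform 1%:M _ _]bform_tr trmx1 bformMr mul1mx.
  have -> : qform (invmx S - invmx S') (colv x - m') =
      qform (invmx S) (colv x - m') - qform (invmx S') (colv x - m').
    by rewrite /qform -!/(bform _ _ _) bformMD -[- invmx S']scaleN1r bformMZ mulN1r.
  by field.
have sB : (invmx S - invmx S')^T = invmx S - invmx S' by rewrite linearB/= sS sS'.
have hq := has_int_gauss_quad m' (invmx S *m D) k (ltW c0) pS' sB.
set z := c * _ in hq.
have mq : measurable_fun setT (fun x : space R d =>
    quadpoly k (invmx S *m D) (invmx S - invmx S') (colv x - m')).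
  exact: measurable_quadpoly.
have hrho := (has_int_density rhoP z mq).2 ((has_int_density gP z mq).1 hq).
have heta := (has_int_density dP z mq).1 hrho.
have rhoT : rho setT = c%:E.
  have [_ _ ->] := rhoP => //; have [_ _ <-] := gP => //.
  exact/scaled_gaussianT/ltW.
have h1 := density_has_int dP; rewrite rhoT/= in h1.
have h2 : has_int (scaled_gaussian a m S) (fun=> 1) (1 * a).
  by apply: has_int_cst; exact/scaled_gaussianT/ltW.
have [_] := has_intD (has_intB heta h1) h2.
under eq_integral => x _ do rewrite -lnE [ln _ * _]mulrC.
move=> ->; congr EFin; rewrite /z /k /KL_gauss_value mul1r mulmxBr raddfB/=.
rewrite mulmxV ?posdef_unit// mxtrace1 [\tr (S' *m _)]mxtrace_mulC -/D.
have dS := posdef_det_gt0 (posdef_inv pS); have dS' := posdef_det_gt0 pS'.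
have -> : ln (c / gauss_mass S' / (a / gauss_mass S)) =
    ln (c / a) - ln (\det (invmx S *m S')) / 2.
  have -> : c / gauss_mass S' / (a / gauss_mass S) =
      (c / a) * (Num.sqrt (\det (invmx S *m S')))^-1.
    rewrite /gauss_mass det_mulmx (det_inv S') (@sqrtrM _ (\det (invmx S))) ?ltW// sqrtrV ?ltW//.
    have p0 : 0 < Num.sqrt (2 * pi) ^+ d :> R.
      by rewrite exprn_gt0// sqrtr_gt0 mulr_gt0// pi_gt0.
    move: (Num.sqrt (2 * pi) ^+ d) p0 => p p0.
    have q0 : 0 < Num.sqrt (\det (invmx S)) by rewrite sqrtr_gt0.
    have q1 : 0 < Num.sqrt (\det S') by rewrite sqrtr_gt0.
    by move: (Num.sqrt (\det (invmx S))) (Num.sqrt (\det S')) q0 q1 => u w u0 w0;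
      field; rewrite !gt_eqF.
  have dd : 0 < \det (invmx S *m S') by rewrite det_mulmx mulr_gt0.
  rewrite lnM ?posrE ?divr_gt0 ?invr_gt0 ?sqrtr_gt0// lnV ?posrE ?sqrtr_gt0//.
  suff -> : ln (\det (invmx S *m S')) = 2 * ln (Num.sqrt (\det (invmx S *m S'))) by field.
  by rewrite -[X in ln X = _](sqr_sqrtr (ltW dd)) lnXn ?sqrtr_gt0// mulr_natl.
by field.
Qed.

End gaussian_divergence.

(** * Gaussian plans with noise *)

Section gaussian_plan.
Variables (R : realType) (d : nat).
Lemma measurable_qform_comp dd (T : measurableType dd) (P : 'M[R]_d) (u : T -> 'cV[R]_d) :
  (forall i, measurable_fun setT (fun t => u t i 0)) ->
  measurable_fun setT (fun t => qform P (u t)).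
Proof.
move=> mu; rewrite (_ : (fun _ => _) = fun t => \sum_i \sum_j u t i 0 * P i j * u t j 0); last first.
  by apply/funext => x; rewrite /qform -/(bform _ _ _) bformE.
apply: measurable_sum => i; apply: measurable_sum => j.
by do 2 apply: measurable_funM => //.
Qed.

Lemma qformMZ k (P : 'M[R]_d) v : qform (k *: P) v = k * qform P v.
Proof. exact: bformMZ. Qed.

Lemma qform_gram (B : 'M[R]_d) v : qform (B^T *m B) v = qform 1%:M (B *m v).
Proof. by rewrite /qform -!/(bform _ _ _) bformMr bformMl mul1mx. Qed.

(** The precision matrix of the second marginal, in the form in which it appears once [x] has been
    integrated out. *)
Lemma woodbury (S0 B : 'M[R]_d) (dl : R) : 0 < dl -> posdefmx S0 ->
  posdefmx (dl%:M + B *m S0 *m B^T) ->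
  invmx (dl%:M + B *m S0 *m B^T) =
  dl^-1%:M - dl^-1 ^+ 2 *: (B *m invmx (invmx S0 + dl^-1 *: (B^T *m B)) *m B^T).
Proof.
move=> dl0 pS0 pS1.
have u0 := posdef_unit pS0; have u1 := posdef_unit pS1.
have pL : posdefmx (invmx S0 + dl^-1 *: (B^T *m B)).
  apply: posdefD (posdef_inv pS0) _ _; first by rewrite linearZ/= trmx_mul trmxK.
  move=> v; rewrite qformMZ qform_gram; apply: mulr_ge0; first by rewrite invr_ge0 ltW.
  exact/qform_ge0/posdef1.
have uL := posdef_unit pL.
set L := _ + _ in pL uL *; set S1 := _ + _ in u1 *.
have E : dl^-1 *: (B^T *m B) = L - invmx S0 by rewrite /L addrC addKr.
set X := dl^-1%:M - _.
suff XS : X *m S1 = 1%:M.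
  by rewrite -[invmx S1]mul1mx -XS -mulmxA mulmxV// mulmx1.
have h : B *m invmx L *m B^T *m (B *m S0 *m B^T) =
    dl *: (B *m S0 *m B^T - B *m invmx L *m B^T).
  have -> : B *m invmx L *m B^T *m (B *m S0 *m B^T) =
      B *m invmx L *m (B^T *m B) *m S0 *m B^T by rewrite !mulmxA.
  have -> : B^T *m B = dl *: (L - invmx S0).
    by rewrite -E scalerA mulfV ?scale1r// gt_eqF.
  rewrite -!scalemxAr -!scalemxAl; congr (_ *: _).
  by rewrite mulmxBr mulmxKV// mulmxBl mulmxKV// mulmxBl.
rewrite /X /S1 mulmxBl !mulmxDr -!scalemxAl h.
rewrite mul_scalar_mx mul_mx_scalar mul_scalar_mx scale_scalar_mx mulVf ?gt_eqF//.
rewrite !scalerA scalerBr -[dl^-1 ^+ 2 * dl]mulrC.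
have -> : dl * dl^-1 ^+ 2 = dl^-1 by field; rewrite gt_eqF.
by rewrite [X in _ - X]addrCA subrr addr0 addrK.
Qed.

(** The noise alone makes the sum definite, whether or not [B] is invertible. *)
Lemma posdef_noise (S0 B : 'M[R]_d) (dl : R) : 0 < dl -> posdefmx S0 ->
  posdefmx (dl%:M + B *m S0 *m B^T).
Proof.
move=> dl0 pS0; rewrite -scalemx1; apply: posdefD.
- exact/posdefZ/posdef1.
- by rewrite !trmx_mul trmxK pS0.1 mulmxA.
- move=> v; have := qform_ge0 (B^T *m v) pS0.
  by rewrite /qform -!/(bform _ _ _) bformMl bformMr trmxK.
Qed.

Variables (c dl : R) (m0 n : 'cV[R]_d) (S0 A : 'M[R]_d).
Hypotheses (c0 : 0 < c) (dl0 : 0 < dl) (pS0 : posdefmx S0) (sA : A^T = A).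

Let B : 'M[R]_d := 1%:M + A.
Let S1 : 'M[R]_d := dl%:M + B *m S0 *m B^T.
Let Sd : 'M[R]_d := dl%:M.
Let T (x : space R d) : 'cV[R]_d := n + B *m (colv x - m0).

Let pSd : posdefmx Sd. Proof. by rewrite /Sd -scalemx1; exact/posdefZ/posdef1. Qed.
Let pS1 : posdefmx S1. Proof. exact: posdef_noise. Qed.

(** The plan has density [g]: [x] is drawn from a Gaussian, then [y] from a Gaussian around
    [T x]. *)
Let g0 (x : space R d) : R := c / gauss_mass S0 * gauss_weight m0 S0 x.
Let g1 (x y : space R d) : R := 1 / gauss_mass Sd * gauss_weight (T x) Sd y.
Let g (p : space R d * space R d) : R := g0 p.1 * g1 p.1 p.2.

Let g0P : density (@leb R d) (scaled_gaussian c m0 S0) g0.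
Proof. exact/scaled_gaussian_density/pS0/ltW. Qed.

Let g1P x : density (@leb R d) (scaled_gaussian 1 (T x) Sd) (g1 x).
Proof. exact: scaled_gaussian_density. Qed.

Let g0_ge0 x : 0 <= g0 x. Proof. by have [_ ->] := g0P. Qed.
Let g1_ge0 x y : 0 <= g1 x y. Proof. by have [_ ->] := g1P x. Qed.
Let g_ge0 p : 0 <= g p. Proof. by rewrite mulr_ge0. Qed.

Let mtnth i : measurable_fun setT (fun x : space R d => tnth x i).
Proof. exact: measurable_tnth. Qed.

Let measurable_g : measurable_fun setT g.
Proof.
apply: measurable_funM.
  by have [m0g _ _] := g0P; exact: (measurableT_comp m0g).
apply: measurable_funM => //; apply: measurableT_comp => //.
apply: measurable_funM => //; apply: measurableT_comp => //.
apply: measurable_qform_comp => i.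
rewrite (_ : (fun _ => _) = fun p : space R d * space R d =>
    tnth p.2 i - (n i 0 + \sum_j B i j * (tnth p.1 j - m0 j 0))); last first.
  apply/funext => p; rewrite /T !mxE; congr (_ - (_ + _)).
  by apply: eq_bigr => j _; rewrite !mxE.
apply: measurable_funB; first exact: (measurableT_comp (mtnth i)).
apply: measurable_funD => //; apply: measurable_sum => j.
apply: measurable_funM => //; apply: measurable_funB => //.
exact: (measurableT_comp (mtnth j)).
Qed.

Let integral_g1 x : (\int[@leb R d]_y (g1 x y)%:E = 1)%E.
Proof.
have [_ _ <-//] := g1P x; exact: scaled_gaussianT.
Qed.

Let integral_gx x : (\int[@leb R d]_y (g (x, y))%:E = (g0 x)%:E)%E.
Proof.
rewrite /g/=; under eq_integral do rewrite EFinM.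
rewrite ge0_integralZl//=.
- by rewrite integral_g1 mule1.
- by apply/measurable_EFinP; have [] := g1P x.
- by move=> y _; rewrite lee_fin.
- by rewrite lee_fin.
Qed.

Let integral_g : (\int[(@leb R d) \x (@leb R d)]_p (g p)%:E = c%:E)%E.
Proof.
rewrite fubini_tonelli1.
- under eq_integral => x _ do rewrite /fubini_F/= integral_gx.
  by have [_ _ <-//] := g0P; exact/scaled_gaussianT/ltW.
- exact/measurable_EFinP.
- by move=> p; rewrite lee_fin.
Qed.

Let L : 'M[R]_d := invmx S0 + dl^-1 *: (B^T *m B).
Let kap : R := (c / gauss_mass S0) * (1 / gauss_mass Sd) *
  (Num.sqrt (2 * pi) ^+ d / Num.sqrt (\det L)).

Let posdef_L : posdefmx L.
Proof.
apply: posdefD (posdef_inv pS0) _ _; first by rewrite linearZ/= trmx_mul trmxK.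
move=> v; rewrite qformMZ qform_gram; apply: mulr_ge0; first by rewrite invr_ge0 ltW.
exact/qform_ge0/posdef1.
Qed.

(** Disintegration in the other order: completing the square in [x] leaves a Gaussian in [x] of
    precision [L] times a factor in [y], whose quadratic form is identified by [woodbury]. *)
Let g_marginal2 x y : g (x, y) = (c / gauss_mass S0) * (1 / gauss_mass Sd) *
  gauss_weight n S1 y *
  expR (- qform L (colv x - (m0 + dl^-1 *: (invmx L *m (B^T *m (colv y - n))))) / 2).
Proof.
rewrite /g /g0 /g1/= mulrACA -[RHS]mulrA; congr (_ * _).
rewrite !gauss_weightE -!expRD; congr expR.
set z := colv y - n; set u := colv x - m0.
have -> : colv y - T x = z - B *m u by rewrite /T opprD addrA.
have -> : colv x - (m0 + dl^-1 *: (invmx L *m (B^T *m z))) =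
    u + invmx L *m (- dl^-1 *: (B^T *m z)).
  by rewrite -scalemxAr scaleNr opprD addrA.
have := qform_complete_square (- dl^-1 *: (B^T *m z)) u posdef_L.
have -> : qform (invmx S1) z = dl^-1 * qform 1%:M z -
    qform (invmx L) (- dl^-1 *: (B^T *m z)).
  rewrite woodbury// -/L qformZ sqrrN /qform -!/(bform _ _ _) bformMD.
  rewrite -scaleNr bformMZ -[dl^-1%:M]scalemx1 bformMZ mulNr; congr (_ - _ * _).
  by rewrite /bform trmx_mul trmxK !mulmxA.
have -> : qform (invmx Sd) (z - B *m u) = dl^-1 * qform 1%:M z
   + 2 * dotv (- dl^-1 *: (B^T *m z)) u + dl^-1 * qform (B^T *m B) u.
  rewrite /Sd invmx_scalar -[dl^-1%:M]scalemx1 qformMZ.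
  rewrite qformD ?trmx1// qformN /dotv bformZl.
  have -> : bform 1%:M z (- (B *m u)) = - bform 1%:M (B^T *m z) u.
    by rewrite -scaleN1r bformZr mulN1r bformMr bformMl trmxK mul1mx mulmx1.
  rewrite -qform_gram.
  by ring.
have -> : qform L u = qform (invmx S0) u + dl^-1 * qform (B^T *m B) u.
  by rewrite /L /qform -!/(bform _ _ _) bformMD bformMZ.
by lra.
Qed.

Let integral_gy y : (\int[@leb R d]_x (g (x, y))%:E = (kap * gauss_weight n S1 y)%:E)%E.
Proof.
under eq_integral => x _ do rewrite g_marginal2 EFinM.
rewrite ge0_integralZl//=.
- by rewrite (integral_gauss _ posdef_L) -EFinM /kap; congr EFin; ring.
- apply/measurable_EFinP; apply: measurableT_comp => //; apply: measurable_funM => //.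
  by apply: measurableT_comp => //; exact: measurable_qform.
- have M0 := gauss_mass_gt0 pS0; have Md := gauss_mass_gt0 pSd.
  rewrite lee_fin; apply: mulr_ge0; last exact: expR_ge0.
  by apply: mulr_ge0; apply/ltW; rewrite divr_gt0.
Qed.

Lemma gaussian_plan :
  exists gamma : {finite_measure set (space R d * space R d)%type -> \bar R},
  [/\ density (@leb R d) (marginal1 gamma)
        (fun x => c / gauss_mass S0 * gauss_weight m0 S0 x),
      density (@leb R d) (marginal2 gamma)
        (fun x => c / gauss_mass S1 * gauss_weight n S1 x) &
      (\int[gamma]_p (sqdist p.1 p.2)%:E =
       (c * (qform 1%:M (n - m0) + \tr (S0 *m (A *m A)) + d%:R * dl))%:E)%E].
Proof.
have [gamma gP] : exists gamma : {finite_measure set (space R d * space R d)%type -> \bar R},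
    density ((@leb R d) \x (@leb R d))%E gamma g.
  by exists (withdensity measurable_g g_ge0 integral_g); exact: withdensityP.
have gT : gamma setT = c%:E by have [_ _ ->//] := gP.
exists gamma; split.
- by apply: (marginal1_density gP) => //; have [] := g0P.
- have kap0 : 0 <= kap.
    have M0 := gauss_mass_gt0 pS0; have Md := gauss_mass_gt0 pSd.
    apply: mulr_ge0; first by apply: mulr_ge0; apply/ltW; rewrite divr_gt0.
    by rewrite divr_ge0 ?exprn_ge0 ?sqrtr_ge0.
  have mw : measurable_fun setT (gauss_weight n S1) by exact: measurable_gauss_weight.
  have hP : density (@leb R d) (marginal2 gamma) (fun x => kap * gauss_weight n S1 x).
    apply: (marginal2_density gP) => //; first exact: measurable_funM.
    by move=> x; rewrite mulr_ge0 ?expR_ge0.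
  (* The constant is found by comparing total masses, which spares a determinant identity. *)
  suff <- : kap = c / gauss_mass S1 by [].
  have M1 := gauss_mass_gt0 pS1.
  apply: (mulIf (lt0r_neq0 M1)); rewrite divfK ?gt_eqF//.
  apply: EFin_inj; rewrite -gT.
  transitivity (marginal2 gamma setT); last first.
    by rewrite [LHS]/= /image_measure/pushforward preimage_setT.
  have [_ _ ->//] := hP; under eq_integral do rewrite EFinM.
  rewrite ge0_integralZl//.
  + by rewrite EFinM -(gauss_unnormalizedT n pS1).
  + exact/measurable_EFinP.
  + by move=> x _; rewrite lee_fin expR_ge0.
have mcost : measurable_fun setT (fun p : space R d * space R d => (sqdist p.1 p.2)%:E).
  by apply/measurable_EFinP; exact: measurable_sqdist.
have cost0 (p : space R d * space R d) : (0 <= (sqdist p.1 p.2)%:E)%E.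
  by rewrite lee_fin sqdist_ge0.
rewrite (integral_product_density gP mcost cost0).
have msq x : measurable_fun setT (fun y : space R d => sqdist x y).
  apply: measurable_sum => i; apply: measurable_funX; apply: measurable_funB => //.
  exact: mtnth.
(* The mean squared distance from [x] to its random target: squared displacement of the centre plus
   the trace of the noise covariance. *)
pose cost x := qform 1%:M (T x - colv x) + d%:R * dl.
have inner x : (\int[@leb R d]_y ((sqdist x y)%:E * (g (x, y))%:E) = (cost x * g0 x)%:E)%E.
  have h : has_int (scaled_gaussian 1 (T x) Sd) (fun y => sqdist x y) (cost x).
    have := has_int_gauss_quad (T x) (2 *: (1%:M *m (T x - colv x)))
      (qform 1%:M (T x - colv x)) ler01 pSd (B := 2 *: (1%:M *m 1%:M)) _.
    rewrite linearZ/= mulmx1 trmx1 => /(_ erefl).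
    rewrite mul1r -scalemxAr mxtraceZ mulmx1 mxtrace_scalar -[dl *+ d]mulr_natl.
    rewrite [2 * _ / 2](_ : _ = d%:R * dl); last by field.
    congr has_int; apply/funext => y.
    have := qform1_affine (T x - colv x) (colv y - T x) (trmx1 R d).
    by rewrite !mul1mx => <-; rewrite sqdistE; congr qform; rewrite addrC subrKA.
  have [_ hv] := (has_int_density (g1P x) _ (msq x)).1 h.
  transitivity (\int[@leb R d]_y ((g0 x)%:E * (sqdist x y * g1 x y)%:E))%E.
    by apply: eq_integral => y _; rewrite -!EFinM /g/=; congr EFin; ring.
  rewrite ge0_integralZl//=.
  + by rewrite hv -EFinM mulrC.
  + apply/measurable_EFinP; apply: measurable_funM; first exact: msq.
    by have [] := g1P x.
  + by move=> y _; rewrite lee_fin mulr_ge0// sqdist_ge0.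
  + by rewrite lee_fin.
under eq_integral => x _ do rewrite inner.
have costE : cost = fun x => quadpoly (qform 1%:M (n - m0) + d%:R * dl)
    (2 *: (A *m (n - m0))) (2 *: (A *m A)) (colv x - m0).
  apply/funext => x; rewrite /cost.
  have -> : T x - colv x = (n - m0) + A *m (colv x - m0).
    rewrite /T /B mulmxDl mul1mx; move: (A *m _) => w.
    by apply/matrixP => i j; rewrite !mxE; ring.
  by rewrite qform1_affine// /quadpoly; ring.
have sAA : (2 *: (A *m A))^T = 2 *: (A *m A) by rewrite linearZ/= trmx_mul sA.
have hq := has_int_gauss_quad m0 (2 *: (A *m (n - m0)))
  (qform 1%:M (n - m0) + d%:R * dl) (ltW c0) pS0 sAA.
have mq := measurable_quadpoly (qform 1%:M (n - m0) + d%:R * dl)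
  (2 *: (A *m (n - m0))) (2 *: (A *m A)) m0.
have [_] := (has_int_density g0P _ mq).1 hq.
under eq_integral => x _ do rewrite costE.
by move=> ->; congr EFin; rewrite -scalemxAr mxtraceZ; field.
Qed.

End gaussian_plan.

Section upper_bound.
Variables (R : realType) (d : nat).

Lemma UOT_le_gauss (tau0 tau1 a b c dl : R) (m m1 m0 n : 'cV[R]_d) (S S1 S0 A : 'M[R]_d) :
  0 < a -> 0 < b -> 0 < c -> 0 < dl ->
  posdefmx S -> posdefmx S1 -> posdefmx S0 -> A^T = A ->
  (UOT tau0 tau1 (scaled_gaussian a m S) (scaled_gaussian b m1 S1) <=
   (c * (qform 1%:M (n - m0) + \tr (S0 *m (A *m A)) + d%:R * dl) +
    tau0 * KL_gauss_value c a m0 m S0 S +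
    tau1 * KL_gauss_value c b n m1 (dl%:M + (1%:M + A) *m S0 *m (1%:M + A)^T) S1)%:E)%E.
Proof.
move=> a0 b0 c0 dl0 pS pS1 pS0 sA.
have [gamma [g0 g1 cost]] := gaussian_plan m0 n c0 dl0 pS0 sA.
apply: ge_ereal_inf; exists (transport_cost tau0 tau1 (scaled_gaussian a m S)
  (scaled_gaussian b m1 S1) gamma); first by exists gamma.
rewrite /transport_cost cost (KL_gauss m c0 a0 pS0 pS g0).
by rewrite (KL_gauss m1 c0 b0 (posdef_noise _ dl0 pS0) pS1 g1).
Qed.

(** The divergence has no first-order term; its second-order term is [q^2 / (2 a0)] for the masses
    plus [a0] times half the Fisher-Rao form of the relative displacement of mean and covariance. *)
Lemma KL_gauss_expansion (c a : R -> R) (m' m : R -> 'cV[R]_d) (S' S : R -> 'M[R]_d)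
    (a0 q : R) (D : 'cV[R]_d) (P N : 'M[R]_d) :
  a0 != 0 -> lim0 a a0 -> lim0 (fun e => (c e - a e) / e) q ->
  mlim (fun e => e^-1 *: (m' e - m e)) D ->
  mlim (fun e => invmx (S e)) P ->
  mlim (fun e => e^-1 *: (invmx (S e) *m S' e - 1%:M)) N ->
  lim0 (fun e => KL_gauss_value (c e) (a e) (m' e) (m e) (S' e) (S e) / e ^+ 2)
    (q ^+ 2 / (2 * a0) + a0 / 2 * (\tr (N *m N) / 2 + qform P D)).
Proof.
move=> a00 alim cqlim Dlim Plim Nlim.
have c_lim : lim0 c a0.
  apply: (lim0_ext (f := fun e => a e + (c e - a e) / e * e)).
    by move=> e e0; rewrite divfK// addrC subrK.
  by apply: (lim0_eq _ (lim0D alim (lim0M cqlim (@lim0_id R)))); rewrite mulr0 addr0.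
have an0 : \forall e \near (0 : R)^', a e != 0 by exact: (cvgr_neq0 a0).
pose x e := (c e - a e) / a e.
have xlim : lim0 (fun e => x e / e) (q / a0).
  apply: (lim0_near (f := fun e => (c e - a e) / e * (a e)^-1)).
    by apply: filterS2 an0 (near0_neq0 R) => e ae e0; rewrite /x mulrAC.
  exact: (lim0M cqlim (lim0V a00 alim)).
have x0 := lim0_quot xlim.
have l1 := lim0_ln xlim.
have [_ l2] := lndet_expansion Nlim.
have l3 := lim0_qform Plim Dlim.
(* With [c = a (1 + x)] the mass part is [a ((1 + x) ln (1 + x) - x)], regrouped here to isolate
   [ln (1 + x) - x]. *)
apply: (lim0_near (f := fun e =>
  a e * ((1 + x e) * ((ln (1 + x e) - x e) / e ^+ 2) + (x e / e) ^+ 2)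
  + c e / 2 * (qform (invmx (S e)) (e^-1 *: (m' e - m e))
     - (ln (\det (1%:M + (invmx (S e) *m S' e - 1%:M)))
        - \tr (invmx (S e) *m S' e - 1%:M)) / e ^+ 2))).
  apply: filterS2 an0 (near0_neq0 R) => e ae e0.
  rewrite /KL_gauss_value addrC qformZ addrCA subrr addr0 raddfB/= mxtrace1.
  have -> : c e / a e = 1 + x e by rewrite /x mulrBl divff// addrC subrK.
  have -> : x e = c e / a e - 1 by rewrite /x mulrBl divff.
  by field; rewrite e0 ae.
apply: (lim0_eq _ (lim0D
  (lim0M alim (lim0D (lim0M (lim0D (lim0_cst 1) x0) l1) (lim0X 2 xlim)))
  (lim0M (lim0M c_lim (lim0_cst _)) (lim0B l3 l2)))).
by rewrite addr0 mul1r; field.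
Qed.

Variables (tau0 tau1 a adot : R) (m : 'cV[R]_d) (S : 'M[R]_d).
Hypotheses (a_gt0 : 0 < a) (pS : posdefmx S).
Variables (m1 : R -> 'cV[R]_d) (S1 : R -> 'M[R]_d) (mdot : 'cV[R]_d) (H : 'M[R]_d).
Hypothesis m1lim : mlim (fun e => e^-1 *: (m1 e - m)) mdot.
Hypothesis S1lim : mlim (fun e => e^-1 *: (S1 e - S)) H.
Hypothesis pS1 : \forall e \near (0 : R)^', posdefmx (S1 e).

(** The [e^2] coefficient of the cost of a plan of mass [a + e p] whose first marginal is displaced
    by [e (w, K)], with velocity [v + A (x - m)]. [w1] and [K1] are the displacements of the second
    marginal relative to the target. *)
Definition primal_value (p : R) (w : 'cV[R]_d) (K : 'M[R]_d) (v : 'cV[R]_d) (A : 'M[R]_d) : R :=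
  let w1 := w + v - mdot in
  let K1 := K + (A *m S + S *m A) - H in
  a * (qform 1%:M v + \tr (S *m (A *m A)))
  + tau0 * (p ^+ 2 / (2 * a) + a / 2 *
      (\tr (invmx S *m K *m (invmx S *m K)) / 2 + qform (invmx S) w))
  + tau1 * ((p - adot) ^+ 2 / (2 * a) + a / 2 *
      (\tr (invmx S *m K1 *m (invmx S *m K1)) / 2 + qform (invmx S) w1)).

Lemma UOT_upper_bound p w K v A : K^T = K -> A^T = A ->
  exists2 D : R -> R, lim0 (fun e => D e / e ^+ 2) (primal_value p w K v A) &
    \forall e \near (0 : R)^', (UOT tau0 tau1 (scaled_gaussian a m S)
       (scaled_gaussian (a + e * adot) (m1 e) (S1 e)) <= (D e)%:E)%E.
Proof.
move=> sK sA.
have uS := posdef_unit pS.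
have S1l := S1_lim S1lim.
pose b e := a + e * adot.
pose c e := a + e * p.
have lin_lim q : lim0 (fun e : R => a + e * q) a.
  apply: (lim0_eq _ (lim0D (lim0_cst a) (lim0M (@lim0_id R) (lim0_cst q)))).
  by rewrite mul0r addr0.
have blim : lim0 b a := lin_lim adot.
have clim : lim0 c a := lin_lim p.
pose m0 e := m + e *: w.
pose S0 e := S + e *: K.
have eKlim n (X : 'M[R]_(d, n)) : mlim (fun e => e *: X) 0.
  by apply: (mlim_eq _ (mlimZ (@lim0_id R) (mlim_cst X))); rewrite scale0r.
have S0l : mlim S0 S.
  by apply: (mlim_eq _ (mlimD (mlim_cst S) (eKlim _ K))); rewrite addr0.
(* The velocity [v + A (x - m)] at the shifted mean [m0 e]. *)
pose v0 e := v + A *m (e *: w).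
have v0lim : mlim v0 v.
  apply: (mlim_eq _ (mlimD (mlim_cst v) (mlimM (mlim_cst A) (eKlim _ w)))).
  by rewrite mulmx0 addr0.
pose n e := m0 e + e *: v0 e.
(* A noise of variance [e^4] adds order [e^4] to the cost and, after division by [e], order [e^3] to
   the covariance: both vanish in the limit. *)
pose Se e := (e ^+ 4)%:M + (1%:M + e *: A) *m S0 e *m (1%:M + e *: A)^T.
pose D e := c e * (qform 1%:M (n e - m0 e) + \tr (S0 e *m ((e *: A) *m (e *: A))) + d%:R * e ^+ 4)
  + tau0 * KL_gauss_value (c e) a (m0 e) m (S0 e) S
  + tau1 * KL_gauss_value (c e) (b e) (n e) (m1 e) (Se e) (S1 e).
exists D.
  have an0 : a != 0 by rewrite gt_eqF.
  have k0 : lim0 (fun e => KL_gauss_value (c e) a (m0 e) m (S0 e) S / e ^+ 2)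
      (p ^+ 2 / (2 * a) + a / 2 *
      (\tr (invmx S *m K *m (invmx S *m K)) / 2 + qform (invmx S) w)).
    apply: (KL_gauss_expansion (a := fun=> a) (m := fun=> m) (S := fun=> S) an0).
    - exact: lim0_cst.
    - by apply: (lim0_ext _ (lim0_cst p)) => e e0; rewrite /c; field.
    - apply: (mlim_ext _ (mlim_cst w)) => e e0.
      by rewrite /m0 addrC addKr scalerA mulVf// scale1r.
    - exact: mlim_cst.
    - apply: (mlim_ext _ (mlim_cst _)) => e e0.
      by rewrite /S0 mulmxDr mulVmx// addrC addKr -scalemxAr scalerA mulVf// scale1r.
  have k1 : lim0 (fun e => KL_gauss_value (c e) (b e) (n e) (m1 e) (Se e) (S1 e) / e ^+ 2)
      ((p - adot) ^+ 2 / (2 * a) + a / 2 *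
      (\tr (invmx S *m (K + (A *m S + S *m A) - H) *m
          (invmx S *m (K + (A *m S + S *m A) - H))) / 2
       + qform (invmx S) (w + v - mdot))).
    apply: (KL_gauss_expansion an0 blim).
    - by apply: (lim0_ext _ (lim0_cst (p - adot))) => e e0; rewrite /c /b; field.
    - apply: (mlim_ext _ (mlimB (mlimD (mlim_cst w) v0lim) m1lim)) => e e0.
      rewrite /n /m0; apply/matrixP => i j; rewrite !mxE.
      by move: (v0 e i j) => v0e; field.
    - exact: mlim_inv.
    - pose G e := K + A *m S0 e + S0 e *m A + e *: (A *m S0 e *m A) + (e ^+ 3)%:M.
      have Glim : mlim G (K + (A *m S + S *m A)).
        have e3 : mlim (fun e : R => (e ^+ 3)%:M : 'M[R]_d) 0.
          apply: (mlim_ext (M := fun e => e ^+ 3 *: 1%:M)).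
            by move=> e _; rewrite scalemx1.
          apply: (mlim_eq _ (mlimZ (lim0X 3 (@lim0_id R)) (mlim_cst 1%:M))).
          by rewrite expr0n scale0r.
        have h1 := mlimM (mlim_cst A) S0l.
        have h2 := mlimM S0l (mlim_cst A).
        have h3 := mlimZ (@lim0_id R) (mlimM h1 (mlim_cst A)).
        apply: (mlim_eq _ (mlimD (mlimD (mlimD (mlimD (mlim_cst K) h1) h2) h3) e3)).
        by rewrite scale0r !addr0 addrA.
      apply: (mlim_near (M := fun e => invmx (S1 e) *m (G e - e^-1 *: (S1 e - S)))).
        apply: filterS2 pS1 (near0_neq0 R) => e pS1e e0.
        rewrite -(mulVmx (posdef_unit pS1e)) -mulmxBr scalemxAr; congr (_ *m _).
        have -> : Se e - S1 e = e *: G e - (S1 e - S); last first.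
          by rewrite [RHS]scalerBr scalerA mulVf// scale1r.
        have -> : Se e = (e ^+ 4)%:M + (S0 e + e *: (A *m S0 e)
            + e *: (S0 e *m A + e *: (A *m S0 e *m A))).
          have BT : (1%:M + e *: A)^T = 1%:M + e *: A.
            by rewrite linearD/= trmx1 linearZ/= sA.
          rewrite /Se BT mulmxDr mulmx1 mulmxDl mul1mx.
          by rewrite -!scalemxAr mulmxDl -!scalemxAl.
        rewrite /G; move: (A *m S0 e *m A) (A *m S0 e) (S0 e *m A) => X Y Z.
        apply/matrixP => i j; rewrite /S0 !mxE.
        by case: (i == j); rewrite ?mulr1n ?mulr0n; ring.
      exact: (mlimM (mlim_inv uS S1l) (mlimB Glim S1lim)).
  pose tr0 e := qform 1%:M (v0 e) + \tr (S0 e *m (A *m A)) + d%:R * e ^+ 2.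
  have tr0lim : lim0 tr0 (qform 1%:M v + \tr (S *m (A *m A))).
    have h1 := lim0_qform (mlim_cst 1%:M) v0lim.
    have h2 := lim0_tr (mlimM S0l (mlim_cst (A *m A))).
    apply: (lim0_eq _ (lim0D (lim0D h1 h2) (lim0M (lim0_cst _) (lim0X 2 (@lim0_id R))))).
    by rewrite expr0n mulr0 addr0.
  apply: (lim0_ext (f := fun e => c e * tr0 e
    + tau0 * (KL_gauss_value (c e) a (m0 e) m (S0 e) S / e ^+ 2)
    + tau1 * (KL_gauss_value (c e) (b e) (n e) (m1 e) (Se e) (S1 e) / e ^+ 2))).
    move=> e e0; rewrite /D /tr0.
    have -> : n e - m0 e = e *: v0 e by rewrite /n addrC addKr.
    rewrite qformZ -scalemxAl -!scalemxAr !mxtraceZ.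
    by move: (KL_gauss_value _ _ _ _ _ _) (KL_gauss_value _ _ _ _ _ _) => x y; field.
  exact: (lim0D (lim0D (lim0M clim tr0lim) (lim0M (lim0_cst tau0) k0)) (lim0M (lim0_cst tau1) k1)).
have cgt : \forall e \near (0:R)^', 0 < c e by exact: lim0_gt clim.
have bgt : \forall e \near (0:R)^', 0 < b e by exact: lim0_gt blim.
have pS0 : \forall e \near (0:R)^', posdefmx (S0 e).
  have sym : \forall e \near (0:R)^', (e *: K)^T = e *: K.
    by near=> e; rewrite linearZ/= sK.
  exact: (posdef_near pS sym (eKlim _ K)).
near=> e; apply: UOT_le_gauss => //.
- by near: e.
- by near: e.
- have e0 : e != 0 by near: e; exact: near0_neq0.
  by rewrite exprn_even_gt0.
- by near: e.
- by near: e.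
- by rewrite linearZ/= sA.
Unshelve. all: by end_near. Qed.

End upper_bound.

(** * The parallel sum *)

Section parallel_sum_closed_form.
Variable R : realType.

Lemma qform_symC d (P : 'M[R]_d) u v : P^T = P -> bform P u v = bform P v u.
Proof. by move=> sP; rewrite -bform_tr sP. Qed.

(* Integrate the quadratic form of [Q] against the centred Gaussian of covariance [S]. *)
Lemma trace_psd_ge0 d (S Q : 'M[R]_d) : posdefmx S -> Q^T = Q ->
  (forall v, 0 <= qform Q v) -> 0 <= \tr (S *m Q).
Proof.
move=> pS sQ Q0.
have h := has_int_gauss_poly 0 0 (@ler01 R) pS sQ.
have z : has_int (scaled_gaussian 1 0 S) (fun=> 0) (0 * 1).
  by apply: has_int_cst; exact: scaled_gaussianT.
have dot0 (w : 'cV[R]_d) : dotv 0 w = 0 by rewrite /dotv -(scale0r w) bformZl mul0r.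
have := has_int_le z h; rewrite mul0r mul1r => /(_ _)/wrap[x|].
  by rewrite dot0 addr0 divr_ge0.
by rewrite pmulr_lge0// invr_gt0.
Qed.

Lemma trace_congr_ge0 d (S P X : 'M[R]_d) : posdefmx S -> posdefmx P ->
  0 <= \tr (X^T *m P *m X *m S).
Proof.
move=> pS pP; rewrite mxtrace_mulC; apply: trace_psd_ge0 => //.
  by rewrite !trmx_mul trmxK pP.1 mulmxA.
move=> v; have := qform_ge0 (X *m v) pP.
by rewrite /qform trmx_mul !mulmxA.
Qed.

Lemma trace_congr_gt0 d (P X : 'M[R]_d) : posdefmx P -> X != 0 ->
  0 < \tr (X^T *m P *m X).
Proof.
move=> pP X0.
have -> : \tr (X^T *m P *m X) = \sum_j qform P (col j X).
  apply: eq_bigr => j _; rewrite /qform tr_col.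
  rewrite -row_mul mxE [RHS]mxE; apply: eq_bigr => k _.
  by rewrite [row _ _ _ _]mxE [col _ _ _ _]mxE.
have [j Xj] : exists j, col j X != 0.
  apply/existsP; apply: contra_neqT X0; rewrite negb_exists => /forallP X0.
  apply/matrixP => i j; have := X0 j; rewrite negbK => /eqP/matrixP/(_ i 0).
  by rewrite !mxE.
rewrite (bigD1 j)//= ltr_pwDl//; first exact: pP.2.
by apply: sumr_ge0 => k _; exact: qform_ge0.
Qed.

Section solve.
Variables (d : nat) (f : {linear 'M[R]_d -> 'M[R]_d}).
Hypothesis finj : forall X, f X = 0 -> X = 0.

Lemma lin_mx_unit : lin_mx f \in unitmx.
Proof.
rewrite unitmxE unitfE; apply/det0P => -[v v0 vf].
have := mul_vec_lin f (vec_mx v); rewrite vec_mxK vf => /esym/(congr1 vec_mx).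
rewrite mxvecK linear0 => /finj /(congr1 mxvec); rewrite vec_mxK linear0 => v0'.
by rewrite v0' eqxx in v0.
Qed.

(** [lyapunov_inv] and [uot_cov] both have this shape, so each solves its equation as soon as its
    operator is injective. *)
Lemma lin_mx_solve H : f (vec_mx (mxvec H *m invmx (lin_mx f))) = H.
Proof.
apply: (can_inj mxvecK); rewrite -mul_vec_lin vec_mxK mulmxKV//.
exact: lin_mx_unit.
Qed.

Lemma lin_mx_solveK X : vec_mx (mxvec (f X) *m invmx (lin_mx f)) = X.
Proof. by rewrite -mul_vec_lin mulmxK ?mxvecK//; exact: lin_mx_unit. Qed.

Hypothesis ftr : forall X, f X^T = (f X)^T.

(** The transpose of the solution solves the same equation, so injectivity identifies them. *)
Lemma lin_mx_solve_sym H : H^T = H ->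
  (vec_mx (mxvec H *m invmx (lin_mx f)))^T = vec_mx (mxvec H *m invmx (lin_mx f)).
Proof.
move=> sH; set X := vec_mx _; have fX : f X = H by exact: lin_mx_solve.
apply/subr0_eq/finj; rewrite linearB/= ftr fX sH subrr//.
Qed.

End solve.

Variable d : nat.
Implicit Types (S X H A : 'M[R]_d) (r : R).

(* Half of its inverse represents the parallel sum of the covariance parts of the
   Bures-Wasserstein form and of [r] times the Fisher-Rao form. *)
Definition uot_op r S X : 'M[R]_d := S *m X + X *m S + r^-1 *: (S *m X *m S).

Lemma uot_op_linear r S : linear (uot_op r S).
Proof.
move=> a X Y; rewrite /uot_op !mulmxDr !mulmxDl -!scalemxAr -!scalemxAl !scalerDr.
rewrite !scalerA (mulrC r^-1 a).
by move: (S *m X *m S) (S *m Y *m S) (S *m X) (S *m Y) (X *m S) (Y *m S) => *;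
  apply/matrixP => i j; rewrite !mxE; ring.
Qed.

HB.instance Definition _ r S := @GRing.isLinear.Build R 'M[R]_d 'M[R]_d _
  (uot_op r S) (uot_op_linear r S).

Lemma lyapunov_linear S : linear (lyapunov S).
Proof.
move=> a X Y; rewrite /lyapunov !mulmxDr !mulmxDl -!scalemxAr -!scalemxAl !scalerDr.
by rewrite addrACA.
Qed.

HB.instance Definition _ S := @GRing.isLinear.Build R 'M[R]_d 'M[R]_d _
  (lyapunov S) (lyapunov_linear S).

(** The case [r = 0] is included because [0^-1 = 0] makes [uot_op 0 S] the Lyapunov operator, which
    thereby inherits injectivity. *)
Lemma uot_op_trace_gt0 r S X : 0 <= r -> posdefmx S -> X != 0 ->
  0 < \tr (X^T *m uot_op r S X).
Proof.
move=> r0 pS X0; rewrite /uot_op !mulmxDr !raddfD/= -scalemxAr mxtraceZ !mulmxA.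
rewrite ltr_wpDr ?mulr_ge0 ?invr_ge0 ?trace_congr_ge0// ltr_pwDl ?trace_congr_gt0//.
by have := trace_congr_ge0 X pS (posdef1 R d); rewrite mulmx1.
Qed.

Lemma uot_op_inj r S X : 0 <= r -> posdefmx S -> uot_op r S X = 0 -> X = 0.
Proof.
move=> r0 pS fX; apply/eqP; apply: contraTT isT => X0.
by have := uot_op_trace_gt0 r0 pS X0; rewrite fX mulmx0 mxtrace0 ltxx.
Qed.

Lemma uot_op_tr r S X : S^T = S -> uot_op r S X^T = (uot_op r S X)^T.
Proof.
move=> sS; rewrite /uot_op !linearD/= linearZ/= !trmx_mul sS mulmxA.
by rewrite (addrC (X^T *m S)).
Qed.

Lemma uot_op0 S X : uot_op 0 S X = lyapunov S X.
Proof. by rewrite /uot_op invr0 scale0r addr0. Qed.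

Lemma lyapunov_inj S X : posdefmx S -> lyapunov S X = 0 -> X = 0.
Proof. by move=> pS; rewrite -uot_op0; exact: uot_op_inj. Qed.

Lemma lyapunov_invK S X : posdefmx S -> lyapunov_inv S (lyapunov S X) = X.
Proof. by move=> pS; apply: lin_mx_solveK => Y; exact: lyapunov_inj. Qed.

Lemma lyapunov_solve S H : posdefmx S -> H^T = H ->
  exists2 A, A^T = A & H = lyapunov S A.
Proof.
move=> pS sH; exists (lyapunov_inv S H).
  apply: lin_mx_solve_sym => // [Y|Y]; first exact: lyapunov_inj.
  by have := uot_op_tr 0 Y pS.1; rewrite !uot_op0.
by rewrite [RHS]lin_mx_solve// => Y; exact: lyapunov_inj.
Qed.

Definition uot_mean r S (m : 'cV[R]_d) : 'cV[R]_d := invmx (1%:M + r^-1 *: S) *m m.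

Definition uot_cov r S H : 'M[R]_d := vec_mx (mxvec H *m invmx (lin_mx (uot_op r S))).

Lemma posdef_mean r S : 0 < r -> posdefmx S -> posdefmx (1%:M + r^-1 *: S).
Proof.
move=> r0 pS; apply: posdefD (posdef1 R d) _ _; first by rewrite linearZ/= pS.1.
move=> v; rewrite qformMZ; apply: mulr_ge0; first by rewrite invr_ge0 ltW.
exact: qform_ge0.
Qed.

Lemma uot_meanE r S m : 0 < r -> posdefmx S ->
  m = uot_mean r S m + r^-1 *: (S *m uot_mean r S m).
Proof.
move=> r0 pS; have u := posdef_unit (posdef_mean r0 pS).
by rewrite scalemxAl -[X in X + _]mul1mx -mulmxDl /uot_mean mulKVmx.
Qed.

Lemma uot_covE r S H : 0 < r -> posdefmx S -> uot_op r S (uot_cov r S H) = H.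
Proof.
by move=> r0 pS; apply: lin_mx_solve => X; apply: uot_op_inj => //; exact: ltW.
Qed.

Lemma uot_cov_sym r S H : 0 < r -> posdefmx S -> H^T = H ->
  (uot_cov r S H)^T = uot_cov r S H.
Proof.
move=> r0 pS; apply: lin_mx_solve_sym => X; first by apply: uot_op_inj => //; exact: ltW.
exact/uot_op_tr/pS.1.
Qed.

(** Pairing of [y] with the potential [(v, A)] that solves the stationarity equations for [x]. It
    displays as a bilinear form what [parallel_sum] defines as an infimum. *)
Definition par_form r S (x y : 'cV[R]_d * 'M[R]_d) : R :=
  bform 1%:M (uot_mean r S x.1) y.1 + \tr (uot_cov r S x.2 *m y.2) / 2.

(** The infimum in terms of [(v, A)]: the Bures-Wasserstein part at [(v, S A + A S)] plus [r] times
    the Fisher-Rao part at the remainder [(S v / r, S A S / r)]. *)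
Definition par_value r S (v : 'cV[R]_d) A : R :=
  qform 1%:M v + \tr (S *m (A *m A)) + r^-1 * (qform S v + \tr (S *m A *m (S *m A)) / 2).

Lemma par_formE r S x : 0 < r -> posdefmx S ->
  par_form r S x x = par_value r S (uot_mean r S x.1) (uot_cov r S x.2).
Proof.
move=> r0 pS; rewrite /par_form {2}(uot_meanE x.1 r0 pS).
set v := uot_mean r S x.1; have := uot_covE x.2 r0 pS; set A := uot_cov r S x.2 => xA.
rewrite -[X in \tr (A *m X)]xA /uot_op !mulmxDr !raddfD/= -scalemxAr mxtraceZ.
rewrite bformDr bformZr bformMr mul1mx /par_value.
have -> : \tr (A *m (S *m A)) = \tr (S *m (A *m A)) by rewrite mxtrace_mulC !mulmxA.
have -> : \tr (A *m (A *m S)) = \tr (S *m (A *m A)) by rewrite mulmxA mxtrace_mulC.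
have -> : \tr (A *m (S *m A *m S)) = \tr (S *m A *m (S *m A)).
  by rewrite mxtrace_mulC !mulmxA.
by rewrite -[bform 1%:M v v]/(qform _ _) -[bform S v v]/(qform _ _); field; rewrite gt_eqF.
Qed.

(** A convex quadratic form lies above its tangent, here at [(v, S A + A S)]. Writing
    [K = S C + C S], the gap is [|u - v|^2 + \tr ((C - A) S (C - A))]. *)
Lemma gBW_ge S u K v A : posdefmx S -> K^T = K -> A^T = A ->
  2 * bform 1%:M v u + \tr (A *m K) - qform 1%:M v - \tr (S *m (A *m A)) <= gBW S (u, K).
Proof.
move=> pS sK sA; have [C sC ->] := lyapunov_solve pS sK.
rewrite /gBW/= lyapunov_invK// -qform1E.
have h1 := qform_ge0 (u + (-1) *: v) (posdef1 R d).
rewrite qformD ?trmx1// qformZ bformZr sqrrN expr1n mul1r (qform_symC _ _ (trmx1 R d)) in h1.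
have h2 := trace_congr_ge0 (C - A) pS (posdef1 R d).
have sCA : (C - A)^T = C - A by rewrite linearB/= sC sA.
rewrite sCA mulmx1 mxtrace_mulC mulmxBl !mulmxBr !raddfB/= in h2.
rewrite /lyapunov mulmxDl mulmxDr !raddfD/=.
have e1 : \tr (S *m C *m C) = \tr (S *m (C *m C)) by rewrite mulmxA.
have e2 : \tr (C *m S *m C) = \tr (S *m (C *m C)) by rewrite -mulmxA mxtrace_mulC -mulmxA.
have e3 : \tr (A *m (S *m C)) = \tr (S *m (C *m A)) by rewrite mxtrace_mulC !mulmxA.
have e4 : \tr (A *m (C *m S)) = \tr (S *m (A *m C)) by rewrite mulmxA mxtrace_mulC.
rewrite e1 e2 e3 e4; lra.
Qed.

(** The tangent inequality at [(S v / r, S A S / r)], with the same slope [(v, A)] as in [gBW_ge];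
    the gap is [r] times the Fisher-Rao form of the difference. *)
Lemma gFR_ge r S u K v A : 0 < r -> posdefmx S -> K^T = K -> A^T = A ->
  2 * bform 1%:M v u + \tr (A *m K)
    - r^-1 * (qform S v + \tr (S *m A *m (S *m A)) / 2) <= r * gFR S (u, K).
Proof.
move=> r0 pS sK sA; have pP := posdef_inv pS; have uS := posdef_unit pS.
have sS := pS.1; have sP := pP.1.
rewrite /gFR/= -/(qform _ _); set P := invmx S in pP sP *.
have h1 := qform_ge0 (u + (- r^-1) *: (S *m v)) pP.
rewrite qformD// qformZ bformZr sqrrN in h1.
have e1 : bform P u (S *m v) = bform 1%:M v u.
  by rewrite bformMr mulVmx// (qform_symC _ _ (trmx1 R d)).
have e2 : qform P (S *m v) = qform S v.
  by rewrite /qform -!/(bform _ _ _) bformMr mulVmx// bformMl mulmx1 sS.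
pose Y := K - r^-1 *: (S *m A *m S).
have sY : Y^T = Y by rewrite /Y linearB/= linearZ/= !trmx_mul sS sA sK mulmxA.
have h2 := trace_congr_ge0 Y pP pP.
have PY : P *m Y = P *m K - r^-1 *: (A *m S).
  by rewrite /Y mulmxBr -scalemxAr !mulmxA mulVmx// mul1mx.
have e3 : \tr (Y^T *m P *m Y *m P) =
    \tr (P *m K *m P *m K) - 2 * r^-1 * \tr (A *m K)
     + r^-1 ^+ 2 * \tr (S *m A *m (S *m A)).
  rewrite sY mxtrace_mulC !mulmxA -mulmxA PY mulmxBl !mulmxBr !raddfB/=.
  rewrite -!scalemxAl -!scalemxAr !mxtraceZ.
  have -> : \tr (P *m K *m (P *m K)) = \tr (P *m K *m P *m K) by rewrite !mulmxA.
  have -> : \tr (P *m K *m (A *m S)) = \tr (A *m K).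
    by rewrite mxtrace_mulC mulmxA -(mulmxA A) mulmxV// mulmx1.
  have -> : \tr (A *m S *m (P *m K)) = \tr (A *m K).
    by rewrite mulmxA -(mulmxA A) mulmxV// mulmx1.
  have -> : \tr (A *m S *m (A *m S)) = \tr (S *m A *m (S *m A)).
    by rewrite -mulmxA mxtrace_mulC !mulmxA.
  by rewrite !mulmxA; ring.
rewrite e3 in h2; rewrite e1 e2 in h1.
have := mulr_ge0 (ltW r0) (addr_ge0 h1 (divr_ge0 h2 (ler0n R 2))).
move=> h; rewrite -subr_ge0; apply: le_trans h _.
rewrite le_eqVlt; apply/orP; left; apply/eqP; field.
by rewrite gt_eqF.
Qed.

(** Since the two tangents have the same slope, the sum of [gBW_ge] and [gFR_ge] depends on [xi] and
    not on its splitting, which gives the lower bound. Both are equalities at the splitting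
    [(v, lyapunov S A)], so the infimum is attained. *)
Lemma parallel_sumE r S (xi : 'cV[R]_d * 'M[R]_d) : 0 < r -> posdefmx S ->
  gauss_tangent xi ->
  parallel_sum (@gauss_tangent R d) (gBW S) (fun z => r * gFR S z) xi = par_form r S xi xi.
Proof.
move=> r0 pS; case: xi => mu H /= sH; rewrite par_formE//=.
have sS := pS.1; have uS := posdef_unit pS.
have muE := uot_meanE mu r0 pS; have HE := uot_covE H r0 pS.
have sA := uot_cov_sym r0 pS sH.
move: (uot_mean _ _ _) (uot_cov _ _ _) muE HE sA => v A muE HE sA.
have lb : lbound [set gBW S eta + r * gFR S ((mu, H) - eta) | eta in @gauss_tangent R d]
    (par_value r S v A).
  move=> _ [[u K] /= sK <-].
  have sHK : (H - K)^T = H - K by rewrite linearB/= sH sK.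
  have h1 := gBW_ge u v pS sK sA; have h2 := gFR_ge (mu - u) v r0 pS sHK sA.
  apply: le_trans (lerD h1 h2).
  rewrite bformDr -[- u]scaleN1r bformZr mulmxBr raddfB/= /par_value.
  have -> : bform 1%:M v mu = qform 1%:M v + r^-1 * qform S v.
    by rewrite muE bformDr bformZr bformMr mul1mx.
  have -> : \tr (A *m H) = 2 * \tr (S *m (A *m A)) + r^-1 * \tr (S *m A *m (S *m A)).
    rewrite -HE /uot_op !mulmxDr !raddfD/= -scalemxAr mxtraceZ.
    have -> : \tr (A *m (S *m A)) = \tr (S *m (A *m A)) by rewrite mxtrace_mulC !mulmxA.
    have -> : \tr (A *m (A *m S)) = \tr (S *m (A *m A)) by rewrite mulmxA mxtrace_mulC.
    have -> : \tr (A *m (S *m A *m S)) = \tr (S *m A *m (S *m A)).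
      by rewrite mxtrace_mulC !mulmxA.
    by ring.
  by lra.
have mem : [set gBW S eta + r * gFR S ((mu, H) - eta) | eta in @gauss_tangent R d]
    (par_value r S v A).
  exists (v, lyapunov S A).
    by rewrite /gauss_tangent/= /lyapunov linearD/= !trmx_mul sA sS addrC.
  have -> : (mu, H) - (v, lyapunov S A) = (r^-1 *: (S *m v), r^-1 *: (S *m A *m S)).
    congr pair; first by rewrite muE addrC addKr.
    by rewrite -HE /uot_op addrC addKr.
  rewrite /gBW /gFR/= lyapunov_invK// -qform1E -/(qform _ _) qformZ.
  have -> : qform (invmx S) (S *m v) = qform S v.
    by rewrite /qform -!/(bform _ _ _) bformMr mulVmx// bformMl mulmx1 sS.
  rewrite -!scalemxAr -!scalemxAl !mxtraceZ !mulmxA mulVmx// mul1mx.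
  rewrite -(mulmxA A S) mulmxV// mulmx1.
  rewrite /lyapunov mulmxDl raddfD/= /par_value.
  have -> : \tr (S *m A *m A) = \tr (S *m (A *m A)) by rewrite mulmxA.
  have -> : \tr (A *m S *m A) = \tr (S *m (A *m A)) by rewrite -mulmxA mxtrace_mulC -mulmxA.
  have -> : \tr (A *m S *m A *m S) = \tr (S *m A *m (S *m A)).
    by rewrite mxtrace_mulC !mulmxA.
  by field; rewrite gt_eqF.
apply/eqP; rewrite eq_le; apply/andP; split.
  by apply: ge_inf => //; exists (par_value r S v A).
by apply: lb_le_inf => //; exists (par_value r S v A).
Qed.

End parallel_sum_closed_form.

(** * Matching the two bounds *)

Section expansion.
Variable R : realType.

Lemma mlim_uniq m n (M : R -> 'M[R]_(m, n)) N N' : mlim M N -> mlim M N' -> N = N'.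
Proof.
move=> MN MN'; apply/matrixP => i j.
exact: (cvg_unique _ (MN i j) (MN' i j)).
Qed.

(** Two real bounds with the same [e^2] coefficient force finiteness and the expansion away from 0;
    [U 0 = 0] extends both conclusions to a full neighbourhood. *)
Lemma lim0_near_sandwich (D1 D2 : R -> R) (U : R -> \bar R) (G : R) :
  lim0 (fun e => D1 e / e ^+ 2) G -> lim0 (fun e => D2 e / e ^+ 2) G ->
  (\forall e \near (0 : R)^', ((D1 e)%:E <= U e)%E) ->
  (\forall e \near (0 : R)^', (U e <= (D2 e)%:E)%E) ->
  U 0 = 0%E ->
  exists rem : R -> R, rem =o_ (0 : R) (fun e : R => e ^+ 2) /\
    \forall e \near (0 : R), U e = (e ^+ 2 * G + rem e)%:E.
Proof.
move=> D1G D2G D1U UD2 U0.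
have fin : \forall e \near (0 : R)^', U e = (fine (U e))%:E.
  apply: filterS2 D1U UD2 => e; case: (U e) => //=.
have at0 (P : R -> Prop) : P 0 -> (\forall e \near (0 : R)^', P e) -> \forall e \near (0 : R), P e.
  move=> P0 /near0P[r r0 rP]; apply/nbhs_ballP; exists r => //= e.
  rewrite /ball/= sub0r normrN => er.
  by have [->//|e0] := eqVneq e 0; exact: rP.
exists (fun e => fine (U e) - e ^+ 2 * G); split.
  apply/eqoP => eps eps0; apply: at0; first by rewrite U0/= expr0n mul0r subrr normr0 mulr0.
  have h1 : \forall e \near (0 : R)^', G - eps < D1 e / e ^+ 2.
    by apply: lim0_gt D1G; rewrite ltrBlDr ltrDl.
  have h2 : \forall e \near (0 : R)^', D2 e / e ^+ 2 < G + eps.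
    by apply: lim0_lt D2G; rewrite ltrDl.
  near=> e.
  have e0 : e != 0 by near: e; exact: near0_neq0.
  have e2 : 0 < e ^+ 2 by rewrite exprn_even_gt0.
  have fe : U e = (fine (U e))%:E by near: e.
  have : ((D1 e)%:E <= U e)%E by near: e.
  have : (U e <= (D2 e)%:E)%E by near: e.
  rewrite fe !lee_fin => u2 u1.
  have : G - eps < D1 e / e ^+ 2 by near: e.
  have : D2 e / e ^+ 2 < G + eps by near: e.
  rewrite ltr_pdivlMr// ltr_pdivrMr// => l2 l1.
  rewrite normrX real_normK ?num_real// ler_norml.
  by apply/andP; split; lra.
apply: at0; first by rewrite U0/= expr0n mul0r add0r subr0.
by apply: filterS fin => e; rewrite addrC subrK.
Unshelve. all: by end_near. Qed.

Lemma derive1_mlim m n (f : R -> 'M[R]_(m, n)) (D : 'M[R]_(m, n)) :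
  (fun h => h^-1 *: (f h - f 0)) @ (0 : R)^' --> D ->
  mlim (fun h => h^-1 *: (f h - f 0)) D.
Proof.
move=> fD i j.
have := cvg_comp _ (fun M : 'M[R]_(m, n) => M i j) fD (@coord_continuous R m n i j D).
exact.
Qed.

Section uot.
Variables (d : nat) (tau0 tau1 : R).
Hypotheses (tau0_gt0 : 0 < tau0) (tau1_gt0 : 0 < tau1).

Let r : R := tau0 * tau1 / (2 * (tau0 + tau1)).

Let r_gt0 : 0 < r.
Proof. by rewrite /r divr_gt0 ?mulr_gt0 ?addr_gt0. Qed.

Lemma gUOTE (a adot : R) (m mdot : 'cV[R]_d) (S H : 'M[R]_d) : posdefmx S -> H^T = H ->
  gUOT tau0 tau1 (a, (m, S)) (adot, (mdot, H)) =
  r / a * adot ^+ 2 + a * par_form r S (mdot, H) (mdot, H).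
Proof. by move=> pS sH; rewrite /gUOT/= parallel_sumE. Qed.

Lemma UOT_expansion (a adot : R) (m1 : R -> 'cV[R]_d) (S1 : R -> 'M[R]_d)
    (mdot : 'cV[R]_d) (H : 'M[R]_d) :
  0 < a -> posdefmx (S1 0) -> (\forall e \near (0 : R)^', posdefmx (S1 e)) ->
  mlim (fun e => e^-1 *: (m1 e - m1 0)) mdot ->
  mlim (fun e => e^-1 *: (S1 e - S1 0)) H ->
  exists rem : R -> R, rem =o_ (0 : R) (fun e : R => e ^+ 2) /\
    \forall e \near (0 : R),
      UOT tau0 tau1 (scaled_gaussian a (m1 0) (S1 0))
        (scaled_gaussian (a + e * adot) (m1 e) (S1 e))
      = (e ^+ 2 * gUOT tau0 tau1 (a, (m1 0, S1 0)) (adot, (mdot, H)) + rem e)%:E.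
Proof.
move=> a0 pS pS1 m1lim S1lim; set S := S1 0 in pS S1lim *; set m := m1 0.
have uS := posdef_unit pS; have sS := pS.1.
(* A limit of symmetric difference quotients is symmetric, so the tangent lies in
   [gauss_tangent]. *)
have sH : H^T = H.
  apply: mlim_uniq (mlim_trmx S1lim) _.
  apply: (mlim_near _ S1lim); apply: filterS pS1 => e pS1e.
  have h : (S1 e - S)^T = S1 e - S by rewrite linearB/= pS1e.1 sS.
  by rewrite [RHS]linearZ/= h.
pose v := uot_mean r S mdot; pose A := uot_cov r S H.
have sA : A^T = A by exact: uot_cov_sym.
have HE : uot_op r S A = H by exact: uot_covE.
have mE : mdot = v + r^-1 *: (S *m v) by exact: uot_meanE.
have rE : r^-1 = 2 / tau0 + 2 / tau1.
  by rewrite /r; field; rewrite !gt_eqF// addr_gt0.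
rewrite gUOTE// par_formE//= -/v -/A.
set G := _ + _.
(* This [s] makes [s + \tr (S *m A) / 2] equal to [r adot / a], which maximises the mass part of
   [dual_value]. *)
have [D1 D1lim D1U] := UOT_lower_bound tau0_gt0 tau1_gt0 adot a0 pS m1lim S1lim pS1
  (r * adot / a - \tr (S *m A) / 2) v sA.
pose K : 'M[R]_d := (2 / tau0) *: (S *m A *m S).
have sK : K^T = K by rewrite linearZ/= !trmx_mul sS sA mulmxA.
(* The absorbed displacement is split in inverse proportion to the penalties: [2 / tau0] on the
   source here, leaving [- 2 / tau1] on the target. The mass increment follows the same rule. *)
have [D2 D2lim UD2] := UOT_upper_bound tau0 tau1 adot a0 pS m1lim S1lim pS1
  (2 * r * adot / tau0) ((2 / tau0) *: (S *m v)) v sK sA.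
apply: (lim0_near_sandwich _ _ D1U UD2); last by rewrite mul0r addr0 UOT_diag.
- apply: (lim0_eq _ D1lim); rewrite /dual_value /G /par_value.
  have -> : \tr (H *m A) = 2 * \tr (S *m (A *m A)) + r^-1 * \tr (S *m A *m (S *m A)).
    rewrite -HE /uot_op !mulmxDl !raddfD/= -scalemxAl mxtraceZ.
    have -> : \tr (S *m A *m A) = \tr (S *m (A *m A)) by rewrite mulmxA.
    have -> : \tr (A *m S *m A) = \tr (S *m (A *m A)) by rewrite -mulmxA mxtrace_mulC -mulmxA.
    have -> : \tr (S *m A *m S *m A) = \tr (S *m A *m (S *m A)) by rewrite !mulmxA.
    by ring.
  have -> : dotv v mdot = qform 1%:M v + r^-1 * qform S v.
    by rewrite /dotv mE bformDr bformZr bformMr mul1mx.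
  have -> : 4 / tau0 + 4 / tau1 = 2 / r by rewrite rE; field; rewrite !gt_eqF.
  by field; rewrite !gt_eqF.
apply: (lim0_eq _ D2lim); rewrite /primal_value /G /par_value.
have -> : 2 / tau0 *: (S *m v) + v - mdot = - (2 / tau1) *: (S *m v).
  rewrite mE rE scalerDl scaleNr; move: (_ *: _) (_ *: _) => X Y.
  by apply/matrixP => i j; rewrite !mxE; ring.
have -> : K + (A *m S + S *m A) - H = - (2 / tau1) *: (S *m A *m S).
  rewrite -HE /uot_op /K rE scalerDl scaleNr.
  move: (S *m A) (A *m S) (_ *: _) (_ *: _) => X Y Z W.
  by apply/matrixP => i j; rewrite !mxE; ring.
have trE c : \tr (invmx S *m (c *: (S *m A *m S)) *m (invmx S *m (c *: (S *m A *m S)))) =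
    c ^+ 2 * \tr (S *m A *m (S *m A)).
  rewrite -!scalemxAr -!scalemxAl !mxtraceZ !mulmxA mulVmx// mul1mx.
  rewrite -(mulmxA (A *m S)) mulVmx// mulmx1 mulrA -expr2; congr (_ * _).
  by rewrite mxtrace_mulC !mulmxA.
have qE c : qform (invmx S) (c *: (S *m v)) = c ^+ 2 * qform S v.
  rewrite qformZ; congr (_ * _).
  by rewrite /qform -!/(bform _ _ _) bformMr mulVmx// bformMl mulmx1 sS.
rewrite /K !trE !qE rE.
have -> : r = tau0 * tau1 / (2 * (tau0 + tau1)) by [].
by field; rewrite !gt_eqF// addr_gt0.
Qed.

End uot.
End expansion.

(** * Smoothness of the metric *)

Section directional_derivatives.
Variables (R : realType) (V : normedModType R).
Implicit Types (f g : V -> R) (x v : V).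

Definition line_deriv f x v (l : R) := lim0 (fun h => h^-1 * (f (h *: v + x) - f x)) l.

Lemma line_derivP f x v l : line_deriv f x v l -> derivable f x v /\ 'D_v f x = l.
Proof.
move=> fl; split; first by apply/cvg_ex; exists l; exact: fl.
exact: (cvg_lim (@Rhausdorff R) fl).
Qed.

Lemma line_deriv_cvg f x v l : line_deriv f x v l -> lim0 (fun h => f (h *: v + x)) (f x).
Proof.
move=> fl; apply: (lim0_ext (f := fun h => h * (h^-1 * (f (h *: v + x) - f x)) + f x)).
  by move=> h h0; rewrite mulrA mulfV// mul1r subrK.
by apply: (lim0_eq _ (lim0D (lim0M (@lim0_id R) fl) (lim0_cst _))); rewrite mul0r add0r.
Qed.

Variables (T U : set V).
Hypothesis Uline : forall x v, U x -> T v -> \forall h \near (0 : R)^', U (h *: v + x).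

(* Functions that agree on [U] with a rational expression in continuous linear forms whose
   denominators do not vanish on [U]. *)
Inductive rational : (V -> R) -> Prop :=
| rational_cst (k : R) : rational (fun=> k)
| rational_lin f : continuous f -> (forall h v x, f (h *: v + x) = h * f v + f x) -> rational f
| rational_add f g : rational f -> rational g -> rational (fun x => f x + g x)
| rational_mul f g : rational f -> rational g -> rational (fun x => f x * g x)
| rational_inv f : (forall x, U x -> f x != 0) -> rational f -> rational (fun x => (f x)^-1)
| rational_eq f g : (forall x, U x -> f x = g x) -> rational f -> rational g.

Lemma rational_continuous f : rational f -> {within U, continuous f}.
Proof.
move=> rf; apply/subspace_continuousP.
elim: {f} rf => [k|f cf _|f g _ cf _ cg|f g _ cf _ cg|f f0 _ cf|f g fg _ cf] x Ux.
- exact: cvg_cst.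
- by apply: cvg_trans (cf x); apply: cvg_app; exact: cvg_within.
- by apply: cvgD; [exact: cf|exact: cg].
- by apply: cvgM; [exact: cf|exact: cg].
- by apply: cvgV; [exact: f0|exact: cf].
- suff : g @ within U (nbhs x) --> f x by rewrite fg.
  apply: cvg_trans _ (cf x Ux).
  by apply: fmap_within_eq => y; rewrite inE => Uy; exact/esym/fg.
Qed.

(** The class is stable under directional derivatives, which is what the induction on the order of
    smoothness consumes. *)
Lemma rational_deriv f v : T v -> rational f ->
  exists2 g, rational g & forall x, U x -> line_deriv f x v (g x).
Proof.
move=> Tv; elim=> {f} [k|f cf lf|f g _ [f' rf' df] _ [g' rg' dg]
    |f g rf [f' rf' df] rg [g' rg' dg]|f f0 rf [f' rf' df]|f g fg rf [f' rf' df]].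
- exists (fun=> 0); first exact: rational_cst.
  by move=> x _; rewrite /line_deriv; under eq_fun do rewrite subrr mulr0; exact: lim0_cst.
- exists (fun=> f v); first exact: rational_cst.
  move=> x _; apply: (lim0_ext _ (lim0_cst (f v))) => h h0.
  by rewrite lf addrK mulKf.
- exists (fun x => f' x + g' x); first exact: rational_add.
  move=> x Ux; apply: (lim0_ext _ (lim0D (df x Ux) (dg x Ux))) => h h0.
  by ring.
- exists (fun x => f' x * g x + f x * g' x).
    by apply: rational_add; exact: rational_mul.
  move=> x Ux; have gx := line_deriv_cvg (dg x Ux).
  apply: (lim0_ext _ (lim0D (lim0M (df x Ux) gx) (lim0M (lim0_cst (f x)) (dg x Ux)))) => h h0.
  by ring.
- exists (fun x => - 1 * f' x * ((f x)^-1 * (f x)^-1)).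
    apply: rational_mul; first by apply: rational_mul => //; exact: rational_cst.
    by apply: rational_mul; exact: rational_inv.
  move=> x Ux; have fx := line_deriv_cvg (df x Ux).
  have ifx := lim0V (f0 x Ux) fx.
  apply: (lim0_near _ (lim0M (lim0M (lim0_cst (-1)) (df x Ux)) (lim0M ifx (lim0_cst (f x)^-1)))).
  have fn0 : \forall h \near (0 : R)^', f (h *: v + x) != 0.
    by apply: (cvgr_neq0 (f x)) => //; exact: f0.
  apply: filterS2 fn0 (near0_neq0 R) => h fh h0.
  by field; rewrite fh f0// h0.
(* Equality on [U] passes to derivatives because [Uline] keeps short segments in directions of [T]
   inside [U]. *)
- exists f' => // x Ux; apply: (lim0_near _ (df x Ux)).
  by apply: filterS (Uline Ux Tv) => h Uh; rewrite !fg.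
Qed.

Lemma rational_smooth f : rational f -> smooth_on T U f.
Proof.
move=> rf n; elim: n f rf => [|n IH] f rf /=; split=> //; try exact: rational_continuous.
move=> v Tv; have [g rg dg] := rational_deriv Tv rf; split.
  by move=> x Ux; have [] := line_derivP (dg x Ux).
apply: IH; apply: rational_eq rg => x Ux.
by have [_ ->] := line_derivP (dg x Ux).
Qed.

Lemma rational_sum (I : Type) (r : seq I) (P : pred I) (F : I -> V -> R) :
  (forall i, rational (F i)) -> rational (fun x => \sum_(i <- r | P i) F i x).
Proof.
move=> rF; elim: r => [|i r IH].
  by under eq_fun do rewrite big_nil; exact: rational_cst.
under eq_fun do rewrite big_cons.
by case: (P i) => //; exact: rational_add.
Qed.

Lemma rational_prod (I : Type) (r : seq I) (P : pred I) (F : I -> V -> R) :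
  (forall i, rational (F i)) -> rational (fun x => \prod_(i <- r | P i) F i x).
Proof.
move=> rF; elim: r => [|i r IH].
  by under eq_fun do rewrite big_nil; exact: rational_cst.
under eq_fun do rewrite big_cons.
by case: (P i) => //; exact: rational_mul.
Qed.

Definition rational_mx m n (M : V -> 'M[R]_(m, n)) := forall i j, rational (fun x => M x i j).

Lemma rational_mx_cst m n (N : 'M[R]_(m, n)) : rational_mx (fun=> N).
Proof. by move=> i j; exact: rational_cst. Qed.

Lemma rational_mxD m n (M N : V -> 'M[R]_(m, n)) :
  rational_mx M -> rational_mx N -> rational_mx (fun x => M x + N x).
Proof. by move=> rM rN i j; under eq_fun do rewrite mxE; exact: rational_add. Qed.

Lemma rational_mxZ m n f (M : V -> 'M[R]_(m, n)) :
  rational f -> rational_mx M -> rational_mx (fun x => f x *: M x).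
Proof. by move=> rf rM i j; under eq_fun do rewrite mxE; exact: rational_mul. Qed.

Lemma rational_mxM m n p (M : V -> 'M[R]_(m, n)) (N : V -> 'M[R]_(n, p)) :
  rational_mx M -> rational_mx N -> rational_mx (fun x => M x *m N x).
Proof.
move=> rM rN i j; under eq_fun do rewrite mxE.
by apply: rational_sum => k; exact: rational_mul.
Qed.

Lemma rational_det n (M : V -> 'M[R]_n) : rational_mx M -> rational (fun x => \det (M x)).
Proof.
move=> rM; rewrite /determinant; apply: rational_sum => s.
by apply: rational_mul; [exact: rational_cst|apply: rational_prod => i; exact: rM].
Qed.

Lemma rational_mxV n (M : V -> 'M[R]_n) : (forall x, U x -> M x \in unitmx) ->
  rational_mx M -> rational_mx (fun x => invmx (M x)).
Proof.
move=> uM rM i j; have rd := rational_det rM.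
apply: (rational_eq (f := fun x => (\det (M x))^-1 * (\adj (M x)) i j)).
  by move=> x Ux; rewrite /invmx uM// [RHS]mxE.
apply: rational_mul.
  by apply: rational_inv => // x Ux; have := uM x Ux; rewrite unitmxE unitfE.
under eq_fun do rewrite mxE; apply: rational_mul; first exact: rational_cst.
by apply: rational_det => k l; under eq_fun do rewrite !mxE; exact: rM.
Qed.

Lemma rational_mxtrace n (M : V -> 'M[R]_n) : rational_mx M -> rational (fun x => \tr (M x)).
Proof. by move=> rM; apply: rational_sum => i; exact: rM. Qed.

End directional_derivatives.

(** * The Riemannian tensor *)

Section riemannian.
Variables (R : realType) (d : nat) (tau0 tau1 : R).
Hypotheses (tau0_gt0 : 0 < tau0) (tau1_gt0 : 0 < tau1).

Let r : R := tau0 * tau1 / (2 * (tau0 + tau1)).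

Let r_gt0 : 0 < r.
Proof. by rewrite /r divr_gt0 ?mulr_gt0 ?addr_gt0. Qed.

Notation chart := (R * ('cV[R]_d * 'M[R]_d))%type.
Notation U := (@scaled_gaussians R d).
Notation T := (@scaled_gauss_tangent R d).

Definition uot_metric (p x y : chart) : R :=
  r / p.1 * (x.1 * y.1) + p.1 * par_form r p.2.2 x.2 y.2.

Lemma scaled_gaussians_line (x v : chart) : U x -> T v ->
  \forall h \near (0 : R)^', U (h *: v + x).
Proof.
case: x v => [a [m S]] [a' [m' K]] [/= a0 pS] sK.
have ahlim : lim0 (fun h => h * a' + a) a.
  apply: (lim0_eq _ (lim0D (lim0M (@lim0_id R) (lim0_cst a')) (lim0_cst a))).
  by rewrite mul0r add0r.
have Klim : mlim (fun h => h *: K) 0.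
  by apply: (mlim_eq _ (mlimZ (@lim0_id R) (mlim_cst K))); rewrite scale0r.
have symK : \forall h \near (0 : R)^', (h *: K)^T = h *: K.
  by near=> h; rewrite linearZ/= sK.
apply: filterS2 (lim0_gt a0 ahlim) (posdef_near pS symK Klim) => h ah Sh.
by split=> //=; rewrite addrC.
Unshelve. all: by end_near. Qed.

(** The matrix [1 + S / r] is symmetric and [uot_op r S] is self-adjoint for the trace pairing, so
    their inverses are too. *)
Lemma par_form_sym S (x y : 'cV[R]_d * 'M[R]_d) : posdefmx S ->
  gauss_tangent x -> gauss_tangent y -> par_form r S x y = par_form r S y x.
Proof.
move=> pS sx sy; rewrite /par_form.
have pI := posdef_inv (posdef_mean r_gt0 pS).
congr (_ + _ / 2).
  rewrite /uot_mean !bformMl !mulmx1 pI.1.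
  exact/qform_symC/pI.1.
have xE := uot_covE x.2 r_gt0 pS; have yE := uot_covE y.2 r_gt0 pS.
rewrite -[X in \tr (_ *m X) = _]yE -[X in _ = \tr (_ *m X)]xE.
move: (uot_cov _ _ _) (uot_cov _ _ _) => X Y.
rewrite /uot_op !mulmxDr !raddfD/= -!scalemxAr !mxtraceZ; congr (_ + _ * _).
  rewrite addrC; congr (_ + _).
    by rewrite mxtrace_mulC -mulmxA.
  by rewrite mulmxA mxtrace_mulC.
by rewrite mxtrace_mulC -!mulmxA mxtrace_mulC !mulmxA.
Qed.

Lemma par_form_linear S c (x y z : 'cV[R]_d * 'M[R]_d) :
  par_form r S (c *: x + y) z = c * par_form r S x z + par_form r S y z.
Proof.
rewrite /par_form /= /uot_mean /uot_cov mulmxDr -scalemxAr bformDl bformZl.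
rewrite linearP/= mulmxDl -scalemxAl linearP/= mulmxDl -scalemxAl mxtraceD mxtraceZ.
by field.
Qed.

(** The mean part is positive as the form of an inverse of a definite matrix; the covariance part
    equals [\tr (A^T *m uot_op r S A)] with [A] the solution for [x.2]. *)
Lemma par_form_gt0 S (x : 'cV[R]_d * 'M[R]_d) : posdefmx S -> gauss_tangent x ->
  x != 0 -> 0 < par_form r S x x.
Proof.
move=> pS sx x0; have pI := posdef_inv (posdef_mean r_gt0 pS).
have m0 : x.1 != 0 -> 0 < bform 1%:M (uot_mean r S x.1) x.1.
  by move=> x10; rewrite bformMl mulmx1 pI.1; exact: pI.2.
have H0 : x.2 != 0 -> 0 < \tr (uot_cov r S x.2 *m x.2).
  move=> x20; have xE := uot_covE x.2 r_gt0 pS.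
  rewrite -[X in \tr (_ *m X)]xE -{1}(uot_cov_sym r_gt0 pS sx).
  apply: uot_op_trace_gt0 => //; first exact: ltW.
  apply: contra_neq x20 => X0; rewrite -xE X0 /uot_op.
  by rewrite mulmx0 !mul0mx scaler0 !addr0.
rewrite /par_form; have [x10|x10] := eqVneq x.1 0.
  have x20 : x.2 != 0.
    by apply: contra_neq x0 => x20; rewrite [x]surjective_pairing x10 x20.
  rewrite x10 /bform mulmx0 mxE add0r divr_gt0//; exact: H0.
have [x20|x20] := eqVneq x.2 0; last by rewrite addr_gt0 ?m0// divr_gt0// H0.
by rewrite x20 mulmx0 mxtrace0 mul0r addr0 m0.
Qed.

Lemma uot_metric_rational x y : rational U (fun p => uot_metric p x y).
Proof.
have rfst : rational U (fun p : chart => p.1).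
  by apply: rational_lin => // p; exact: cvg_fst.
have rS : rational_mx U (fun p : chart => p.2.2).
  move=> i j; apply: rational_lin => [p|h v p]; last by rewrite !mxE.
  have h : (fun q : chart => q.2.2) @ p --> p.2.2.
    by apply: (@continuous_comp _ _ _ snd snd); exact: cvg_snd.
  exact: (cvg_comp _ (fun M : 'M[R]_d => M i j) h (@coord_continuous R d d i j p.2.2)).
have rop X : rational_mx U (fun p : chart => uot_op r p.2.2 X).
  have rX := rational_mx_cst U X.
  apply: rational_mxD; first by apply: rational_mxD; exact: rational_mxM.
  apply: rational_mxZ; first exact: rational_cst.
  by apply: rational_mxM => //; exact: rational_mxM.
apply: rational_add.
  apply: rational_mul; last exact: rational_cst.
  apply: rational_mul; first exact: rational_cst.
  by apply: rational_inv => // p [p0 _]; rewrite gt_eqF.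
apply: rational_mul => //; apply: rational_add.
  have rm : rational_mx U (fun p : chart => uot_mean r p.2.2 x.2.1).
    apply: rational_mxM; last exact: rational_mx_cst.
    apply: rational_mxV.
      by move=> p [_ pS]; exact/posdef_unit/(posdef_mean r_gt0 pS).
    apply: rational_mxD; first exact: rational_mx_cst.
    by apply: rational_mxZ => //; exact: rational_cst.
  rewrite /bform; apply: (rational_mxM (rational_mxM _ _) _ 0 0).
  - by move=> i j; under eq_fun do rewrite mxE; exact: rm.
  - exact: rational_mx_cst.
  - exact: rational_mx_cst.
apply: rational_mul; last exact: rational_cst.
apply: rational_mxtrace; apply: rational_mxM; last exact: rational_mx_cst.
(* The entries of this matrix are entries of [uot_op] at fixed basis matrices, so they depend
   polynomially on the covariance. *)
have rlin : rational_mx U (fun p : chart => lin_mx (uot_op r p.2.2)).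
  move=> i j; under eq_fun do rewrite !mxE; case/mxvec_indexP: j => k l.
  by under eq_fun do rewrite /= mxvecE; exact: rop.
have rinv : rational_mx U (fun p : chart => invmx (lin_mx (uot_op r p.2.2))).
  apply: rational_mxV => // p [_ pS]; apply: lin_mx_unit => X.
  by apply: uot_op_inj => //; exact: ltW.
move=> i j; rewrite /uot_cov; under eq_fun do rewrite mxE.
exact: (rational_mxM (rational_mx_cst U _) rinv).
Qed.

Lemma uot_riemannian_metric : riemannian_metric T U uot_metric.
Proof.
split.
- move=> p [_ pS] x y sx sy; rewrite /uot_metric (par_form_sym pS sx sy).
  by rewrite (mulrC x.1).
- move=> p _ c x y z _ _ _; rewrite /uot_metric/= par_form_linear.
  by rewrite /GRing.scale/=; ring.
- move=> p [p0 pS] x sx x0; rewrite /uot_metric.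
  have rp : 0 < r / p.1 by rewrite divr_gt0.
  have [x20|x20] := eqVneq x.2 0.
    have x10 : x.1 != 0.
      by apply: contra_neq x0 => x10; rewrite [x]surjective_pairing x10 x20.
    rewrite ltr_wpDr//; last by rewrite mulr_gt0// -expr2 exprn_even_gt0.
    have [x21 x22] : x.2.1 = 0 /\ x.2.2 = 0 by rewrite x20.
    by rewrite /par_form x21 x22 /bform !mulmx0 mxE mxtrace0 mul0r addr0 mulr0.
  rewrite ltr_wpDl//; first by rewrite -expr2 mulr_ge0 ?sqr_ge0// ltW.
  by rewrite mulr_gt0// par_form_gt0.
- by move=> x y _ _; apply: rational_smooth (uot_metric_rational x y) => p v; exact: scaled_gaussians_line.
Qed.

Lemma uot_metricE p xi : U p -> T xi -> uot_metric p xi xi = gUOT tau0 tau1 p xi.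
Proof.
move: p xi => [a [m S]] [adot [mdot H]] [/= a0 pS] sH.
by rewrite gUOTE// /uot_metric/= expr2.
Qed.

End riemannian.

Theorem theorem4p3 (R : realType) (d : nat) (tau0 tau1 : R)
    (tau0_gt0 : 0 < tau0) (tau1_gt0 : 0 < tau1) :
  (forall (a adot delta : R) (mu : R -> 'cV[R]_d * 'M[R]_d)
      (xi : 'cV[R]_d * 'M[R]_d),
    0 < a -> 0 < delta ->
    (forall e, e \in `]-delta, delta[ -> posdefmx (mu e).2) ->
    smooth_curve [set` `]-delta, delta[] mu ->
    derive1 mu 0 = xi ->
    exists rem : R -> R,
      rem =o_ (0 : R) (fun e : R => e ^+ 2) /\
      \forall e \near (0 : R),
        UOT tau0 tau1
          (scaled_gaussian a (mu 0).1 (mu 0).2)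
          (scaled_gaussian (a + e * adot) (mu e).1 (mu e).2)
        = (e ^+ 2 * gUOT tau0 tau1 (a, mu 0) (adot, xi) + rem e)%:E) /\
  (exists g : R * ('cV[R]_d * 'M[R]_d) -> R * ('cV[R]_d * 'M[R]_d) ->
              R * ('cV[R]_d * 'M[R]_d) -> R,
    riemannian_metric (@scaled_gauss_tangent R d) (@scaled_gaussians R d) g /\
    forall p xi, scaled_gaussians p -> scaled_gauss_tangent xi ->
      g p xi xi = gUOT tau0 tau1 p xi).
Proof.
split; last first.
  exists (uot_metric tau0 tau1); split; first exact: uot_riemannian_metric.
  by move=> p xi; exact: uot_metricE.
move=> a adot delta mu xi a0 delta0 posmu smu dmu.
have mem0 : (0 : R) \in `]-delta, delta[ by rewrite in_itv/= oppr_lt0 delta0.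
(* Derivability at 0 turns [derive1], defined through [lim], into a genuine convergence of
   difference quotients. *)
have dmu0 : (fun h => h^-1 *: (mu h - mu 0)) @ (0 : R)^' --> xi.
  have := smu 0 0 mem0; rewrite -dmu /derivable /derive1 /= => cv.
  have E : (fun h : R => h^-1 *: (mu (h *: 1 + 0) - mu 0)) =
      (fun h => h^-1 *: (mu h - mu 0)).
    by apply/funext => h; rewrite addr0 /GRing.scale/= mulr1.
  by under [X in lim (X @ _)]eq_fun do rewrite addr0; rewrite -E.
have d1 : (fun h => h^-1 *: ((mu h).1 - (mu 0).1)) @ (0 : R)^' --> xi.1.
  have h : fst @ xi --> xi.1 by exact: cvg_fst.
  exact: (cvg_comp _ fst dmu0 h).
have d2 : (fun h => h^-1 *: ((mu h).2 - (mu 0).2)) @ (0 : R)^' --> xi.2.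
  have h : snd @ xi --> xi.2 by exact: cvg_snd.
  exact: (cvg_comp _ snd dmu0 h).
have pos : \forall e \near (0 : R)^', posdefmx (mu e).2.
  apply: nbhs_dnbhs; apply/nbhs_ballP; exists delta => //= e.
  by rewrite /ball/= sub0r normrN => ed; apply: posmu; rewrite in_itv/= -ltr_norml.
have := UOT_expansion tau0_gt0 tau1_gt0 adot (m1 := fun e => (mu e).1) (S1 := fun e => (mu e).2)
  a0 (posmu 0 mem0) pos (derive1_mlim d1) (derive1_mlim d2).
by rewrite -!surjective_pairing.
Qed.
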